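(* Let $n>2$, let $\alpha$ be an Einstein metric with Ricci constant $\mu$ on an $n$-dimensional manifold, and let $\beta$ be a Killing form of $\alpha$ with non-constant length satisfying $$t_{00}+(a^2-\mu b^2)\alpha^2+\mu(b^2\alpha^2-\beta^2)-\frac{\mu}{a^2-\mu b^2}s_0^2=0,\qquad R_{bb}=\mu(b^2\alpha^2-\beta^2),$$ where $a\neq0$ is a constant. Let $\bar\alpha=e^{\rho(b^2)}\sqrt{\alpha^2-\kappa(b^2)\beta^2}$, $\bar\beta=\nu(b^2)\beta$, and $\Delta:=1-b^2\kappa$. Then $\bar\alpha$ has constant Ricci curvature $\bar\mu$ and $\bar\beta$ satisfies $$\bar R_{\bar b\bar b}=\bar\mu(\bar b^2\bar\alpha^2-\bar\beta^2)$$ if and only if $\Delta\equiv1$ and, for some constants $C$ and $D$, $$\rho(b^2)=-\ln(C+Db^2),\quad\bar\mu=4CDa^2\qquad\text{when }\mu=0,$$ $$\rho(b^2)=-\ln\big(C+D\sqrt{a^2-\mu b^2}\big),\quad\bar\mu=(C^2-D^2a^2)\mu\qquad\text{when }\mu\neq0.$$ Moreover, in this case, when $\nu=k(1-b^2\kappa)e^{2\rho}$ with $k$ a non-zero constant, $\bar\beta$ is a Killing form of $\bar\alpha$ and satisfies $$\bar t_{00}+(\bar a^2-\bar\mu\bar b^2)\bar\alpha^2+\bar\mu(\bar b^2\bar\alpha^2-\bar\beta^2)-\frac{\bar\mu}{\bar a^2-\bar\mu\bar b^2}\bar s_0^2=0,$$ in which $\bar a=\pm ka$.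
   Context: Setting: $M$ is a smooth connected $n$-manifold, $\alpha=\sqrt{a_{ij}(x)y^iy^j}$ is a Riemannian metric on $M$ (viewed as a function of tangent vectors $y$), $\beta=b_i(x)y^i$ is a 1-form, $b:=\|\beta\|_\alpha$. A bar ''$|$'' denotes covariant derivative with respect to the Levi-Civita connection of $\alpha$; indices are raised and lowered with $a_{ij}$. A 1-form is a Killing form if its dual vector field is Killing, i.e. $b_{i|j}+b_{j|i}=0$. Put $s_{ij}:=\frac12(b_{i|j}-b_{j|i})$, $s_i:=b^ms_{mi}$, $s_0:=s_iy^i$, $t_{ij}:=s_{im}s^m{}_j$, $t_{00}:=t_{ij}y^iy^j$. At points where $a^2-\mu b^2=0$ the term $s_0^2/(a^2-\mu b^2)$ is understood as its limit (similarly for barred quantities). Curvature: $R^i{}_k=R^i{}_k(y)$ denotes the Riemann curvature of $\alpha$, quadratic in $y$, normalized so that constant sectional curvature $\mu$ means $R^i{}_k=\mu(\alpha^2\delta^i{}_k-y^iy_k)$; $R_{bb}:=R^i{}_kb_ib^k$. Constant Ricci curvature $\mu$ (equivalently, Einstein with Ricci constant $\mu$) means $Ric_{ij}y^iy^j=R^k{}_k=(n-1)\mu\alpha^2$ with $\mu$ constant. Deformation: $\rho,\kappa,\nu$ are smooth functions of the single variable $b^2$, and $\Delta=1-b^2\kappa$ is assumed positive (so that $\bar\alpha$ is a Riemannian metric). The barred quantities $\bar b=\|\bar\beta\|_{\bar\alpha}$, $\bar R_{\bar b\bar b}$, $\bar t_{00}$, $\bar s_0$ are the same objects formed from the pair $(\bar\alpha,\bar\beta)$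 (with $\bar\alpha$'s own Levi-Civita connection, curvature and index raising). $C,D$ are such that the arguments of the logarithms are positive. ($\bar a$ is a constant, not to be confused with the metric $\bar\alpha$.)
   Formalization: The function ν is assumed to be non-zero at every value of b²; with ν = 0 the condition on R̄ is void and the ''only if'' part fails (Fubini–Study metric as a deformation of flat C^m with Δ not identically 1). *)

(* Defs.v *)
From mathcomp Require Import all_boot all_order all_algebra.
From mathcomp Require Import all_classical all_reals all_analysis.
From mathcomp Require Import ring.
Set Implicit Arguments.
Unset Strict Implicit.
Unset Printing Implicit Defensive.
Import Order.TTheory GRing.Theory Num.Theory numFieldNormedType.Exports.
Local Open Scope classical_set_scope.
Local Open Scope ring_scope.

Section smoothness.
Context {R : realType} {n : nat}.
Implicit Types f : 'rV[R]_n -> R.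

Definition partial (k : 'I_n) f : 'rV[R]_n -> R :=
  fun p => 'D_(delta_mx 0 k : 'rV[R]_n) f p.

Definition partials (s : seq 'I_n) f : 'rV[R]_n -> R := foldr partial f s.

(* C^oo: all iterated partial derivatives exist and are continuous on U (which
   is an open set in all uses below). *)
Definition smooth_on (U : set 'rV[R]_n) f : Prop :=
  forall (s : seq 'I_n) (p : 'rV[R]_n), U p ->
    {for p, continuous (partials s f)} /\
    forall k : 'I_n, derivable (partials s f) p (delta_mx 0 k : 'rV[R]_n).

Definition smooth_on_line (J : set R) (f : R -> R) : Prop :=
  forall (m : nat) (t : R), J t -> derivable (derive1n m f) t 1.

End smoothness.

(* An n-dimensional smooth manifold structure on M, given by a smooth atlas:
   [chart i] is the coordinate map on the open set [dom i] and [par i] its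
   inverse on the open set [chart i @` dom i]. *)
Record smooth_manifold (R : realType) (n : nat) (M : topologicalType) := {
  chart_index : Type ;
  dom : chart_index -> set M ;
  chart : chart_index -> M -> 'rV[R]_n ;
  par : chart_index -> 'rV[R]_n -> M ;
  manifold_hausdorff : hausdorff_space M ;
  manifold_countable : @second_countable M ;
  dom_open : forall i, open (dom i) ;
  image_open : forall i, open (chart i @` dom i) ;
  dom_cover : \bigcup_i dom i = [set: M] ;
  chartK : forall i x, dom i x -> par i (chart i x) = x ;
  chart_continuous : forall i, {within dom i, continuous (chart i)} ;
  par_continuous : forall i,
    {within chart i @` dom i, continuous (par i)} ;
  transition_smooth : forall (i j : chart_index) (k : 'I_n),
    smooth_on [set p | (chart i @` dom i) p /\ dom j (par i p)]
              (fun p => chart j (par i p) 0 k)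
}.

(* Tensor calculus in one coordinate chart: g p is the matrix (a_ij(p)) and
   b p the row (b_i(p)).  An upper index in the mathematical notation comes
   first among the arguments. *)
Section local_geometry.
Context {R : realType} {n : nat}.
Implicit Types (g : 'rV[R]_n -> 'M[R]_n) (b : 'rV[R]_n -> 'rV[R]_n).
Implicit Types (p y : 'rV[R]_n) (i j k l m : 'I_n).

Definition ginv g p : 'M[R]_n := invmx (g p).

Definition alpha2 g p y : R := \sum_i \sum_j g p i j * y 0 i * y 0 j.
Definition alpha g p y : R := Num.sqrt (alpha2 g p y).
Definition beta b p y : R := \sum_i b p 0 i * y 0 i.

Definition bup g b p m : R := \sum_l ginv g p m l * b p 0 l.
Definition normsq g b p : R := \sum_i b p 0 i * bup g b p i.
Definition norm g b p : R := Num.sqrt (normsq g b p).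

Definition christoffel g p m i j : R :=
  2^-1 * \sum_l ginv g p m l *
    (partial i (fun q => g q j l) p + partial j (fun q => g q i l) p
     - partial l (fun q => g q i j) p).

(* b_{i|j} *)
Definition covd g b p i j : R :=
  partial j (fun q => b q 0 i) p - \sum_m christoffel g p m i j * b p 0 m.

Definition sij g b p i j : R := 2^-1 * (covd g b p i j - covd g b p j i).
Definition s_ g b p i : R := \sum_m bup g b p m * sij g b p m i.
Definition s0 g b p y : R := \sum_i s_ g b p i * y 0 i.
Definition tij g b p i j : R :=
  \sum_m \sum_l sij g b p i m * ginv g p m l * sij g b p l j.
Definition t00 g b p y : R := \sum_i \sum_j tij g b p i j * y 0 i * y 0 j.

(* R_j^i_kl, where R(e_k, e_l) e_j = sum_i R_j^i_kl e_i. *)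
Definition riemann g p i j k l : R :=
  partial k (fun q => christoffel g q i j l) p
  - partial l (fun q => christoffel g q i j k) p
  + \sum_m (christoffel g p i k m * christoffel g p m j l
            - christoffel g p i l m * christoffel g p m j k).

(* R^i_k(y) = R_j^i_kl y^j y^l; with this choice constant sectional curvature
   mu reads R^i_k = mu (alpha^2 delta^i_k - y^i y_k). *)
Definition Rik g p y i k : R :=
  \sum_j \sum_l riemann g p i j k l * y 0 j * y 0 l.
Definition ricci g p y : R := \sum_k Rik g p y k k.
Definition Rbb g b p y : R :=
  \sum_i \sum_k Rik g p y i k * b p 0 i * bup g b p k.

End local_geometry.

(* v is the value at p of the quotient N / D, understood as its limit (along
   the points where D does not vanish, which have to accumulate at p) when
   D p = 0. *)
Definition quotient_value (R : realType) (n : nat) (N D : 'rV[R]_n -> R)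
    (p : 'rV[R]_n) (v : R) : Prop :=
  (D p != 0 -> v = N p / D p) /\
  (D p = 0 -> closure [set q | D q != 0] p /\
     (fun q => N q / D q) @ within [set q | D q != 0] (nbhs p) --> v).

Section global_geometry.
Context {R : realType} {n : nat} {M : topologicalType}.
Variable A : smooth_manifold R n M.

(* A tensor field is the family of its components in the charts of the atlas. *)
Definition form_field := chart_index A -> 'rV[R]_n -> 'rV[R]_n.
Definition bilinear_field := chart_index A -> 'rV[R]_n -> 'M[R]_n.

Implicit Types (g : bilinear_field) (b : form_field).

Definition coords (i : chart_index A) : set 'rV[R]_n := chart i @` dom i.

Definition overlap (i j : chart_index A) : set 'rV[R]_n :=
  [set p | coords i p /\ dom j (par i p)].

Definition transition (i j : chart_index A) : 'rV[R]_n -> 'rV[R]_n :=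
  fun p => chart j (par i p).

(* The rows of 'J f p are the partial derivatives of f. *)
Definition is_one_form b : Prop :=
  (forall i k, smooth_on (coords i) (fun p => b i p 0 k)) /\
  (forall i j p, overlap i j p ->
     b i p = b j (transition i j p) *m ('J (transition i j) p)^T).

Definition is_riemannian_metric g : Prop :=
  [/\ forall i k l, smooth_on (coords i) (fun p => g i p k l),
      forall i j p, overlap i j p ->
        g i p = 'J (transition i j) p *m g j (transition i j p)
                  *m ('J (transition i j) p)^T,
      forall i p, coords i p -> (g i p)^T = g i p &
      forall i p, coords i p -> forall y, y != 0 -> 0 < alpha2 (g i) p y].

Definition nonconstant_length g b : Prop :=
  exists i j p q, [/\ coords i p, coords j q &
    norm (g i) (b i) p <> norm (g j) (b j) q].

Definition killing_form g b : Prop :=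
  forall i p, coords i p -> forall k l,
    covd (g i) (b i) p k l + covd (g i) (b i) p l k = 0.

Definition constant_ricci g (mu : R) : Prop :=
  forall i p, coords i p -> forall y,
    ricci (g i) p y = n.-1%:R * mu * alpha2 (g i) p y.

Definition Rbb_condition g b (mu : R) : Prop :=
  forall i p, coords i p -> forall y,
    Rbb (g i) (b i) p y =
    mu * (normsq (g i) (b i) p * alpha2 (g i) p y - beta (b i) p y ^+ 2).

Definition t00_condition g b (a mu : R) : Prop :=
  forall i p, coords i p -> forall y, exists2 v : R,
    quotient_value (fun q => s0 (g i) (b i) q y ^+ 2)
      (fun q => a ^+ 2 - mu * normsq (g i) (b i) q) p v &
    t00 (g i) (b i) p y
    + (a ^+ 2 - mu * normsq (g i) (b i) p) * alpha2 (g i) p y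
    + mu * (normsq (g i) (b i) p * alpha2 (g i) p y - beta (b i) p y ^+ 2)
    - mu * v = 0.

(* t ranges over the values taken by b^2 on M *)
Definition b2_value g b (t : R) : Prop :=
  exists i p, coords i p /\ t = normsq (g i) (b i) p.

(* Components of the square of e^{rho(b^2)} sqrt(alpha^2 - kappa(b^2) beta^2),
   see [alpha_deform_metric]. *)
Definition deform_metric (rho kappa : R -> R) g b : bilinear_field :=
  fun i p => let t := normsq (g i) (b i) p in
    expR (rho t) ^+ 2 *: (g i p - kappa t *: ((b i p)^T *m b i p)).

Definition deform_form (nu : R -> R) g b : form_field :=
  fun i p => nu (normsq (g i) (b i) p) *: b i p.

Lemma alpha_deform_metric (rho kappa : R -> R) g b i p y :
  0 <= alpha2 (g i) p y ->
  let t := normsq (g i) (b i) p in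
  alpha (deform_metric rho kappa g b i) p y =
  expR (rho t) *
    Num.sqrt (alpha (g i) p y ^+ 2 - kappa t * beta (b i) p y ^+ 2).
Proof.
move=> ge0 t; rewrite /alpha sqr_sqrtr //.
rewrite -[in RHS](ger0_norm (expR_ge0 (rho t))).
rewrite -sqrtr_sqr -sqrtrM ?sqr_ge0 //; congr Num.sqrt.
have -> : beta (b i) p y ^+ 2 =
    \sum_k \sum_l b i p 0 k * y 0 k * (b i p 0 l * y 0 l).
  by rewrite /beta expr2 mulr_suml; apply: eq_bigr => k _; rewrite mulr_sumr.
rewrite /alpha2 !mulr_sumr -sumrB mulr_sumr.
apply: eq_bigr => k _; rewrite !mulr_sumr -sumrB mulr_sumr.
apply: eq_bigr => l _; rewrite /deform_metric !mxE big_ord1 !mxE -/t.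
by ring.
Qed.

Lemma beta_deform_form (nu : R -> R) g b i p y :
  beta (deform_form nu g b i) p y =
  nu (normsq (g i) (b i) p) * beta (b i) p y.
Proof.
by rewrite /beta mulr_sumr; apply: eq_bigr => k _; rewrite mxE mulrA.
Qed.

End global_geometry.

(* Main.v *)
(* Put f = b^2 and w = a^2 - mu f, and let s be the 1-form s_i = df / 2.  For a
   Killing form the second covariant derivatives of f are controlled by t_00
   and R_bb, so the two hypotheses give the Hessian of f, and then |s|^2 = f w.
   The deformed metric has a connection differing from that of alpha by an
   explicit tensor in b and s, and up to the factor k the form
   (1 - f kappa) e^(2 rho) beta is dual for alpha-bar to the Killing field of
   beta, hence Killing for alpha-bar.

   Evaluating the two conditions on alpha-bar at a point where f and w do not
   vanish, in the direction of grad f and in the directions orthogonal to b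
   and grad f, gives ordinary differential equations in t = f for E = e^(2 rho)
   and Delta = 1 - t kappa.  They force Delta' = 0, then Delta = 1,
   and what is left says that phi = e^(-rho) satisfies
   (phi' sqrt w)' = 0 together with a first integral fixing mu-bar.
   Conversely these equations for phi imply the conditions on alpha-bar.  Since
   M is connected the values of f form an interval, which is nontrivial since f
   is not constant, and its end points are handled by continuity. *)

Require Import Defs.
From mathcomp Require Import all_boot all_order all_algebra.
From mathcomp Require Import all_classical all_reals all_analysis.
From mathcomp Require Import ring lra.
Set Implicit Arguments.
Unset Strict Implicit.
Unset Printing Implicit Defensive.
Import Order.TTheory GRing.Theory Num.Theory numFieldNormedType.Exports.
Local Open Scope classical_set_scope.
Local Open Scope ring_scope.

(** The full curvature tensor of alpha-bar is never computed. The [R_bb] condition is quadratic in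
    the form at each point and nu does not vanish, so beta-bar may be exchanged for the Killing form
    dual to the old Killing field. The Hessian identity used for (alpha, beta) then holds for the
    barred pair too, and expresses its [R_bb] through [t_00] and the Hessian of the barred squared
    length. Only the Ricci curvature needs the difference tensor of the connections, and only in
    directions killed by beta or when the deformation is conformal.

    The assumption n > 2 provides a direction orthogonal to b and grad f, and makes n - 2 nonzero
    when the two equations in the direction of grad f are combined. Delta' = 0 comes from one
    further differentiation: an elimination leaves an equation in E, E' and Delta alone, whose
    derivative is 3 a^2 Delta' up to a multiple of the second-order equation.

    The obstacle is the locus w = 0, where quotients by w are only limits. There s vanishes, and the
    formulas carry the limit as a witness instead of evaluating it. For beta-bar the zeros of 1 + f
    E'/E are new singular points, where the limit has to be shown to exist. *)

Notation ecoord k := (delta_mx 0 k : 'rV_ _).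

(** * Partial derivatives and finite smoothness *)

Section is_derive_pointwise.
Context {R : realType} {V : normedModType R}.
Implicit Types (f h : V -> R) (p v : V).

Lemma is_derive_fctD f h p v df dh : is_derive p v f df -> is_derive p v h dh ->
  is_derive p v (fun q => f q + h q) (df + dh).
Proof. by move=> ? ?; exact: is_deriveD. Qed.

Lemma is_derive_fctN f p v df : is_derive p v f df ->
  is_derive p v (fun q => - f q) (- df).
Proof. by move=> ?; exact: is_deriveN. Qed.

Lemma is_derive_fctB f h p v df dh : is_derive p v f df -> is_derive p v h dh ->
  is_derive p v (fun q => f q - h q) (df - dh).
Proof. by move=> ? ?; exact: is_deriveB. Qed.

Lemma is_derive_fctM f h p v df dh : is_derive p v f df -> is_derive p v h dh ->
  is_derive p v (fun q => f q * h q) (df * h p + f p * dh).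
Proof.
move=> ? ?; apply: is_derive_eq; rewrite addrC.
by rewrite [df * _]mulrC.
Qed.

Lemma is_derive_fct_sum (I : Type) (r : seq I) (P : pred I) (F : I -> V -> R) p v dF :
  (forall i, P i -> is_derive p v (F i) (dF i)) ->
  is_derive p v (fun q => \sum_(i <- r | P i) F i q) (\sum_(i <- r | P i) dF i).
Proof.
move=> HF; elim: r => [|i r IH].
  rewrite big_nil; under eq_fun do rewrite big_nil; exact: is_derive_cst.
rewrite big_cons; under eq_fun do rewrite big_cons.
by case: ifP => // Pi; apply: is_derive_fctD => //; exact: HF.
Qed.

Lemma is_derive_fctV f p v df : f p != 0 -> is_derive p v f df ->
  is_derive p v (fun q => (f q)^-1) (- (f p) ^- 2 * df).
Proof.
move=> f0 fd.
have dV := derivableV f0 (@ex_derive _ _ _ _ _ _ _ fd).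
have := derivableP dV.
by rewrite deriveV // derive_val.
Qed.

(** Restriction to a line turns a directional derivative into an ordinary one; the chain rule below
    then needs no total derivative of the inner function. *)
Lemma derive_line f p v : 'D_v f p = 'D_1 (fun t : R => f (t *: v + p)) 0.
Proof.
rewrite /derive; set g1 := fun h : R => h^-1 *: _; set g2 := fun h : R => h^-1 *: _.
suff -> : g1 = g2 by [].
by apply/funext => t; rewrite /g1 /g2 /= addr0 scale0r add0r [_%:A]mulr1.
Qed.

Lemma is_derive_line f p v df :
  is_derive p v f df <-> is_derive (0 : R) 1 (fun t => f (t *: v + p)) df.
Proof.
by split=> [[fd <-]|[fd <-]]; apply: DeriveDef;
  rewrite ?derive_line//; apply/(derivable1P f p v).
Qed.

Lemma is_derive_fct_comp (phi : R -> R) f p v df dphi :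
  is_derive (f p) 1 phi dphi -> is_derive p v f df ->
  is_derive p v (fun q => phi (f q)) (dphi * df).
Proof.
move=> phid /is_derive_line fd; apply/is_derive_line.
have e0 : f (0 *: v + p) = f p by rewrite scale0r add0r.
have phid' : is_derive (f (0 *: v + p)) 1 phi dphi by rewrite e0.
have := @is_derive1_comp R phi (fun t => f (t *: v + p)) 0 dphi df phid' fd.
by rewrite mulrC; apply.
Qed.

End is_derive_pointwise.

Section Cm.
Context {R : realType} {n : nat}.
Implicit Types (f h : 'rV[R]_n -> R) (U : set 'rV[R]_n) (p : 'rV[R]_n).

Lemma near_open U (P : 'rV[R]_n -> Prop) p :
  open U -> U p -> (forall q, U q -> P q) -> \near p, P p.
Proof. by move=> Uo Up HP; apply: filterS (open_nbhs_nbhs (conj Uo Up)). Qed.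

Lemma partial_eq_on U k f h p : open U -> U p ->
  (forall q, U q -> f q = h q) -> partial k f p = partial k h p.
Proof. by move=> Uo Up fh; apply: near_eq_derive; exact: near_open fh. Qed.

Lemma continuous_eq_on U f h p : open U -> U p -> (forall q, U q -> f q = h q) ->
  {for p, continuous f} -> {for p, continuous h}.
Proof.
move=> Uo Up fh; rewrite /prop_for /continuous_at -(fh p Up) => fc.
apply: cvg_trans fc; apply: near_eq_cvg; [exact: nbhs_filter|exact: near_open Uo Up fh].
Qed.

(* A version of [smooth_on] of finite order, in recursive form, for which
   closure under the arithmetic operations is proved by induction on [m]. *)
Fixpoint Cm (m : nat) U f : Prop :=
  (forall p, U p -> {for p, continuous f}) /\
  if m is m'.+1 then
    (forall k p, U p -> derivable f p (ecoord k)) /\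
    (forall k, Cm m' U (partial k f))
  else True.

Lemma Cm_continuous m U f p : Cm m U f -> U p -> {for p, continuous f}.
Proof. by case: m => [|m] [fc _]; exact: fc. Qed.

Lemma Cm_derivable m U f k p : Cm m.+1 U f -> U p -> derivable f p (ecoord k).
Proof. by move=> [_ [fd _]]; exact: fd. Qed.

Lemma Cm_partial m U f k : Cm m.+1 U f -> Cm m U (partial k f).
Proof. by move=> [_ [_ fp]]; exact: fp. Qed.

Lemma Cm_is_derive m U f k p : Cm m.+1 U f -> U p ->
  is_derive p (ecoord k) f (partial k f p).
Proof. by move=> fC Up; apply: derivableP; exact: Cm_derivable fC Up. Qed.

Lemma CmS m U f : Cm m.+1 U f -> Cm m U f.
Proof.
elim: m f => [|m IH] f; first by move=> [].
by move=> [fc [fd fp]]; split=> //; split=> // k; exact: IH.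
Qed.

Lemma Cm_eq_on m U f h : open U -> (forall q, U q -> f q = h q) ->
  Cm m U f -> Cm m U h.
Proof.
move=> Uo; elim: m f h => [|m IH] f h fh.
all: move=> [fc fd]; split=> //.
- by move=> p Up; apply: continuous_eq_on fh (fc p Up).
- by move=> p Up; apply: continuous_eq_on fh (fc p Up).
- move: fd => [fd fp]; split=> [k p Up|k].
    by apply: near_eq_derivable (fd k p Up); exact: (near_open Uo Up).
  apply: IH (fp k) => q Uq; exact: (partial_eq_on k Uo Uq fh).
Qed.

Lemma Cm_cst m U (c : R) : Cm m U (fun=> c).
Proof.
elim: m c => [|m IH] c; split=> //; try by move=> p _; exact: cst_continuous.
split=> [k p _|k]; first exact: derivable_cst.
rewrite (_ : partial k _ = fun=> 0); first exact: IH.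
by apply/funext => p; rewrite /partial derive_cst.
Qed.

Lemma CmD m U f h : open U -> Cm m U f -> Cm m U h -> Cm m U (fun q => f q + h q).
Proof.
move=> Uo; elim: m f h => [|m IH] f h [fc fd] [hc hd]; split=> //.
- by move=> p Up; apply: continuousD; [exact: fc|exact: hc].
- by move=> p Up; apply: continuousD; [exact: fc|exact: hc].
move: fd hd => [fd fp] [hd hp]; split=> [k p Up|k].
  by apply: derivableD; [exact: fd|exact: hd].
apply: Cm_eq_on (IH _ _ (fp k) (hp k)) => // q Uq.
by rewrite /partial deriveD//; [exact: fd|exact: hd].
Qed.

Lemma CmM m U f h : open U -> Cm m U f -> Cm m U h -> Cm m U (fun q => f q * h q).
Proof.
move=> Uo; elim: m f h => [|m IH] f h fC hC.
all: have [fc fd] := fC; have [hc hd] := hC; split=> //.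
- by move=> p Up; apply: continuousM; [exact: fc|exact: hc].
- by move=> p Up; apply: continuousM; [exact: fc|exact: hc].
move: fd hd => [fd fp] [hd hp]; split=> [k p Up|k].
  by apply: derivableM; [exact: fd|exact: hd].
have := CmD Uo (IH _ _ (fp k) (CmS hC)) (IH _ _ (CmS fC) (hp k)).
apply: Cm_eq_on => // q Uq; rewrite /partial deriveM; [|exact: fd|exact: hd].
by rewrite addrC [X in _ + X]mulrC.
Qed.

Lemma CmZ m U f (c : R) : open U -> Cm m U f -> Cm m U (fun q => c * f q).
Proof. by move=> Uo fC; apply: CmM => //; exact: Cm_cst. Qed.

Lemma CmN m U f : open U -> Cm m U f -> Cm m U (fun q => - f q).
Proof.
move=> Uo fC; apply: Cm_eq_on (CmZ (-1) Uo fC) => // q _; exact: mulN1r.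
Qed.

Lemma CmB m U f h : open U -> Cm m U f -> Cm m U h -> Cm m U (fun q => f q - h q).
Proof. by move=> Uo fC hC; apply: CmD => //; exact: CmN. Qed.

Lemma Cm_sum m U (I : Type) (r : seq I) (P : pred I) (F : I -> 'rV[R]_n -> R) :
  open U -> (forall i, P i -> Cm m U (F i)) -> Cm m U (fun q => \sum_(i <- r | P i) F i q).
Proof.
move=> Uo HF; elim: r => [|i r IH].
  by under eq_fun do rewrite big_nil; exact: Cm_cst.
under eq_fun do rewrite big_cons.
by case Pi: (P i) => //; apply: CmD => //; exact: HF.
Qed.

Lemma Cm_prod m U (I : Type) (r : seq I) (P : pred I) (F : I -> 'rV[R]_n -> R) :
  open U -> (forall i, P i -> Cm m U (F i)) -> Cm m U (fun q => \prod_(i <- r | P i) F i q).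
Proof.
move=> Uo HF; elim: r => [|i r IH].
  by under eq_fun do rewrite big_nil; exact: Cm_cst.
under eq_fun do rewrite big_cons.
by case Pi: (P i) => //; apply: CmM => //; exact: HF.
Qed.

(** The induction varies [phi] as well, since the chain rule replaces it by its derivative.
    Regularity of [phi] is required only at the values of [f]. *)
Lemma Cm_comp m U (J : set R) (phi : R -> R) f : open U ->
  (forall j t, J t -> derivable (derive1n j phi) t 1) ->
  (forall q, U q -> J (f q)) -> Cm m U f -> Cm m U (fun q => phi (f q)).
Proof.
move=> Uo; elim: m phi f => [|m IH] phi f phid UJ fC.
all: have [fc fd] := fC; split=> //.
1,2: move=> p Up; apply: continuous_comp; first exact: fc.
1,2: by apply: differentiable_continuous; apply/derivable1_diffP; exact: (phid 0 _ (UJ _ Up)).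
have phi1 t : J t -> is_derive t 1 phi ((derive1 phi) t).
  by move=> Jt; rewrite derive1E; apply: derivableP; exact: (phid 0).
have H k p : U p -> is_derive p (ecoord k) (fun q => phi (f q)) ((derive1 phi) (f p) * partial k f p).
  move=> Up; apply: is_derive_fct_comp; first by apply: phi1; exact: UJ.
  exact: Cm_is_derive fC Up.
split=> [k p Up|k]; first by have [] := H k p Up.
have phi1d j t : J t -> derivable (derive1n j (derive1 phi)) t 1.
  by move=> Jt; rewrite -derive1Sn; exact: phid.
apply: Cm_eq_on (CmM Uo (IH _ _ phi1d UJ (CmS fC)) (fd.2 k)) => // q Uq.
by have [_ <-] := H k q Uq.
Qed.

Lemma CmV m U f : open U -> (forall q, U q -> f q != 0) -> Cm m U f ->
  Cm m U (fun q => (f q)^-1).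
Proof.
move=> Uo f0; elim: m f f0 => [|m IH] f f0 fC.
all: have [fc fd] := fC; split=> //.
1,2: by move=> p Up; apply: continuousV; [exact: f0|exact: fc].
have H k p : U p -> is_derive p (ecoord k) (fun q => (f q)^-1) (- (f p) ^- 2 * partial k f p).
  by move=> Up; apply: is_derive_fctV; [exact: f0|exact: Cm_is_derive fC Up].
split=> [k p Up|k]; first by have [] := H k p Up.
have C' := IH _ f0 (CmS fC).
apply: Cm_eq_on (CmM Uo (CmN Uo (CmM Uo C' C')) (fd.2 k)) => // q Uq.
by have [_] := H k q Uq; rewrite /partial => ->; rewrite -expr2 exprVn.
Qed.

Lemma smooth_on_Cm m U f : smooth_on U f -> Cm m U f.
Proof.
elim: m f => [|m IH] f fs; split=> //.
- by move=> p Up; exact: (fs [::] p Up).1.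
- by move=> p Up; exact: (fs [::] p Up).1.
split=> [k p Up|k]; first exact: (fs [::] p Up).2.
(* The derivative taken first stands last in the list, hence [rcons]. *)
by apply: IH => s p Up; have := fs (rcons s k) p Up; rewrite /partials foldr_rcons.
Qed.

End Cm.

(** * Symmetry of second partial derivatives *)

Section schwarz.
Context {R : realType} {n : nat}.
Implicit Types (f : 'rV[R]_n -> R) (U : set 'rV[R]_n) (p q v : 'rV[R]_n).

Lemma is_derive_translate f q c v df : is_derive (q + c) v f df ->
  is_derive q v (fun r => f (r + c)) df.
Proof.
move=> /is_derive_line fd; apply/is_derive_line.
by under eq_fun do rewrite -addrA.
Qed.

Lemma mvt_direction f q v (h : R) : 0 < h ->
  (forall s, 0 <= s <= h -> derivable f (q + s *: v) v) ->
  exists2 s, 0 <= s <= h & f (q + h *: v) - f q = h * 'D_v f (q + s *: v).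
Proof.
move=> h0 fd.
have Fd s : 0 <= s <= h ->
    is_derive s 1 (fun r : R => f (q + r *: v)) ('D_v f (q + s *: v)).
  move=> /fd /derivableP /is_derive_line.
  rewrite -{1}(subrr s) => Fs.
  have sd : is_derive s 1 (fun r : R => r - s) (1 - 0).
    exact: is_derive_fctB.
  have := is_derive_fct_comp (f := fun r : R => r - s) Fs sd; rewrite subr0 mulr1.
  by under eq_fun do rewrite addrCA -scalerDl subrK.
have oc x : x \in `]0, h[ -> 0 <= x <= h.
  by rewrite in_itv /= => /andP[/ltW -> /ltW ->].
have cont : {within `[0, h], continuous (fun r : R => f (q + r *: v))}.
  apply: derivable_within_continuous => x; rewrite in_itv /= => xh.
  by have [] := Fd x xh.
have [c /oc ch] := MVT h0 (fun x xh => Fd x (oc x xh)) cont.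
by rewrite scale0r addr0 subr0 mulrC => E; exists c.
Qed.

(** The mean value theorem is applied along [k] to the increment of [f] in direction [l], then along
    [l] to [partial k f]. *)
Lemma second_difference U f p k l (h : R) : 0 < h -> Cm 2 U f ->
  (forall s t, 0 <= s <= h -> 0 <= t <= h -> U (p + s *: ecoord k + t *: ecoord l)) ->
  exists s t, [/\ 0 <= s <= h, 0 <= t <= h &
    f (p + h *: ecoord k + h *: ecoord l) - f (p + h *: ecoord k)
    - (f (p + h *: ecoord l) - f p) =
    h * (h * partial l (partial k f) (p + s *: ecoord k + t *: ecoord l))].
Proof.
move=> h0 fC UP.
have hh : 0 <= h <= h by rewrite lexx ltW.
have h00 : 0 <= (0 : R) <= h by rewrite lexx ltW.
have UP0 s : 0 <= s <= h -> U (p + s *: ecoord k).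
  by move=> sh; have := UP s 0 sh h00; rewrite scale0r addr0.
pose phi q := f (q + h *: ecoord l) - f q.
have phid s : 0 <= s <= h -> is_derive (p + s *: ecoord k) (ecoord k) phi
    (partial k f (p + s *: ecoord k + h *: ecoord l) - partial k f (p + s *: ecoord k)).
  move=> sh; apply: is_derive_fctB.
    by apply: is_derive_translate; apply: Cm_is_derive fC _; exact: UP.
  by apply: Cm_is_derive fC _; exact: UP0.
have [|s sh E1] := @mvt_direction phi p (ecoord k) h h0.
  by move=> s /phid[].
have [|t th E2] := @mvt_direction (partial k f) (p + s *: ecoord k) (ecoord l) h h0.
  by move=> t th; apply: (Cm_derivable (Cm_partial k fC)); exact: UP.
exists s, t; split=> //.
have [_ pE] := phid s sh.
by rewrite -[X in h * X]E2 -pE -E1 /phi.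
Qed.

(** The second difference over a small square is symmetric in the two directions and equals [h ^+ 2]
    times either mixed derivative somewhere in the square. Continuity at [p] then forces the two
    limits to agree. *)
Lemma schwarz U f p k l : open U -> U p -> Cm 2 U f ->
  partial k (partial l f) p = partial l (partial k f) p.
Proof.
move=> Uo Up fC; apply/eqP; rewrite -subr_eq0; apply/negPn/negP.
set A := partial k (partial l f); set B := partial l (partial k f) => AB0.
have eps0 : 0 < `|A p - B p| / 2 by rewrite divr_gt0 ?normr_gt0.
have Ac : \forall q \near p, `|A p - A q| < `|A p - B p| / 2.
  have := Cm_continuous (Cm_partial k (Cm_partial l fC)) Up.
  by move=> /cvgrPdist_lt /(_ _ eps0).
have Bc : \forall q \near p, `|B p - B q| < `|A p - B p| / 2.
  have := Cm_continuous (Cm_partial l (Cm_partial k fC)) Up.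
  by move=> /cvgrPdist_lt /(_ _ eps0).
have Un : \forall q \near p, U q by apply: (@near_open _ _ U (fun q => U q) p).
have : \forall q \near p, [/\ U q, `|A p - A q| < `|A p - B p| / 2
    & `|B p - B q| < `|A p - B p| / 2].
  exact: (@filterS3 _ _ (nbhs_filter p) _ _ _ _ (fun q a b c => And3 a b c) Un Ac Bc).
move=> /nbhs_ballP[d /= d0 dP].
(* [K] dominates the lengths of both edge directions, so a square of side [d / (2 * K)] stays in the
   ball of radius [d]. *)
pose K : R := `|ecoord k| + `|ecoord l| + 1.
have K0 : 0 < K by rewrite /K ltr_wpDl// addr_ge0.
pose h := d / (2 * K).
have h0 : 0 < h by rewrite divr_gt0 ?mulr_gt0.
have inb s t : 0 <= s <= h -> 0 <= t <= h ->
    ball p d (p + s *: ecoord k + t *: ecoord l).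
  move=> /andP[s0 sh] /andP[t0 th].
  rewrite -ball_normE /= opprD addrA opprD addrA subrr sub0r -opprD normrN.
  apply: (le_lt_trans (ler_normD _ _)); rewrite !normrZ !ger0_norm//.
  apply: (@le_lt_trans _ _ (h * (K - 1))).
    by rewrite /K addrK mulrDr lerD// ler_wpM2r.
  apply: (@le_lt_trans _ _ (h * K)); first by rewrite ler_wpM2l ?ltW// ltrBlDr ltrDl.
  rewrite /h invfM mulrA mulfVK ?gt_eqF//.
  by rewrite ltr_pdivrMr// ltr_pMr// ltr1n.
have inU s t : 0 <= s <= h -> 0 <= t <= h -> U (p + s *: ecoord k + t *: ecoord l).
  by move=> sh th; have [] := dP _ (inb s t sh th).
have [s [t [sh th E1]]] := second_difference h0 fC inU.
have inb' s' t' : 0 <= s' <= h -> 0 <= t' <= h ->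
    ball p d (p + s' *: ecoord l + t' *: ecoord k).
  by move=> ? ?; rewrite addrAC; exact: inb.
have inU' s' t' : 0 <= s' <= h -> 0 <= t' <= h -> U (p + s' *: ecoord l + t' *: ecoord k).
  by move=> ? ?; rewrite addrAC; exact: inU.
have [s' [t' [sh' th' E2]]] := second_difference h0 fC inU'.
have [_ _ HB] := dP _ (inb s t sh th).
have [_ HA _] := dP _ (inb' s' t' sh' th').
have E : A (p + s' *: ecoord l + t' *: ecoord k) =
    B (p + s *: ecoord k + t *: ecoord l).
  apply: (mulfI (lt0r_neq0 h0)); apply: (mulfI (lt0r_neq0 h0)).
  transitivity (f (p + h *: ecoord l + h *: ecoord k) - f (p + h *: ecoord l)
      - (f (p + h *: ecoord k) - f p)); first exact: esym E2.
  transitivity (f (p + h *: ecoord k + h *: ecoord l) - f (p + h *: ecoord k)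
      - (f (p + h *: ecoord l) - f p)); last exact: E1.
  rewrite [p + h *: ecoord l + h *: ecoord k]addrAC.
  move: (f (p + h *: ecoord k + h *: ecoord l)) (f (p + h *: ecoord k)) => x1 x2.
  by move: (f (p + h *: ecoord l)) (f p) => x3 x4; ring.
move: HA; rewrite E => HA.
have : `|A p - B p| < `|A p - B p| / 2 + `|A p - B p| / 2.
  apply: le_lt_trans (ltrD HA HB).
  move: (B (p + s *: ecoord k + t *: ecoord l)) (A p) (B p) => x1 x2 x3.
  have E' : x2 - x3 = x2 - x1 - (x3 - x1) by ring.
  by rewrite E'; exact: ler_normB.
by rewrite -splitr ltxx.
Qed.

End schwarz.

Section matrix_smooth.
Context {R : realType} {n : nat} (U : set 'rV[R]_n) (Uo : open U) (m : nat).

Lemma Cm_det k (F : 'rV[R]_n -> 'M[R]_k) :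
  (forall i j, Cm m U (fun q => F q i j)) -> Cm m U (fun q => \det (F q)).
Proof.
move=> FC; rewrite /determinant; apply: Cm_sum => // s _; apply: CmZ => //.
by apply: Cm_prod => // i _; exact: FC.
Qed.

(** Cramer's rule leaves only polynomials in the entries and the inverse of the determinant. *)
Lemma Cm_invmx k (F : 'rV[R]_n -> 'M[R]_k) :
  (forall q, U q -> F q \in unitmx) ->
  (forall i j, Cm m U (fun q => F q i j)) ->
  forall i j, Cm m U (fun q => invmx (F q) i j).
Proof.
move=> Fu FC i j.
apply: (@Cm_eq_on _ _ _ _ (fun q => (\det (F q))^-1 * cofactor (F q) j i)) => //.
  by move=> q Uq; rewrite /invmx Fu// !mxE.
apply: CmM => //.
  by apply: CmV => //; [move=> q /Fu; rewrite unitmxE unitfE|exact: Cm_det].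
rewrite /cofactor; apply: CmZ => //.
have := @Cm_det k.-1 (fun q => row' j (col' i (F q))); apply => a b.
by under eq_fun do rewrite !mxE; exact: FC.
Qed.

End matrix_smooth.

Section dot.
Context {R : realType} {n : nat}.
Implicit Types (u v w : 'rV[R]_n) (A : 'M[R]_n).

Definition dot u v : R := \sum_i u 0 i * v 0 i.

Lemma dotE u v : dot u v = (u *m v^T) 0 0.
Proof. by rewrite mxE; apply: eq_bigr => i _; rewrite mxE. Qed.

Lemma dotC u v : dot u v = dot v u.
Proof. by apply: eq_bigr => i _; rewrite mulrC. Qed.

Lemma dotDl u v w : dot (u + v) w = dot u w + dot v w.
Proof. by rewrite !dotE mulmxDl mxE. Qed.

Lemma dotDr u v w : dot w (u + v) = dot w u + dot w v.
Proof. by rewrite !(dotC w) dotDl. Qed.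

Lemma dotZl c u v : dot (c *: u) v = c * dot u v.
Proof. by rewrite !dotE -scalemxAl mxE. Qed.

Lemma dotZr c u v : dot u (c *: v) = c * dot u v.
Proof. by rewrite !(dotC u) dotZl. Qed.

Lemma dotNl u v : dot (- u) v = - dot u v.
Proof. by rewrite -scaleN1r dotZl mulN1r. Qed.

Lemma dotNr u v : dot u (- v) = - dot u v.
Proof. by rewrite -scaleN1r dotZr mulN1r. Qed.

Lemma dotBl u v w : dot (u - v) w = dot u w - dot v w.
Proof. by rewrite dotDl dotNl. Qed.

Lemma dotBr u v w : dot w (u - v) = dot w u - dot w v.
Proof. by rewrite dotDr dotNr. Qed.

Lemma dot0l u : dot 0 u = 0.
Proof. by rewrite -(scale0r 0) dotZl mul0r. Qed.

Lemma dot0r u : dot u 0 = 0.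
Proof. by rewrite dotC dot0l. Qed.

Lemma dot_ecoord u k : dot u (ecoord k) = u 0 k.
Proof.
rewrite /dot (bigD1 k)//= mxE !eqxx mulr1 big1 ?addr0// => i /negPf ik.
by rewrite mxE eqxx ik mulr0.
Qed.

Lemma dot_inj u v : (forall w, dot u w = dot v w) -> u = v.
Proof. by move=> uv; apply/rowP => k; rewrite -!dot_ecoord. Qed.

Lemma dot_mulmx u v A : dot (u *m A) v = dot u (v *m A^T).
Proof. by rewrite !dotE trmx_mul trmxK mulmxA. Qed.

Lemma sum_ecoord u : u = \sum_k u 0 k *: ecoord k.
Proof. exact: row_sum_delta. Qed.

Lemma tr_outer u v : \tr (u^T *m v) = dot u v.
Proof. by rewrite mxtrace_mulC dotC dotE trace_mx11. Qed.

Lemma mul_outer w u v : w *m (u^T *m v) = dot w u *: v.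
Proof.
rewrite mulmxA dotE; apply/rowP => i; rewrite !mxE big_ord1 !mxE.
by congr (_ * _); apply: eq_bigr => j _; rewrite !mxE.
Qed.

Lemma quad_mxE (A : 'M[R]_n) u v : (\sum_i \sum_j A i j * u 0 i * v 0 j) = dot (u *m A) v.
Proof.
rewrite /dot exchange_big /=; apply: eq_bigr => j _.
by rewrite mxE mulr_suml; apply: eq_bigr => i _; rewrite [_ * u _ _]mulrC.
Qed.

End dot.

(** * Directional derivatives and divergences from partial derivatives *)

Section directional_derivatives.
Context {R : realType} {n : nat}.
Implicit Types (f h : 'rV[R]_n -> R) (U : set 'rV[R]_n) (p v : 'rV[R]_n).

(* Derivative along [v] of a function having partial derivatives: linear in
   [v] by construction, so that total differentiability is never needed. *)
Definition ddval p v f : R := \sum_k v 0 k * partial k f p.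

(** A relation, so that derivability travels with the value: the rules below compose by application,
    and two computations of one derivative are compared by [dd_unique]. *)
Definition dd p v f (d : R) : Prop :=
  (forall k, derivable f p (ecoord k)) /\ d = ddval p v f.

Lemma dd_intro p v f (d : 'I_n -> R) :
  (forall k, is_derive p (ecoord k) f (d k)) -> dd p v f (\sum_k v 0 k * d k).
Proof.
move=> fd; split=> [k|]; first by have [] := fd k.
by apply: eq_bigr => k _; have [_ <-] := fd k.
Qed.

Lemma dd_is_derive p v f d k : dd p v f d -> is_derive p (ecoord k) f (partial k f p).
Proof. by move=> [fd _]; exact: derivableP. Qed.

Lemma dd_unique p v f d d' : dd p v f d -> dd p v f d' -> d = d'.
Proof. by move=> [_ ->] [_ ->]. Qed.

Lemma dd_eq p v f d d' : dd p v f d -> d = d' -> dd p v f d'.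
Proof. by move=> H <-. Qed.

Lemma dd_eq_on U p v f h d : open U -> U p -> (forall q, U q -> f q = h q) ->
  dd p v f d -> dd p v h d.
Proof.
move=> Uo Up fh [fd ->]; split=> [k|].
  by apply: near_eq_derivable (fd k); exact: near_open Uo Up fh.
by apply: eq_bigr => k _; rewrite (partial_eq_on k Uo Up fh).
Qed.

Lemma dd_Cm U p v f : Cm 1 U f -> U p -> dd p v f (ddval p v f).
Proof. by move=> fC Up; split=> // k; exact: Cm_derivable fC Up. Qed.

Lemma dd_cst p v (c : R) : dd p v (fun=> c) 0.
Proof.
have := @dd_intro p v (fun=> c) (fun=> 0) (fun k => is_derive_cst _ _ _).
by move/dd_eq; apply; rewrite big1// => k _; rewrite mulr0.
Qed.

Lemma ddD p v f h df dh : dd p v f df -> dd p v h dh ->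
  dd p v (fun q => f q + h q) (df + dh).
Proof.
move=> fd hd; have := @dd_intro p v _ _ (fun k => is_derive_fctD (dd_is_derive k fd) (dd_is_derive k hd)).
move/dd_eq; apply; rewrite fd.2 hd.2 -big_split; apply: eq_bigr => k _.
by rewrite mulrDr.
Qed.

Lemma ddM p v f h df dh : dd p v f df -> dd p v h dh ->
  dd p v (fun q => f q * h q) (df * h p + f p * dh).
Proof.
move=> fd hd; have := @dd_intro p v _ _ (fun k => is_derive_fctM (dd_is_derive k fd) (dd_is_derive k hd)).
move/dd_eq; apply; rewrite fd.2 hd.2 mulr_suml mulr_sumr -big_split.
by apply: eq_bigr => k _ /=; ring.
Qed.

Lemma ddZ p v f df (c : R) : dd p v f df -> dd p v (fun q => c * f q) (c * df).
Proof.
by move=> fd; apply: dd_eq (ddM (dd_cst p v c) fd) _; rewrite mul0r add0r.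
Qed.

Lemma ddN p v f df : dd p v f df -> dd p v (fun q => - f q) (- df).
Proof.
move=> fd; have := ddZ (-1) fd; rewrite mulN1r.
by under eq_fun do rewrite mulN1r.
Qed.

Lemma ddB p v f h df dh : dd p v f df -> dd p v h dh ->
  dd p v (fun q => f q - h q) (df - dh).
Proof. by move=> fd hd; apply: ddD => //; exact: ddN. Qed.

Lemma dd_sum p v (I : Type) (r : seq I) (P : pred I) (F : I -> 'rV[R]_n -> R) dF :
  (forall i, P i -> dd p v (F i) (dF i)) ->
  dd p v (fun q => \sum_(i <- r | P i) F i q) (\sum_(i <- r | P i) dF i).
Proof.
move=> HF; elim: r => [|i r IH].
  by rewrite big_nil; under eq_fun do rewrite big_nil; exact: dd_cst.
rewrite big_cons; under eq_fun do rewrite big_cons.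
by case Pi: (P i) => //; apply: ddD => //; exact: HF.
Qed.

Lemma dd_comp p v (phi : R -> R) f df dphi :
  is_derive (f p) 1 phi dphi -> dd p v f df ->
  dd p v (fun q => phi (f q)) (dphi * df).
Proof.
move=> phid fd; have := @dd_intro p v _ _ (fun k => is_derive_fct_comp phid (dd_is_derive k fd)).
move/dd_eq; apply; rewrite fd.2 mulr_sumr.
by apply: eq_bigr => k _ /=; rewrite mulrCA.
Qed.

Definition ddr p v {m} (F : 'rV[R]_n -> 'rV[R]_m) (dF : 'rV[R]_m) : Prop :=
  forall i, dd p v (fun q => F q 0 i) (dF 0 i).

Lemma ddr_cst p v m (u : 'rV[R]_m) : ddr p v (fun=> u) 0.
Proof. by move=> i; rewrite mxE; exact: dd_cst. Qed.

Lemma ddr_eq p v m (F : 'rV[R]_n -> 'rV[R]_m) dF dF' : ddr p v F dF -> dF = dF' -> ddr p v F dF'.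
Proof. by move=> H <-. Qed.

Lemma dd_dot p v m (F H : 'rV[R]_n -> 'rV[R]_m) dF dH : ddr p v F dF -> ddr p v H dH ->
  dd p v (fun q => dot (F q) (H q)) (dot dF (H p) + dot (F p) dH).
Proof.
by move=> Fd Hd; rewrite -big_split; apply: dd_sum => i _; exact: ddM.
Qed.

Lemma ddr_Cm U p v m (F : 'rV[R]_n -> 'rV[R]_m) : (forall i, Cm 1 U (fun q => F q 0 i)) ->
  U p -> ddr p v F (\row_i ddval p v (fun q => F q 0 i)).
Proof. by move=> FC Up i; rewrite mxE; exact: dd_Cm. Qed.

(** The coordinate divergence, as it occurs in a traced curvature; the Christoffel trace that makes
    it covariant is kept apart, see [isdiv_sharp]. *)
Definition isdiv p (F : 'rV[R]_n -> 'rV[R]_n) (d : R) : Prop :=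
  (forall i k, derivable (fun q => F q 0 i) p (ecoord k)) /\
  d = \sum_k partial k (fun q => F q 0 k) p.

Lemma isdiv_intro p (F : 'rV[R]_n -> 'rV[R]_n) (dF : 'I_n -> 'rV[R]_n) :
  (forall k, ddr p (ecoord k) F (dF k)) -> isdiv p F (\sum_k dF k 0 k).
Proof.
move=> Fd; split=> [i k|]; first by have [] := Fd k i.
apply: eq_bigr => k _; have [_ ->] := Fd k k.
rewrite /ddval (bigD1 k)//= mxE !eqxx mul1r big1 ?addr0// => j /negPf jk.
by rewrite mxE eqxx jk mul0r.
Qed.

Lemma isdiv_eq p F d d' : isdiv p F d -> d = d' -> isdiv p F d'.
Proof. by move=> H <-. Qed.

Lemma isdiv_eq_on U p F H d : open U -> U p -> (forall q, U q -> F q = H q) ->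
  isdiv p F d -> isdiv p H d.
Proof.
move=> Uo Up FH [Fd ->]; split=> [i k|].
  apply: near_eq_derivable (Fd i k).
  by apply: (@near_open _ _ U (fun q => F q 0 i = H q 0 i) p) => // q Uq; rewrite FH.
by apply: eq_bigr => k _; apply: partial_eq_on Uo Up _ => q Uq; rewrite FH.
Qed.

Lemma isdivD p F H dF dH : isdiv p F dF -> isdiv p H dH ->
  isdiv p (fun q => F q + H q) (dF + dH).
Proof.
move=> [Fd ->] [Hd ->].
have D i k : is_derive p (ecoord k) (fun q => (F q + H q) 0 i)
    (partial k (fun q => F q 0 i) p + partial k (fun q => H q 0 i) p).
  under eq_fun do rewrite mxE.
  by apply: is_derive_fctD; exact: derivableP.
split=> [i k|]; first by have [] := D i k.
by rewrite -big_split; apply: eq_bigr => k _; have [_ e] := D k k; symmetry; exact: e.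
Qed.

Lemma isdivZ p f df F dF : dd p (F p) f df -> isdiv p F dF ->
  isdiv p (fun q => f q *: F q) (df + f p * dF).
Proof.
move=> fd [Fd ->].
have D i k : is_derive p (ecoord k) (fun q => (f q *: F q) 0 i)
    (partial k f p * F p 0 i + f p * partial k (fun q => F q 0 i) p).
  under eq_fun do rewrite mxE.
  by apply: is_derive_fctM; [exact: dd_is_derive fd|exact: derivableP].
split=> [i k|]; first by have [] := D i k.
rewrite fd.2 mulr_sumr -big_split; apply: eq_bigr => k _ /=.
by have [_ e] := D k k; symmetry; rewrite [F p 0 k * _]mulrC; exact: e.
Qed.

Lemma isdiv_cst p u : isdiv p (fun=> u) 0.
Proof.
apply: isdiv_eq (isdiv_intro (dF := fun=> 0) (fun k => ddr_cst _ _ _)) _.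
by rewrite big1// => k _; rewrite mxE.
Qed.

End directional_derivatives.

(** * Metrics and connections in a chart *)

Section tensors.
Context {R : realType} {n : nat}.
Implicit Types (g : 'rV[R]_n -> 'M[R]_n) (w : 'rV[R]_n -> 'rV[R]_n).
Implicit Types (p q u v x y : 'rV[R]_n).

Definition gm g p u v : R := dot (u *m g p) v.

Definition sharp g p u : 'rV[R]_n := u *m ginv g p.

Definition chrmx g p m : 'M[R]_n := \matrix_(i, j) christoffel g p m i j.

Definition chr g p u v : 'rV[R]_n := \row_m dot (u *m chrmx g p m) v.

(** In [chr g p u v] above, the field with constant components [u] is differentiated along [v].
    Likewise the second vector argument of [cov] below is the direction of differentiation, as in
    [b_{i|j}]. *)
Definition covmx g w p : 'M[R]_n := \matrix_(i, j) covd g w p i j.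

Definition cov g w p u v : R := dot (u *m covmx g w p) v.

Definition nab g w p v : 'rV[R]_n := v *m (covmx g w p)^T.

Lemma alpha2E g p y : alpha2 g p y = gm g p y y.
Proof. exact: quad_mxE. Qed.

Lemma gmDl g p u v x : gm g p (u + v) x = gm g p u x + gm g p v x.
Proof. by rewrite /gm mulmxDl dotDl. Qed.
Lemma gmZl g p c u x : gm g p (c *: u) x = c * gm g p u x.
Proof. by rewrite /gm -scalemxAl dotZl. Qed.
Lemma gmDr g p u v x : gm g p x (u + v) = gm g p x u + gm g p x v.
Proof. exact: dotDr. Qed.
Lemma gmZr g p c u x : gm g p x (c *: u) = c * gm g p x u.
Proof. exact: dotZr. Qed.
Lemma gmNl g p u x : gm g p (- u) x = - gm g p u x.
Proof. by rewrite -scaleN1r gmZl mulN1r. Qed.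
Lemma gmNr g p u x : gm g p x (- u) = - gm g p x u.
Proof. exact: dotNr. Qed.

Lemma chrDl g p u v x : chr g p (u + v) x = chr g p u x + chr g p v x.
Proof. by apply/rowP => m; rewrite !mxE mulmxDl dotDl. Qed.
Lemma chrZl g p c u x : chr g p (c *: u) x = c *: chr g p u x.
Proof. by apply/rowP => m; rewrite !mxE -scalemxAl dotZl. Qed.
Lemma chrDr g p u v x : chr g p x (u + v) = chr g p x u + chr g p x v.
Proof. by apply/rowP => m; rewrite !mxE dotDr. Qed.
Lemma chrZr g p c u x : chr g p x (c *: u) = c *: chr g p x u.
Proof. by apply/rowP => m; rewrite !mxE dotZr. Qed.
Lemma chrNr g p u x : chr g p x (- u) = - chr g p x u.
Proof. by rewrite -scaleN1r chrZr scaleN1r. Qed.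

Lemma covDl g w p u v x : cov g w p (u + v) x = cov g w p u x + cov g w p v x.
Proof. by rewrite /cov mulmxDl dotDl. Qed.
Lemma covZl g w p c u x : cov g w p (c *: u) x = c * cov g w p u x.
Proof. by rewrite /cov -scalemxAl dotZl. Qed.
Lemma covNl g w p u x : cov g w p (- u) x = - cov g w p u x.
Proof. by rewrite -scaleN1r covZl mulN1r. Qed.
Lemma dot_nab g w p v u : dot (nab g w p v) u = cov g w p u v.
Proof. by rewrite /nab dot_mulmx trmxK dotC. Qed.

Lemma chrE g p u v m :
  chr g p u v 0 m = \sum_i \sum_j christoffel g p m i j * u 0 i * v 0 j.
Proof.
rewrite mxE -quad_mxE; apply: eq_bigr => i _; apply: eq_bigr => j _.
by rewrite mxE.
Qed.

Lemma covE g w p u v :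
  cov g w p u v = \sum_i \sum_j covd g w p i j * u 0 i * v 0 j.
Proof.
rewrite /cov -quad_mxE; apply: eq_bigr => i _; apply: eq_bigr => j _.
by rewrite mxE.
Qed.

Lemma cov_ecoord g w p i j : cov g w p (ecoord i) (ecoord j) = covd g w p i j.
Proof. by rewrite /cov dot_ecoord -rowE !mxE. Qed.

End tensors.

Record metric_on (R : realType) (n : nat) (U : set 'rV[R]_n) (g : 'rV[R]_n -> 'M[R]_n) : Prop :=
  { metric_open : open U ;
    metric_Cm : forall m i j, Cm m U (fun q => g q i j) ;
    metric_symmetric : forall q, U q -> (g q)^T = g q ;
    metric_pos : forall q, U q -> forall y, y != 0 -> 0 < alpha2 g q y }.

Record form_on (R : realType) (n : nat) (U : set 'rV[R]_n) (w : 'rV[R]_n -> 'rV[R]_n) : Prop :=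
  { form_Cm : forall m i, Cm m U (fun q => w q 0 i) }.

Section metric.
Context {R : realType} {n : nat} (U : set 'rV[R]_n) (g : 'rV[R]_n -> 'M[R]_n).
Hypothesis gU : metric_on U g.
Implicit Types (w : 'rV[R]_n -> 'rV[R]_n) (p q u v x y : 'rV[R]_n).

Let Uo : open U := metric_open gU.

Lemma metric_unit q : U q -> g q \in unitmx.
Proof.
move=> Uq; rewrite -row_free_unit -kermx_eq0; apply/negPn/negP => K0.
have v0 : nz_row (kermx (g q)) != 0 by rewrite nz_row_eq0.
have /sub_kermxP vg : (nz_row (kermx (g q)) <= kermx (g q))%MS by exact: nz_row_sub.
have := metric_pos gU Uq v0; rewrite alpha2E /gm vg dot0l ltxx.
by [].
Qed.

Lemma gmC q u v : U q -> gm g q u v = gm g q v u.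
Proof. by move=> Uq; rewrite /gm dot_mulmx (metric_symmetric gU Uq) dotC. Qed.

Lemma ginv_sym q : U q -> (ginv g q)^T = ginv g q.
Proof. by move=> Uq; rewrite /ginv trmx_inv (metric_symmetric gU Uq). Qed.

Lemma gm_sharp q u v : U q -> gm g q (sharp g q u) v = dot u v.
Proof. by move=> Uq; rewrite /gm /sharp mulmxKV ?metric_unit. Qed.

Lemma gm_sharpr q u v : U q -> gm g q v (sharp g q u) = dot u v.
Proof. by move=> Uq; rewrite gmC// gm_sharp. Qed.

Lemma gm_inj q u v : U q -> (forall x, gm g q u x = gm g q v x) -> u = v.
Proof.
by move=> Uq uv; apply: (can_inj (mulmxK (metric_unit Uq))); apply: dot_inj.
Qed.

Lemma ginv_Cm m i j : Cm m U (fun q => ginv g q i j).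
Proof.
apply: (@Cm_invmx R n U Uo m n g metric_unit).
by move=> a b; exact: (metric_Cm gU).
Qed.

Lemma christoffel_Cm m l i j : Cm m U (fun q => christoffel g q l i j).
Proof.
rewrite /christoffel; apply: CmZ => //; apply: Cm_sum => // k _.
apply: CmM => //; first exact: ginv_Cm.
have gP a b c : Cm m U (partial a (fun q => g q b c)) by apply: Cm_partial; exact: (metric_Cm gU).
apply: (CmB Uo) => //; first exact: CmD.
Qed.

Lemma christoffel_sym q l i j : U q -> christoffel g q l i j = christoffel g q l j i.
Proof.
move=> Uq; rewrite /christoffel; congr (_ * _); apply: eq_bigr => k _.
congr (_ * _); rewrite [X in X - _]addrC; congr (_ - _).
apply: (partial_eq_on _ Uo Uq) => r Ur.
by rewrite -{1}(metric_symmetric gU Ur) mxE.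
Qed.

Lemma chrC q u v : U q -> chr g q u v = chr g q v u.
Proof.
move=> Uq; apply/rowP => m; rewrite !chrE exchange_big; apply: eq_bigr => i _.
by apply: eq_bigr => j _; rewrite (christoffel_sym m _ _ Uq) -!mulrA [u _ _ * _]mulrC.
Qed.

Lemma chr_Cm m u v i : Cm m U (fun q => chr g q u v 0 i).
Proof.
under eq_fun do rewrite chrE.
apply: Cm_sum => // a _; apply: Cm_sum => // b _.
by do 2 (apply: CmM => //; last exact: Cm_cst); exact: christoffel_Cm.
Qed.

Definition dgm p v u x := \sum_k \sum_i \sum_j partial k (fun q => g q i j) p * v 0 k * u 0 i * x 0 j.

Lemma dd_gm_cst p v u x : U p -> dd p v (fun q => gm g q u x) (dgm p v u x).
Proof.
move=> Up; have H k : is_derive p (ecoord k) (fun q => gm g q u x)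
    (\sum_i \sum_j partial k (fun q => g q i j) p * u 0 i * x 0 j).
  rewrite /gm; under eq_fun do rewrite -quad_mxE.
  apply: is_derive_fct_sum => i _; apply: is_derive_fct_sum => j _.
  have gd : is_derive p (ecoord k) (fun q => g q i j) (partial k (fun q => g q i j) p).
    exact: (Cm_is_derive k (metric_Cm gU 1 i j) Up).
  have := is_derive_fctM (is_derive_fctM gd (is_derive_cst (u 0 i) p _)) (is_derive_cst (x 0 j) p _).
  by move/is_derive_eq; apply; rewrite !mulr0 !addr0.
have := @dd_intro _ _ p v _ _ H; move/dd_eq; apply; rewrite /dgm; apply: eq_bigr => k _.
rewrite mulr_sumr; apply: eq_bigr => i _; rewrite mulr_sumr; apply: eq_bigr => j _.
by ring.
Qed.

Lemma dgmC p v u x : U p -> dgm p v u x = dgm p v x u.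
Proof.
move=> Up; apply: dd_unique (dd_gm_cst v u x Up) _.
by apply: (dd_eq_on Uo Up _ (dd_gm_cst v x u Up)) => q Uq; exact: gmC.
Qed.

Lemma koszul p u v x : U p ->
  gm g p (chr g p u v) x = 2^-1 * (dgm p u v x + dgm p v u x - dgm p x u v).
Proof.
move=> Up.
pose K i j l := partial i (fun q => g q j l) p + partial j (fun q => g q i l) p
     - partial l (fun q => g q i j) p.
have -> : chr g p u v = 2^-1 *: sharp g p (\row_l \sum_i \sum_j K i j l * u 0 i * v 0 j).
  apply/rowP => m; rewrite chrE mxE mxE.
  under [X in _ = _ * X]eq_bigr do rewrite mxE mulr_suml.
  rewrite [in RHS]exchange_big /= mulr_sumr; apply: eq_bigr => i _.
  under [X in _ = _ * X]eq_bigr do rewrite mulr_suml.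
  rewrite [in RHS]exchange_big /= mulr_sumr; apply: eq_bigr => j _.
  rewrite /christoffel -!mulrA; congr (_ * _); rewrite mulr_suml; apply: eq_bigr => l _.
  rewrite -{1}(ginv_sym Up) mxE /K; ring.
rewrite gmZl gm_sharp//; congr (_ * _); rewrite /dot.
under eq_bigr do rewrite mxE mulr_suml.
rewrite exchange_big /=.
under eq_bigr do (under eq_bigr do rewrite mulr_suml; rewrite exchange_big /=).
have -> : dgm p v u x = \sum_i \sum_j \sum_l partial j (fun q => g q i l) p * v 0 j * u 0 i * x 0 l.
  by rewrite /dgm exchange_big.
have -> : dgm p x u v = \sum_i \sum_j \sum_l partial l (fun q => g q i j) p * x 0 l * u 0 i * v 0 j.
  rewrite /dgm exchange_big /=; apply: eq_bigr => i _; exact: exchange_big.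
rewrite /dgm -big_split -sumrB; apply: eq_bigr => i _.
rewrite -big_split -sumrB; apply: eq_bigr => j _.
rewrite -big_split -sumrB; apply: eq_bigr => l _ /=.
by rewrite /K; ring.
Qed.

Lemma compat p u v x : U p ->
  dgm p v u x = gm g p (chr g p u v) x + gm g p u (chr g p x v).
Proof.
move=> Up; rewrite [gm _ _ u _]gmC// !koszul//.
rewrite (dgmC x v u Up) (dgmC v x u Up) (dgmC u x v Up).
by field.
Qed.

(** A cyclic combination of the compatibility hypotheses is the Koszul formula. A candidate for the
    deformed connection thus has only to be checked, without inverting the deformed metric. *)
Lemma levi_civita_unique p (K : 'rV[R]_n -> 'rV[R]_n -> 'rV[R]_n) : U p ->
  (forall u v, K u v = K v u) ->
  (forall u v x, dd p v (fun q => gm g q u x) (gm g p (K u v) x + gm g p u (K x v))) ->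
  forall u v, chr g p u v = K u v.
Proof.
move=> Up Ks Kc u v; apply: (gm_inj Up) => x; rewrite koszul//.
have E a b c : dgm p b a c = gm g p (K a b) c + gm g p a (K c b).
  exact: dd_unique (dd_gm_cst b a c Up) (Kc a b c).
rewrite !E (Ks x u) (Ks x v) (Ks v u) ![gm _ _ _ (K _ _)]gmC//.
by field.
Qed.

Lemma ddr_form w p v : form_on U w -> U p ->
  exists2 dw, ddr p v w dw & forall u, dot dw u = cov g w p u v + dot (w p) (chr g p u v).
Proof.
move=> wC Up; have wd := ddr_Cm (m := n) v (form_Cm wC 1) Up.
exists (\row_i ddval p v (fun q => w q 0 i)) => // u.
rewrite {1}/dot covE.
have -> : dot (w p) (chr g p u v) = \sum_i \sum_j (\sum_m christoffel g p m i j * w p 0 m) * u 0 i * v 0 j.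
  rewrite /dot; under eq_bigr do rewrite chrE mulr_sumr.
  rewrite exchange_big; apply: eq_bigr => i _ /=.
  under eq_bigr do rewrite mulr_sumr.
  rewrite exchange_big; apply: eq_bigr => j _ /=.
  by rewrite !mulr_suml; apply: eq_bigr => m _; ring.
rewrite -big_split; apply: eq_bigr => i _ /=; rewrite mxE mulr_suml -big_split.
by apply: eq_bigr => j _ /=; rewrite /covd; ring.
Qed.

Lemma dd_form w p v u : form_on U w -> U p ->
  dd p v (fun q => dot (w q) u) (cov g w p u v + dot (w p) (chr g p u v)).
Proof.
move=> wC Up; have [dw wd <-] := ddr_form v wC Up.
by apply: dd_eq (dd_dot wd (ddr_cst p v u)) _; rewrite dot0r addr0.
Qed.

Lemma ddr_mulmx p v (F : 'rV[R]_n -> 'rV[R]_n) dF u : U p -> ddr p v F dF ->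
  dd p v (fun q => gm g q (F q) u) (gm g p dF u + dgm p v (F p) u).
Proof.
move=> Up Fd.
have gd k : ddr p v (fun q => ecoord k *m g q) (\row_j dgm p v (ecoord k) (ecoord j)).
  move=> j; rewrite mxE; have := dd_gm_cst v (ecoord k) (ecoord j) Up.
  by rewrite /gm; under eq_fun do rewrite dot_ecoord.
(* Expanding the moving vector in the coordinate basis leaves only constant vectors under the
   metric. *)
have E q : gm g q (F q) u = \sum_k F q 0 k * dot (ecoord k *m g q) u.
  rewrite /gm {1}(sum_ecoord (F q)) mulmx_suml dotE mulmx_suml summxE.
  by apply: eq_bigr => k _; rewrite -!scalemxAl mxE dotE.
have := @dd_sum _ _ p v _ (index_enum 'I_n) xpredT _ _
  (fun k _ => ddM (Fd k) (dd_dot (gd k) (ddr_cst p v u))).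
under eq_fun do rewrite -E.
move=> /dd_eq; apply.
rewrite big_split /=; congr (_ + _).
  rewrite /gm {2}(sum_ecoord dF) mulmx_suml [RHS]dotE mulmx_suml summxE.
  by apply: eq_bigr => k _; rewrite -!scalemxAl mxE dotE.
under eq_bigr do rewrite dot0r addr0 /dot mulr_sumr.
rewrite [RHS]/dgm.
under eq_bigr do under eq_bigr do rewrite mxE.
have L k j : dgm p v (ecoord k) (ecoord j) = \sum_l partial l (fun q => g q k j) p * v 0 l.
  apply: eq_bigr => l _; rewrite (bigD1 k)//= [X in _ + X]big1 ?addr0; last first.
    by move=> i /negPf ik; apply: big1 => j' _; rewrite mxE eqxx ik mulr0 mul0r.
  rewrite (bigD1 j)//= [X in _ + X]big1 ?addr0; last first.
    by move=> i /negPf ik; rewrite !mxE eqxx ik mulr0.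
  by rewrite !mxE !eqxx !mulr1.
under eq_bigr do under eq_bigr do rewrite L mulr_suml mulr_sumr.
under eq_bigr do rewrite exchange_big /=.
rewrite exchange_big /=; apply: eq_bigr => l _; apply: eq_bigr => k _.
by apply: eq_bigr => j _; ring.
Qed.

Lemma sharp_Cm w m i : form_on U w -> Cm m U (fun q => sharp g q (w q) 0 i).
Proof.
move=> wC; under eq_fun do rewrite mxE; apply: Cm_sum => // k _.
by apply: CmM => //; [exact: form_Cm wC m k|exact: ginv_Cm].
Qed.

(** The pairing of the dual vector field with a constant vector is differentiated in two ways, which
    avoids differentiating the inverse matrix. *)
Lemma ddr_sharp w p v : form_on U w -> U p ->
  ddr p v (fun q => sharp g q (w q))
    (sharp g p (nab g w p v) - chr g p (sharp g p (w p)) v).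
Proof.
move=> wC Up.
have Bd := ddr_Cm (m := n) v (fun i => sharp_Cm 1 i wC) Up.
apply: (ddr_eq Bd); apply: (gm_inj Up) => u.
have := ddr_mulmx u Up Bd.
have wd : dd p v (fun q => gm g q (sharp g q (w q)) u) (cov g w p u v + dot (w p) (chr g p u v)).
  apply: (dd_eq_on Uo Up _ (dd_form v u wC Up)) => q Uq.
  by rewrite gm_sharp.
move=> /(dd_unique wd); rewrite compat// gm_sharp//.
rewrite gmDl gmNl gm_sharp// dot_nab => E.
apply: (addIr (gm g p (chr g p (sharp g p (w p)) v) u + dot (w p) (chr g p u v))).
by rewrite -E; ring.
Qed.

End metric.

(** * Curvature contractions in terms of the connection *)

Section curvature.
Context {R : realType} {n : nat} (U : set 'rV[R]_n) (g : 'rV[R]_n -> 'M[R]_n).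
Hypothesis gU : metric_on U g.
Implicit Types (w : 'rV[R]_n -> 'rV[R]_n) (p q u v x y : 'rV[R]_n).

Let Uo : open U := metric_open gU.

Lemma dd_chr p x u v i : U p -> dd p x (fun q => chr g q u v 0 i)
  (\sum_k \sum_j \sum_l partial k (fun q => christoffel g q i j l) p * x 0 k * u 0 j * v 0 l).
Proof.
move=> Up; have H k : is_derive p (ecoord k) (fun q => chr g q u v 0 i)
    (\sum_j \sum_l partial k (fun q => christoffel g q i j l) p * u 0 j * v 0 l).
  under eq_fun do rewrite chrE.
  apply: is_derive_fct_sum => j _; apply: is_derive_fct_sum => l _.
  have gd := Cm_is_derive k (christoffel_Cm gU 1 i j l) Up.
  have := is_derive_fctM (is_derive_fctM gd (is_derive_cst (u 0 j) p _)) (is_derive_cst (v 0 l) p _).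
  by move/is_derive_eq; apply; rewrite !mulr0 !addr0.
have := @dd_intro _ _ p x _ _ H; move/dd_eq; apply; apply: eq_bigr => k _.
rewrite mulr_sumr; apply: eq_bigr => j _; rewrite mulr_sumr; apply: eq_bigr => l _.
by ring.
Qed.

(** Fields with constant components commute, so the curvature applied to [x], [y], [y] is the
    commutator of covariant derivatives without a bracket term. *)
Lemma Rik_chr p y x i : U p ->
  \sum_k Rik g p y i k * x 0 k =
  ddval p x (fun q => chr g q y y 0 i) - ddval p y (fun q => chr g q y x 0 i)
  + chr g p x (chr g p y y) 0 i - chr g p y (chr g p y x) 0 i.
Proof.
move=> Up; have [_ <-] := dd_chr x y y i Up; have [_ <-] := dd_chr y y x i Up.
have -> : \sum_k \sum_j \sum_l partial k (fun q => christoffel g q i j l) p * y 0 k * y 0 j * x 0 l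
    = \sum_k \sum_j \sum_l partial l (fun q => christoffel g q i j k) p * y 0 l * y 0 j * x 0 k.
  rewrite exchange_big /= [RHS]exchange_big /=; apply: eq_bigr => j _.
  by rewrite exchange_big.
have -> : chr g p x (chr g p y y) 0 i = \sum_k \sum_j \sum_l
    (\sum_m christoffel g p i k m * christoffel g p m j l) * x 0 k * y 0 j * y 0 l.
  rewrite chrE; apply: eq_bigr => k _.
  under eq_bigr do rewrite chrE mulr_sumr.
  rewrite exchange_big /=; apply: eq_bigr => j _.
  under eq_bigr do rewrite mulr_sumr.
  rewrite exchange_big /=; apply: eq_bigr => l _.
  by rewrite !mulr_suml; apply: eq_bigr => m _; ring.
have -> : chr g p y (chr g p y x) 0 i = \sum_k \sum_j \sum_l
    (\sum_m christoffel g p i l m * christoffel g p m j k) * x 0 k * y 0 j * y 0 l.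
  rewrite chrE.
  under eq_bigr do (under eq_bigr do (rewrite chrE mulr_sumr; under eq_bigr do rewrite mulr_sumr)).
  under eq_bigr do (rewrite exchange_big /=; under eq_bigr do rewrite exchange_big /=).
  rewrite exchange_big /= [RHS]exchange_big /=; apply: eq_bigr => j _.
  rewrite exchange_big /=; apply: eq_bigr => k _; apply: eq_bigr => l _.
  by rewrite !mulr_suml; apply: eq_bigr => m _; ring.
rewrite -sumrB -big_split -sumrB; apply: eq_bigr => k _ /=.
rewrite /Rik mulr_suml -sumrB -big_split -sumrB; apply: eq_bigr => j _ /=.
rewrite mulr_suml -sumrB -big_split -sumrB; apply: eq_bigr => l _ /=.
rewrite /riemann sumrB.
move: (partial _ _ _) (partial _ _ _) (\sum_m _) (\sum_m _) (x 0 k) (y 0 j) (y 0 l).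
by move=> c1 c2 c3 c4 c5 c6 c7; ring.
Qed.

Definition trc p u : R := \sum_k chr g p u (ecoord k) 0 k.

Definition Gmx p u : 'M[R]_n := \matrix_(k, i) chr g p u (ecoord k) 0 i.

Lemma mul_Gmx p u v : v *m Gmx p u = chr g p u v.
Proof.
rewrite {2}(sum_ecoord v); apply/rowP => i; rewrite mxE.
have -> : chr g p u (\sum_k v 0 k *: ecoord k) = \sum_k v 0 k *: chr g p u (ecoord k).
  elim/big_rec2: _ => [|k x1 x2 _ <-]; first by rewrite -[X in chr _ _ _ X](scale0r 0) chrZr scale0r.
  by rewrite chrDr chrZr.
by rewrite summxE; apply: eq_bigr => k _; rewrite !mxE.
Qed.

(** The trace of [Rik_chr]. One term is kept as a divergence, so that a change of connection can be
    inserted through the rules for [isdiv] instead of through indices. *)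
Lemma ricci_chr p y d : U p -> isdiv p (fun q => chr g q y y) d ->
  ricci g p y = d - ddval p y (fun q => trc q y) + trc p (chr g p y y)
                - \tr (Gmx p y *m Gmx p y).
Proof.
move=> Up [_ ->]; rewrite /ricci.
have E k : Rik g p y k k = \sum_l Rik g p y k l * (ecoord k : 'rV[R]_n) 0 l.
  rewrite (bigD1 k)//= mxE !eqxx mulr1 big1 ?addr0// => j /negPf jk.
  by rewrite mxE eqxx jk mulr0.
under eq_bigr do rewrite E Rik_chr//.
rewrite sumrB big_split sumrB /=; congr (_ - _ + _ - _).
- apply: eq_bigr => k _; rewrite /ddval (bigD1 k)//= mxE !eqxx mul1r big1 ?addr0// => j /negPf jk.
  by rewrite mxE eqxx jk mul0r.
- have := dd_sum (index_enum 'I_n) (fun k (_ : true) => dd_Cm y (chr_Cm gU 1 y (ecoord k) k) Up).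
  by case=> _ ->.
- by apply: eq_bigr => k _; rewrite (chrC gU)//.
by apply: eq_bigr => k _; rewrite -[LHS]dot_ecoord -!mul_Gmx -mulmxA dot_ecoord -rowE !mxE.
Qed.

Lemma covd_Cm w m i j : form_on U w -> Cm m U (fun q => covd g w q i j).
Proof.
move=> wC; rewrite /covd; apply: CmB => //.
  by apply: Cm_partial; exact: (form_Cm wC).
apply: Cm_sum => // l _; apply: CmM => //; first exact: (christoffel_Cm gU).
exact: (form_Cm wC).
Qed.

Lemma cov_Cm w m u v : form_on U w -> Cm m U (fun q => cov g w q u v).
Proof.
move=> wC; under eq_fun do rewrite covE.
apply: Cm_sum => // i _; apply: Cm_sum => // j _.
by do 2 (apply: CmM => //; last exact: Cm_cst); exact: covd_Cm.
Qed.

Lemma bupE w p m : U p -> bup g w p m = sharp g p (w p) 0 m.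
Proof.
move=> Up; rewrite mxE; apply: eq_bigr => l _.
by rewrite -{1}(ginv_sym gU Up) mxE mulrC.
Qed.

Lemma normsqE w p : U p -> normsq g w p = dot (w p) (sharp g p (w p)).
Proof. by move=> Up; apply: eq_bigr => l _; rewrite bupE. Qed.

End curvature.

Definition sform (R : realType) (n : nat) (g : 'rV[R]_n -> 'M[R]_n) (b : 'rV[R]_n -> 'rV[R]_n)
  (p : 'rV[R]_n) : 'rV[R]_n := \row_i s_ g b p i.

Definition killing_on (R : realType) (n : nat) (U : set 'rV[R]_n) (g : 'rV[R]_n -> 'M[R]_n)
  (b : 'rV[R]_n -> 'rV[R]_n) : Prop :=
  forall q, U q -> forall k l, covd g b q k l + covd g b q l k = 0.

(** * Killing forms: gradient and Hessian of the squared length *)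

Section killing.
Context {R : realType} {n : nat} (U : set 'rV[R]_n) (g : 'rV[R]_n -> 'M[R]_n).
Context (b : 'rV[R]_n -> 'rV[R]_n).
Hypothesis gU : metric_on U g.
Hypothesis bU : form_on U b.
Hypothesis bK : killing_on U g b.
Implicit Types (p q u v x y : 'rV[R]_n).

Let Uo : open U := metric_open gU.
Local Notation B p := (sharp g p (b p)).
Local Notation s := (sform g b).

Lemma covN q u v : U q -> cov g b q u v = - cov g b q v u.
Proof.
move=> Uq; apply/eqP; rewrite -subr_eq0 opprK !covE [X in _ + X]exchange_big -big_split /=.
apply/eqP; apply: big1 => i _; rewrite -big_split; apply: big1 => j _ /=.
have /(canRL (addrK _)) -> := bK Uq i j; rewrite sub0r; ring.
Qed.

Lemma cov_diag q u : U q -> cov g b q u u = 0.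
Proof.
move=> Uq; have /eqP := covN u u Uq; rewrite -addr_eq0 -mulr2n mulrn_eq0 /=.
by move/eqP.
Qed.

Lemma sijE q i j : U q -> sij g b q i j = covd g b q i j.
Proof.
move=> Uq; have /(canRL (addKr _)) := bK Uq i j; rewrite addr0 /sij => ->.
by field.
Qed.

Lemma s0E p y : s0 g b p y = dot (s p) y.
Proof. by apply: eq_bigr => i _; rewrite mxE. Qed.

Lemma dot_s q u : U q -> dot (s q) u = cov g b q (B q) u.
Proof.
move=> Uq; rewrite covE exchange_big; apply: eq_bigr => j _ /=.
rewrite mxE mulr_suml; apply: eq_bigr => i _.
by rewrite (bupE gU)// sijE//; ring.
Qed.

Lemma sform_on : form_on U s.
Proof.
split=> m i; apply: (@Cm_eq_on _ _ _ _ (fun q => \sum_l sharp g q (b q) 0 l * covd g b q l i)) => //.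
  move=> q Uq; rewrite mxE; apply: eq_bigr => l _.
  by rewrite (bupE gU)// sijE.
apply: Cm_sum => // l _; apply: CmM => //; first exact: (sharp_Cm gU).
exact: (covd_Cm gU).
Qed.

(** Antisymmetry of the covariant derivative makes [t00] minus a squared norm; this form can be
    polarized, see [cov_S_regular]. *)
Lemma t00E p y : U p ->
  t00 g b p y = - dot (nab g b p y) (sharp g p (nab g b p y)).
Proof.
move=> Up.
have nE m : nab g b p y 0 m = \sum_j covd g b p m j * y 0 j.
  by rewrite mxE; apply: eq_bigr => j _; rewrite !mxE mulrC.
rewrite /t00 /tij /dot -sumrN [LHS]exchange_big /=.
transitivity (\sum_m \sum_l (\sum_i sij g b p i m * y 0 i) * ginv g p m l * (\sum_j sij g b p l j * y 0 j)).
  under eq_bigr do (under eq_bigr do rewrite !mulr_suml; rewrite exchange_big /=).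
  rewrite exchange_big /=; apply: eq_bigr => m _.
  under eq_bigr do (under eq_bigr do rewrite !mulr_suml; rewrite exchange_big /=).
  rewrite exchange_big /=; apply: eq_bigr => l _.
  rewrite exchange_big mulr_suml mulr_suml /=; apply: eq_bigr => i _.
  by rewrite mulr_sumr; apply: eq_bigr => j _; ring.
rewrite exchange_big /=.
have -> : \sum_l - (nab g b p y 0 l * sharp g p (nab g b p y) 0 l) =
    \sum_l \sum_m - (nab g b p y 0 m * ginv g p m l * nab g b p y 0 l).
  by apply: eq_bigr => l _; rewrite [sharp _ _ _ 0 l]mxE mulr_sumr -sumrN; apply: eq_bigr => m _; congr (- _); exact: mulrC.
apply: eq_bigr => l _; apply: eq_bigr => m _.
rewrite !nE; have -> : \sum_i sij g b p i m * y 0 i = - \sum_j covd g b p m j * y 0 j.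
  rewrite -sumrN; apply: eq_bigr => i _; rewrite sijE//.
  by have /(canRL (addrK _)) -> := bK Up i m; rewrite sub0r mulNr.
have -> : \sum_j sij g b p l j * y 0 j = \sum_j covd g b p l j * y 0 j.
  by apply: eq_bigr => j _; rewrite sijE.
by ring.
Qed.

Lemma dd_normsq p v : U p -> dd p v (normsq g b) (2 * dot (s p) v).
Proof.
move=> Up; have [db bd dbE] := ddr_form g v bU Up.
have := dd_dot bd (ddr_sharp gU v bU Up).
move=> /(dd_eq_on Uo Up (fun q Uq => esym (normsqE gU b Uq))) /dd_eq; apply.
rewrite dbE dotBr dot_s// -(gm_sharp gU (b p) (sharp g p (nab g b p v)) Up).
by rewrite (gm_sharpr gU)// dot_nab; ring.
Qed.

(* The Hessian of [normsq g b / 2] along a Killing field: commuting the two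
   covariant derivatives of [b] only costs a curvature term, the other order
   vanishing by antisymmetry. *)
Lemma cov_sform p y : U p -> cov g s p y y = - t00 g b p y - Rbb g b p y.
Proof.
move=> Up; set w := B p.
have sd := dd_form g y y sform_on Up.
have Bd := ddr_sharp gU y bU Up.
(* [dM] is the part of the derivative of [s] with the dual vector frozen at [p]; the variation of
   that vector contributes the [t00] term. *)
pose dM := ddval p y (fun q => cov g b q w y).
have covd1 i j : dd p y (fun q => covd g b q i j) (ddval p y (fun q => covd g b q i j)).
  exact: dd_Cm (covd_Cm gU 1 i j bU) Up.
have dME : dM = \sum_i \sum_j ddval p y (fun q => covd g b q i j) * w 0 i * y 0 j.
  have := dd_sum (index_enum 'I_n) (fun i (_ : true) => dd_sum (index_enum 'I_n)
    (fun j (_ : true) => ddM (ddM (covd1 i j) (dd_cst p y (w 0 i))) (dd_cst p y (y 0 j)))).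
  have -> : (fun q => \sum_(i in 'I_n) \sum_(j in 'I_n) covd g b q i j * w 0 i * y 0 j) =
     (fun q => cov g b q w y) by apply/funext => q; rewrite covE.
  move=> [_]; rewrite -/dM => <-; apply: eq_bigr => i _; apply: eq_bigr => j _; ring.
have sy : dd p y (fun q => dot (s q) y)
    (cov g b p (sharp g p (nab g b p y) - chr g p w y) y + dM).
  have := dd_sum (index_enum 'I_n) (fun i (_ : true) => dd_sum (index_enum 'I_n)
    (fun j (_ : true) => ddM (ddM (covd1 i j) (Bd i)) (dd_cst p y (y 0 j)))).
  move/(dd_eq_on Uo Up (h := fun q => dot (s q) y)).
  have H q : U q -> \sum_(i in 'I_n) \sum_(j in 'I_n) covd g b q i j * sharp g q (b q) 0 i * y 0 j = dot (s q) y.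
    by move=> Uq; rewrite dot_s// covE.
  move/(_ H)/dd_eq; apply.
  rewrite dME covE -big_split; apply: eq_bigr => i _; rewrite -big_split; apply: eq_bigr => j _ /=.
  by rewrite -/w; ring.
have := dd_unique sd sy => /(canRL (addrK _)) ->.
have cb u v q : U q -> cov g b q u v = ddval q v (fun r => dot (b r) u) - dot (b q) (chr g q u v).
  by move=> Uq; have [_ <-] := dd_form g v u bU Uq; rewrite addrK.
have bC u : Cm 2 U (fun r => dot (b r) u).
  by apply: Cm_sum => // i _; apply: CmM => //; [exact: form_Cm bU 2 i|exact: Cm_cst].
have ddvC u v : Cm 1 U (fun r => ddval r v (fun r => dot (b r) u)).
  by apply: Cm_sum => // i _; apply: CmM => //; [exact: Cm_cst|exact: Cm_partial (bC u)].
have chrd u v x : ddr p x (fun q => chr g q u v) (\row_i ddval p x (fun q => chr g q u v 0 i)).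
  exact: ddr_Cm (fun i => chr_Cm gU 1 u v i) Up.
have [dby bdy dbyE] := ddr_form g y bU Up.
have [dbw bdw dbwE] := ddr_form g w bU Up.
pose Dyw := \row_i ddval p y (fun q => chr g q y w 0 i).
pose Dwy := \row_i ddval p w (fun q => chr g q y y 0 i).
have E1 : dM = - (ddval p y (fun r => ddval r w (fun r => dot (b r) y))
    - (dot dby (chr g p y w) + dot (b p) Dyw)).
  have H := ddN (ddB (dd_Cm y (ddvC y w) Up) (dd_dot bdy (chrd y w y))).
  have : dd p y (fun q => cov g b q w y) dM by apply: dd_Cm (cov_Cm gU 1 w y bU) Up.
  move=> /dd_unique; apply.
  by apply: (dd_eq_on Uo Up _ H) => q Uq; rewrite covN// cb.
have E2 : 0 = ddval p w (fun r => ddval r y (fun r => dot (b r) y))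
    - (dot dbw (chr g p y y) + dot (b p) Dwy).
  have H := ddB (dd_Cm w (ddvC y y) Up) (dd_dot bdw (chrd y y w)).
  apply: dd_unique (dd_cst p w 0) _.
  by apply: (dd_eq_on Uo Up _ H) => q Uq; rewrite -cb// cov_diag.
(* The two mixed second derivatives of [b] are exchanged here, by [schwarz]. *)
have E3 : ddval p y (fun r => ddval r w (fun r => dot (b r) y)) =
    ddval p w (fun r => ddval r y (fun r => dot (b r) y)).
  have X v v' : ddval p v (fun r => ddval r v' (fun r => dot (b r) y)) =
      \sum_k \sum_l v 0 k * v' 0 l * partial k (partial l (fun r => dot (b r) y)) p.
    have := dd_sum (index_enum 'I_n) (fun k (_ : true) =>
      ddZ (v' 0 k) (dd_Cm v (Cm_partial k (bC y)) Up)).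
    move=> [_] E; symmetry; transitivity (\sum_l v' 0 l * ddval p v (partial l (fun r => dot (b r) y))) => //.
    rewrite exchange_big; apply: eq_bigr => l _ /=; rewrite /ddval mulr_sumr.
    by apply: eq_bigr => k _; ring.
  rewrite !X exchange_big; apply: eq_bigr => k _; apply: eq_bigr => l _ /=.
  by rewrite (schwarz _ _ Uo Up (bC y)); ring.
have RE : Rbb g b p y = dot (b p) Dwy - dot (b p) Dyw
    + dot (b p) (chr g p w (chr g p y y)) - dot (b p) (chr g p y (chr g p y w)).
  rewrite /Rbb -dotBr -dotDr -dotBr; apply: eq_bigr => i _.
  transitivity (b p 0 i * \sum_k Rik g p y i k * w 0 k).
    by rewrite mulr_sumr; apply: eq_bigr => k _; rewrite (bupE gU)// -/w; ring.
  by rewrite (Rik_chr gU)// !mxE.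
have dByE : cov g b p (sharp g p (nab g b p y)) y = - t00 g b p y.
  by rewrite t00E// opprK -dot_nab.
rewrite RE E1 E3 !covDl covNl dByE dot_s// -/w.
move: E2 => /esym/(canRL (subrK _)); rewrite add0r => ->.
rewrite dbyE dbwE (chrC gU y w Up) (chrC gU _ y Up) (chrC gU _ w Up).
rewrite (covN w _ Up) (chrC gU w (chr g p y y) Up) (chrC gU y (chr g p w y) Up).
move: (t00 _ _ _ _) (cov g b p (chr g p w y) y) (cov g b p (chr g p y y) w) (dot _ Dwy) (dot _ Dyw).
move: (dot _ (chr g p (chr g p y y) w)) (dot _ (chr g p (chr g p w y) y)).
by move=> c1 c2 c3 c4 c5 c6 c7; ring.
Qed.

End killing.

(** * Deformation of a metric along a Killing form *)

Section killing_algebra.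
Context {R : realType} {n : nat} (U : set 'rV[R]_n) (g : 'rV[R]_n -> 'M[R]_n).
Context (b : 'rV[R]_n -> 'rV[R]_n).
Hypothesis gU : metric_on U g.
Hypothesis bU : form_on U b.
Hypothesis bK : killing_on U g b.
Implicit Types (p q u v x y : 'rV[R]_n).

Local Notation B q := (sharp g q (b q)).
Local Notation s := (sform g b).
Local Notation S q := (sharp g q (sform g b q)).
Local Notation Sv q u := (sharp g q (nab g b q u)).

Lemma sharp_sym q u v : U q -> dot u (sharp g q v) = dot v (sharp g q u).
Proof. by move=> Uq; rewrite -(gm_sharp gU u _ Uq) -(gm_sharpr gU v _ Uq). Qed.

Lemma dot_sB q : U q -> dot (s q) (B q) = 0.
Proof. by move=> Uq; rewrite (dot_s gU bK)// (cov_diag bK). Qed.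

Lemma dot_bS q : U q -> dot (b q) (S q) = 0.
Proof. by move=> Uq; rewrite sharp_sym// dot_sB. Qed.

Lemma dot_bSv q u : U q -> dot (b q) (Sv q u) = dot (s q) u.
Proof. by move=> Uq; rewrite sharp_sym// dot_nab (dot_s gU bK). Qed.

Lemma dot_sSv q u : U q -> dot (s q) (Sv q u) = cov g b q (S q) u.
Proof. by move=> Uq; rewrite sharp_sym// dot_nab. Qed.

Lemma dot_nabB q u : U q -> dot (nab g b q u) (B q) = dot (s q) u.
Proof. by move=> Uq; rewrite dot_nab (dot_s gU bK). Qed.

Lemma cov_ySv q y : U q -> cov g b q y (Sv q y) = t00 g b q y.
Proof. by move=> Uq; rewrite (covN bK)// -dot_nab (t00E bK). Qed.

Lemma gm_ge0 q y : U q -> 0 <= gm g q y y.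
Proof.
move=> Uq; have [->|y0] := eqVneq y 0; first by rewrite /gm mul0mx dot0l.
by rewrite -alpha2E ltW// (metric_pos gU Uq y0).
Qed.

Lemma normsq_ge0 q : U q -> 0 <= normsq g b q.
Proof. by move=> Uq; rewrite (normsqE gU)// -(gm_sharpr gU _ _ Uq) gm_ge0. Qed.

Lemma form_cauchy_schwarz q y : U q -> dot (b q) y ^+ 2 <= normsq g b q * gm g q y y.
Proof.
move=> Uq; have f0 := normsq_ge0 Uq.
have fE : gm g q (B q) (B q) = normsq g b q by rewrite (gm_sharp gU)// (normsqE gU).
have [fz|fnz] := eqVneq (normsq g b q) 0.
  have Bz : B q = 0.
    apply/eqP/negPn/negP => B0; have := metric_pos gU Uq B0.
    by rewrite alpha2E fE fz ltxx.
  by rewrite fz mul0r -(gm_sharp gU (b q) y Uq) Bz /gm mul0mx dot0l expr0n.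
have fp : 0 < normsq g b q by rewrite lt0r fnz.
(* With [f] the squared norm of [b], the squared norm of this vector is
   [f * (f * |y|^2 - beta(y)^2)]. *)
have := gm_ge0 (normsq g b q *: y - dot (b q) y *: B q) Uq.
rewrite !gmDl !gmDr !gmNl !gmNr !gmZl !gmZr fE (gm_sharp gU)// (gm_sharpr gU)//.
move: (normsq g b q) (dot (b q) y) (gm g q y y) fp => f be a fp H.
rewrite -subr_ge0 -(pmulr_rge0 _ fp).
by apply: le_trans H _; rewrite le_eqVlt; apply/orP; left; apply/eqP; ring.
Qed.

End killing_algebra.

Section deformation.
Context {R : realType} {n : nat} (U : set 'rV[R]_n) (g : 'rV[R]_n -> 'M[R]_n).
Context (b : 'rV[R]_n -> 'rV[R]_n).
Hypothesis gU : metric_on U g.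
Hypothesis bU : form_on U b.
Hypothesis bK : killing_on U g b.
Implicit Types (p q u v x y : 'rV[R]_n).

Let Uo : open U := metric_open gU.
Local Notation B q := (sharp g q (b q)).
Local Notation s := (sform g b).
Local Notation S q := (sharp g q (sform g b q)).
Local Notation Sv q u := (sharp g q (nab g b q u)).
Local Notation f := (normsq g b).

Variables (J : set R) (E kap : R -> R).
Hypothesis UJ : forall q, U q -> J (f q).
Hypothesis ES : smooth_on_line J E.
Hypothesis kapS : smooth_on_line J kap.
Hypothesis E_gt0 : forall q, U q -> 0 < E (f q).
Hypothesis Delta_gt0 : forall q, U q -> 0 < 1 - f q * kap (f q).

Definition deform q : 'M[R]_n := E (f q) *: (g q - kap (f q) *: ((b q)^T *m b q)).

(* The coefficients of the difference of the two connections.  The division in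
   [defX] comes from inverting the rank one perturbation [g - kap b b]. *)
Definition defA t : R := derive1 E t / E t.
Definition defX t : R := - (derive1 kap t + kap t ^+ 2) / (1 - t * kap t).
Definition defY t : R := derive1 kap t + defA t * kap t.

Definition defT q u v : 'rV[R]_n :=
  let t := f q in
  defA t *: (dot (s q) u *: v + dot (s q) v *: u - gm g q u v *: S q)
  + (defX t * (dot (s q) u * dot (b q) v + dot (s q) v * dot (b q) u)) *: B q
  + (defY t * (dot (b q) u * dot (b q) v)) *: S q
  - kap t *: (dot (b q) v *: Sv q u + dot (b q) u *: Sv q v).

Lemma E_is_derive q : U q -> is_derive (f q) 1 E (derive1 E (f q)).
Proof. by move=> Uq; rewrite derive1E; apply: derivableP; exact: (@ES 0%N _ (UJ Uq)). Qed.

Lemma kap_is_derive q : U q -> is_derive (f q) 1 kap (derive1 kap (f q)).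
Proof. by move=> Uq; rewrite derive1E; apply: derivableP; exact: (@kapS 0%N _ (UJ Uq)). Qed.

Lemma gm_deform q u v : gm deform q u v =
  E (f q) * (gm g q u v - kap (f q) * dot (b q) u * dot (b q) v).
Proof.
rewrite /gm /deform -scalemxAr dotZl mulmxBr dotBl -scalemxAr dotZl mul_outer dotZl.
by rewrite mulrA (dotC u).
Qed.

Lemma normsq_Cm m : Cm m U f.
Proof.
apply: (@Cm_eq_on _ _ _ _ (fun q => dot (b q) (B q))) => //.
  by move=> q Uq; rewrite (normsqE gU).
apply: Cm_sum => // i _; apply: CmM => //; first exact: (form_Cm bU).
exact: (sharp_Cm gU).
Qed.

Lemma deform_metric_on : metric_on U deform.
Proof.
split=> //.
- move=> m i j; under eq_fun do rewrite mxE mxE mxE mxE mxE.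
  under eq_fun do rewrite big_ord1 mxE.
  apply: CmM => //; first exact: (Cm_comp Uo ES UJ (normsq_Cm m)).
  apply: CmB => //; first exact: (metric_Cm gU).
  apply: CmM => //; first exact: (Cm_comp Uo kapS UJ (normsq_Cm m)).
  by apply: CmM => //; exact: (form_Cm bU).
- move=> q Uq; rewrite /deform linearZ linearB linearZ /= trmx_mul trmxK.
  by rewrite (metric_symmetric gU Uq).
move=> q Uq y y0; rewrite alpha2E gm_deform mulr_gt0 ?E_gt0//.
have := form_cauchy_schwarz b gU y Uq.
have := metric_pos gU Uq y0; rewrite alpha2E.
have := Delta_gt0 Uq.
move: (dot (b q) y) (gm g q y y) (f q) (kap (f q)) => be a t k D a0 cs.
rewrite -mulrA -expr2 subr_gt0.
(* A nonpositive [kap] only enlarges the form; otherwise Cauchy-Schwarz and the positivity of Delta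
   bound the subtracted term. *)
have [k0|k0] := lerP k 0.
  by apply: le_lt_trans a0; rewrite mulr_le0_ge0// sqr_ge0.
apply: (@le_lt_trans _ _ (k * (t * a))); first by rewrite ler_pM2l.
by rewrite mulrA -subr_gt0 -{1}(mul1r a) -mulrBl mulr_gt0// mulrC.
Qed.

Lemma gm_T q u v x : U q -> gm g q (defT q u v) x =
  defA (f q) * (dot (s q) u * gm g q v x + dot (s q) v * gm g q u x - gm g q u v * dot (s q) x)
  + defX (f q) * (dot (s q) u * dot (b q) v + dot (s q) v * dot (b q) u) * dot (b q) x
  + defY (f q) * (dot (b q) u * dot (b q) v) * dot (s q) x
  - kap (f q) * (dot (b q) v * cov g b q x u + dot (b q) u * cov g b q x v).
Proof.
move=> Uq; rewrite /defT !(gmDl, gmZl, gmNl) !(gm_sharp gU)//.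
by rewrite !dot_nab.
Qed.

Lemma dot_bT q u v : U q -> dot (b q) (defT q u v) =
  (defA (f q) + defX (f q) * f q - kap (f q)) *
    (dot (s q) u * dot (b q) v + dot (s q) v * dot (b q) u).
Proof.
move=> Uq; rewrite /defT !(dotDr, dotZr, dotNr) !(dot_bS gU bK)// !(dot_bSv gU bK)//.
by rewrite -(normsqE gU)//; ring.
Qed.

Lemma dot_sT q u v : U q -> dot (s q) (defT q u v) =
  defA (f q) * (2 * dot (s q) u * dot (s q) v - gm g q u v * dot (s q) (S q))
  + defY (f q) * (dot (b q) u * dot (b q) v) * dot (s q) (S q)
  - kap (f q) * (dot (b q) v * cov g b q (S q) u + dot (b q) u * cov g b q (S q) v).
Proof.
move=> Uq; rewrite /defT !(dotDr, dotZr, dotNr) !(dot_sB gU bK)// !(dot_sSv b gU)//.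
by ring.
Qed.

(** The candidate is symmetric and compatible with the deformed metric, so [levi_civita_unique]
    identifies it; [defA], [defX] and [defY] are what compatibility requires. *)
Lemma chr_deform q u v : U q -> chr deform q u v = chr g q u v + defT q u v.
Proof.
move=> Uq; pose K u v := chr g q u v + defT q u v.
apply: (levi_civita_unique deform_metric_on (K := K)) => // [{u v}u v|{u v}u v x].
  rewrite /K (chrC gU)// /defT (gmC gU u v Uq); congr (_ + _).
  by rewrite [_ *: v + _]addrC [X in defX _ * X]addrC [X in defY _ * X]mulrC [_ *: Sv q u + _]addrC.
have Ed := dd_comp (E_is_derive Uq) (dd_normsq gU bU bK v Uq).
have kd := dd_comp (kap_is_derive Uq) (dd_normsq gU bU bK v Uq).
have H := ddM Ed (ddB (dd_gm_cst gU v u x Uq)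
  (ddM (ddM kd (dd_form g v u bU Uq)) (dd_form g v x bU Uq))).
have FE : (fun r => gm deform r u x) = (fun r => E (f r) * (gm g r u x - kap (f r) * dot (b r) u * dot (b r) x)).
  by apply/funext => r; rewrite gm_deform.
rewrite FE; apply: (dd_eq H) => {H FE Ed kd}.
rewrite !gm_deform /K (gmDl _ _ (chr g q u v) (defT q u v)) (gmDr _ _ (chr g q x v) (defT q x v)).
rewrite (gmC gU u (defT q x v) Uq) !gm_T//.
rewrite (dotDr (chr g q u v) (defT q u v)) (dotDr (chr g q x v) (defT q x v)) !dot_bT//.
rewrite (compat gU)// (gmC gU v x Uq) (gmC gU v u Uq) (gmC gU x u Uq).
rewrite (covN bK x u Uq).
move: (chr g q u v) (chr g q x v) => c1 c2.
move: (gm g q c1 x) (gm g q u c2) (dot (b q) c1) (dot (b q) c2) => {c1 c2} c1 c2 c3 c4.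
have := E_gt0 Uq; have := Delta_gt0 Uq; rewrite /defX /defY /defA.
move: (f q) => t; move: (E t) (kap t) (derive1 E t) (derive1 kap t) => e k e1 k1.
move: (cov g b q u v) (cov g b q x v) (cov g b q u x) => m1 m2 m3.
move: (gm g q u v) (gm g q x v) (gm g q u x) => g1 g2 g3.
move: (dot (s q) u) (dot (s q) v) (dot (s q) x) => s1 s2 s3.
move: (dot (b q) u) (dot (b q) v) (dot (b q) x) => b1 b2 b3 /lt0r_neq0 D0 /lt0r_neq0 e0.
by field; rewrite D0 e0.
Qed.

Variable k : R.

(** [defN1] is the derivative of [defN], and [defc] that of [k * t * defN t], the barred squared
    length as a function of [t]. As [s] is half the differential of the squared length, [defc] is
    the factor between the barred [s] and the original one. *)
Definition defN t : R := k * (1 - t * kap t) * E t.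
Definition defN1 t : R :=
  k * (- (kap t + t * derive1 kap t)) * E t + k * (1 - t * kap t) * derive1 E t.
Definition defc t : R := k * (defN t + defN1 t * t).
(* Lowering with [deform] the index of the vector field dual to [b] gives
   [dual_form] with [k = 1]. *)
Definition dual_form q : 'rV[R]_n := defN (f q) *: b q.

Local Notation gb := deform.
Local Notation bb := dual_form.

Lemma defN_is_derive q : U q -> is_derive (f q) 1 defN (defN1 (f q)).
Proof.
move=> Uq; have id1 := is_derive_id (f q) (1 : R).
have H := is_derive_fctM (is_derive_fctM (is_derive_cst k (f q) 1)
  (is_derive_fctB (is_derive_cst (1 : R) (f q) 1) (is_derive_fctM id1 (kap_is_derive Uq)))) (E_is_derive Uq).
apply: (is_derive_eq H); rewrite /defN1.
move: (f q) (E _) (kap _) (derive1 E _) (derive1 kap _) => t e c e1 c1 /=; ring.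
Qed.

Lemma dual_form_on : form_on U bb.
Proof.
split=> m i; under eq_fun do rewrite mxE.
apply: CmM => //; last exact: (form_Cm bU).
apply: CmM => //; last exact: (Cm_comp Uo ES UJ (normsq_Cm m)).
apply: CmZ => //; apply: CmB => //; first exact: Cm_cst.
by apply: CmM => //; [exact: normsq_Cm|exact: (Cm_comp Uo kapS UJ (normsq_Cm m))].
Qed.

(** [defA + t * defX - kap] is the logarithmic derivative of [(1 - t * kap t) * E t]. Hence the
    symmetric term coming from [defT] cancels the symmetric part of the derivative of the factor
    [defN], and what remains is antisymmetric. *)
Lemma cov_dual q u v : U q -> cov gb bb q u v =
  defN (f q) * cov g b q u v
  + defN1 (f q) * (dot (s q) v * dot (b q) u - dot (s q) u * dot (b q) v).
Proof.
move=> Uq.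
have H1 := dd_form gb v u dual_form_on Uq.
have H2 : dd q v (fun r => dot (bb r) u)
    (defN1 (f q) * (2 * dot (s q) v) * dot (b q) u
     + defN (f q) * (cov g b q u v + dot (b q) (chr g q u v))).
  have := ddM (dd_comp (defN_is_derive Uq) (dd_normsq gU bU bK v Uq)) (dd_form g v u bU Uq).
  by under eq_fun do rewrite -dotZl.
have := dd_unique H1 H2 => /(canRL (addrK _)) ->.
rewrite chr_deform// /dual_form dotZl (dotDr (chr g q u v) (defT q u v)) dot_bT//.
have := E_gt0 Uq; have := Delta_gt0 Uq; rewrite /defN /defN1 /defX /defY /defA.
move: (dot (b q) (chr g q u v)) (cov g b q u v) => c1 m1.
move: (f q) => t; move: (E t) (kap t) (derive1 E t) (derive1 kap t) => e c e1 k1.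
move: (dot (s q) u) (dot (s q) v) => s1 s2.
move: (dot (b q) u) (dot (b q) v) => b1 b2 /lt0r_neq0 D0 /lt0r_neq0 e0.
by field; rewrite D0 e0.
Qed.

Lemma killing_dual : killing_on U gb bb.
Proof.
move=> q Uq i j; rewrite -!cov_ecoord !cov_dual// (covN bK _ _ Uq).
by move: (cov _ _ _ _ _) (dot _ _) (dot _ _) (dot _ _) (dot _ _) => *; ring.
Qed.

Lemma nab_dual q y : U q -> nab gb bb q y =
  defN (f q) *: nab g b q y
  + defN1 (f q) *: (dot (s q) y *: b q - dot (b q) y *: s q).
Proof.
move=> Uq; apply: dot_inj => u; rewrite dot_nab cov_dual//.
rewrite dotDl !dotZl dot_nab dotBl !dotZl.
by move: (cov _ _ _ _ _) (dot _ _) (dot _ _) (dot _ _) (dot _ _) => *; ring.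
Qed.

(** The Sherman-Morrison formula for a rank one perturbation, checked by pairing with vectors. *)
Lemma sharp_deform q w : U q -> sharp gb q w = (E (f q))^-1 *:
  (sharp g q w + (kap (f q) / (1 - f q * kap (f q)) * dot w (B q)) *: B q).
Proof.
move=> Uq; apply: (gm_inj deform_metric_on Uq) => x.
rewrite (gm_sharp deform_metric_on)// gm_deform.
rewrite gmZl gmDl gmZl !(gm_sharp gU)// dotZr dotDr dotZr -(normsqE gU b Uq).
rewrite (sharp_sym gU (b q) w Uq).
have := E_gt0 Uq; have := Delta_gt0 Uq.
move: (dot w x) (dot w (B q)) (dot (b q) x) => w1 w2 b1.
move: (f q) => t; move: (E t) (kap t) => e c /lt0r_neq0 D0 /lt0r_neq0 e0.
by field; rewrite D0 e0.
Qed.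

Lemma sharp_dual q : U q -> sharp gb q (bb q) = k *: B q.
Proof.
move=> Uq; rewrite sharp_deform// /dual_form dotZl -(normsqE gU b Uq).
have -> : sharp g q (defN (f q) *: b q) = defN (f q) *: B q by rewrite /sharp -scalemxAl.
rewrite -scalerDl scalerA; congr (_ *: _); rewrite /defN.
have := E_gt0 Uq; have := Delta_gt0 Uq.
move: (f q) => t; move: (E t) (kap t) => e c /lt0r_neq0 D0 /lt0r_neq0 e0.
by field; rewrite D0 e0.
Qed.

Lemma normsq_dual q : U q -> normsq gb bb q = k * defN (f q) * f q.
Proof.
move=> Uq; rewrite (normsqE deform_metric_on)// sharp_dual// dotZl dotZr -(normsqE gU b Uq).
by rewrite mulrCA mulrA.
Qed.

Lemma sform_dual q : U q -> sform gb bb q = defc (f q) *: s q.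
Proof.
move=> Uq; apply: dot_inj => u; rewrite (dot_s deform_metric_on killing_dual)//.
rewrite sharp_dual// covZl cov_dual// -(normsqE gU b Uq) (dot_sB gU bK)//.
rewrite -(dot_s gU bK)// dotZl /defc.
by move: (f q) (defN _) (defN1 _) (dot (s q) u) (dot _ _) => *; ring.
Qed.

Lemma t00_dual q y : U q -> t00 gb bb q y =
  - (E (f q))^-1 * (defN (f q) ^+ 2 * - t00 g b q y
   + 2 * defN (f q) * defN1 (f q) * (dot (s q) y ^+ 2 - dot (b q) y * cov g b q (S q) y)
   + defN1 (f q) ^+ 2 * (dot (s q) y ^+ 2 * f q + dot (b q) y ^+ 2 * dot (s q) (S q))
   + kap (f q) / (1 - f q * kap (f q)) *
     (defN (f q) * dot (s q) y + defN1 (f q) * dot (s q) y * f q) ^+ 2).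
Proof.
move=> Uq; rewrite (t00E killing_dual)// sharp_deform// nab_dual//.
set w := _ + _.
have wB : dot w (B q) = defN (f q) * dot (s q) y + defN1 (f q) * dot (s q) y * f q.
  rewrite /w dotDl !dotZl dotBl !dotZl (dot_sB gU bK)// (dot_nabB gU bK)// -(normsqE gU b Uq).
  by move: (f q) (defN _) (defN1 _) (dot (s q) y) (dot _ _) => *; ring.
have ww : dot w (sharp g q w) = defN (f q) ^+ 2 * - t00 g b q y
   + 2 * defN (f q) * defN1 (f q) * (dot (s q) y ^+ 2 - dot (b q) y * cov g b q (S q) y)
   + defN1 (f q) ^+ 2 * (dot (s q) y ^+ 2 * f q + dot (b q) y ^+ 2 * dot (s q) (S q)).
  have -> : sharp g q w = defN (f q) *: Sv q y
      + defN1 (f q) *: (dot (s q) y *: B q - dot (b q) y *: S q).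
    by rewrite /w /sharp mulmxDl -!scalemxAl mulmxBl -!scalemxAl.
  rewrite /w !(dotDl, dotDr, dotZl, dotZr, dotNl, dotNr).
  rewrite (dot_nabB gU bK)// (dot_sB gU bK)// (dot_bS gU bK)// (dot_bSv gU bK)//.
  rewrite (dot_sSv b gU)// -(normsqE gU b Uq) (t00E bK)// !dot_nab.
  move: (f q) (defN _) (defN1 _) (cov g b q (Sv q y) y) (cov g b q (S q) y) (dot (s q) (S q)) => x1 x2 x3 x4 x5 x6.
  by move: (dot (s q) y) (dot (b q) y) => x7 x8; ring.
rewrite dotZr dotDr dotZr (sharp_sym gU w (b q)) // ww.
rewrite (sharp_sym gU (b q) w Uq) wB.
move: (E (f q))^-1 (kap _ / _) => x1 x2.
move: (f q) (defN _) (defN1 _) (t00 _ _ _ _) (cov _ _ _ _ _) (dot (s q) (S q)) => x3 x4 x5 x6 x7 x8.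
by move: (dot (s q) y) (dot (b q) y) => x9 x10; ring.
Qed.

Lemma cov_sform_dual q y c1 : U q -> is_derive (f q) 1 defc c1 ->
  cov gb (sform gb bb) q y y =
  2 * c1 * dot (s q) y ^+ 2 + defc (f q) * cov g s q y y
  - defc (f q) * dot (s q) (defT q y y).
Proof.
move=> Uq cd.
have H1 := dd_form gb y y (sform_on deform_metric_on dual_form_on killing_dual) Uq.
have H2 : dd q y (fun r => dot (sform gb bb r) y)
    (c1 * (2 * dot (s q) y) * dot (s q) y
     + defc (f q) * (cov g s q y y + dot (s q) (chr g q y y))).
  have := ddM (dd_comp cd (dd_normsq gU bU bK y Uq)) (dd_form g y y (sform_on gU bU bK) Uq).
  by apply: (dd_eq_on Uo Uq) => r Ur; rewrite sform_dual// dotZl.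
have := dd_unique H1 H2 => /(canRL (addrK _)) ->.
rewrite chr_deform// sform_dual// dotZl (dotDr (chr g q y y) (defT q y y)).
move: (defc _) (cov _ _ _ _ _) (dot _ (chr _ _ _ _)) (dot _ (defT _ _ _)) (dot _ _) => *.
by ring.
Qed.

End deformation.

Lemma Rbb_scale (R : realType) (n : nat) (g : 'rV[R]_n -> 'M[R]_n)
    (b w : 'rV[R]_n -> 'rV[R]_n) p y (c : R) :
  w p = c *: b p -> Rbb g w p y = c ^+ 2 * Rbb g b p y.
Proof.
move=> wb; rewrite /Rbb mulr_sumr; apply: eq_bigr => i _; rewrite mulr_sumr.
apply: eq_bigr => k _; have -> : bup g w p k = c * bup g b p k.
  by rewrite /bup mulr_sumr; apply: eq_bigr => l _; rewrite wb mxE mulrCA.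
by rewrite wb mxE; ring.
Qed.

Lemma mulmx_inj_all (R : realType) n (M N : 'M[R]_n) :
  (forall v : 'rV[R]_n, v *m M = v *m N) -> M = N.
Proof. by move=> MN; apply/row_matrixP => i; rewrite !rowE. Qed.

Lemma tr_mul_outer (R : realType) n (M : 'M[R]_n) (x y : 'rV[R]_n) :
  \tr (M *m (x^T *m y)) = dot x (y *m M).
Proof. by rewrite mxtrace_mulC -mulmxA tr_outer. Qed.

Lemma tr_outer_mul (R : realType) n (x y z w : 'rV[R]_n) :
  \tr (x^T *m y *m (z^T *m w)) = dot y z * dot x w.
Proof. by rewrite tr_mul_outer mul_outer dotZr mulrC (dotC z) (dotC w). Qed.

Lemma tr_sqrD (R : realType) n (M N : 'M[R]_n) :
  \tr ((M + N) *m (M + N)) = \tr (M *m M) + 2 * \tr (M *m N) + \tr (N *m N).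
Proof.
rewrite mulmxDl !mulmxDr !mxtraceD [\tr (N *m M)]mxtrace_mulC.
by move: (\tr _) (\tr _) (\tr _) => *; ring.
Qed.

(** * Traces of the connection and covariant divergence *)

Section divergence.
Context {R : realType} {n : nat} (U : set 'rV[R]_n) (g : 'rV[R]_n -> 'M[R]_n).
Hypothesis gU : metric_on U g.

Lemma trcE p u : trc g p u = \tr (Gmx g p u).
Proof. by apply: eq_bigr => i _; rewrite [RHS]mxE. Qed.

Lemma trcD p u v : trc g p (u + v) = trc g p u + trc g p v.
Proof. by rewrite /trc -big_split; apply: eq_bigr => i _; rewrite chrDl mxE. Qed.

Lemma trcZ p c u : trc g p (c *: u) = c * trc g p u.
Proof. by rewrite /trc mulr_sumr; apply: eq_bigr => i _; rewrite chrZl mxE. Qed.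

Definition divg w p : R := \tr ((covmx g w p)^T *m ginv g p).

Lemma isdiv_sharp w p : form_on U w -> U p ->
  isdiv p (fun q => sharp g q (w q)) (divg w p - trc g p (sharp g p (w p))).
Proof.
move=> wC Up; have := isdiv_intro (fun k => ddr_sharp gU (ecoord k) wC Up).
move/isdiv_eq; apply; rewrite /divg /trc /mxtrace -sumrB; apply: eq_bigr => k _.
by rewrite !mxE; congr (_ - _); apply: eq_bigr => j _; rewrite /nab -rowE !mxE.
Qed.

Lemma nab_form_on b y : form_on U b -> form_on U (fun q => nab g b q y).
Proof.
move=> bU; split=> m i; under eq_fun do rewrite mxE.
apply: Cm_sum; first exact: metric_open gU.
move=> j _; under eq_fun do rewrite !mxE.
apply: CmM; [exact: metric_open gU|exact: Cm_cst|exact: (covd_Cm gU)].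
Qed.

Lemma divg_killing b p : killing_on U g b -> U p -> divg b p = 0.
Proof.
move=> bK Up; rewrite /divg.
have CN : (covmx g b p)^T = - covmx g b p.
  apply/matrixP => i j; rewrite !mxE.
  by have /(canRL (addrK _)) -> := bK p Up j i; rewrite sub0r.
have : \tr ((covmx g b p)^T *m ginv g p) = - \tr ((covmx g b p)^T *m ginv g p).
  rewrite -[LHS]mxtrace_tr trmx_mul trmxK (ginv_sym gU Up) mxtrace_mulC.
  by rewrite CN mulNmx linearN /= opprK.
by move/eqP; rewrite -addr_eq0 -mulr2n mulrn_eq0 /= => /eqP.
Qed.

End divergence.

(** * Ricci curvature of the deformed metric *)

Section ricci_deformation.
Context {R : realType} {n : nat} (U : set 'rV[R]_n) (g : 'rV[R]_n -> 'M[R]_n).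
Context (b : 'rV[R]_n -> 'rV[R]_n).
Hypothesis gU : metric_on U g.
Hypothesis bU : form_on U b.
Hypothesis bK : killing_on U g b.
Implicit Types (p q u v x y : 'rV[R]_n).

Let Uo : open U := metric_open gU.
Local Notation B q := (sharp g q (b q)).
Local Notation s := (sform g b).
Local Notation S q := (sharp g q (sform g b q)).
Local Notation Sv q u := (sharp g q (nab g b q u)).
Local Notation f := (normsq g b).

Variables (J : set R) (E kap : R -> R).
Hypothesis UJ : forall q, U q -> J (f q).
Hypothesis ES : smooth_on_line J E.
Hypothesis kapS : smooth_on_line J kap.
Hypothesis E_gt0 : forall q, U q -> 0 < E (f q).
Hypothesis Delta_gt0 : forall q, U q -> 0 < 1 - f q * kap (f q).

Local Notation gb := (deform g b E kap).
Local Notation A q := (defA E (f q)).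
Local Notation X q := (defX kap (f q)).
Local Notation Y q := (defY E kap (f q)).
Local Notation T := (defT g b E kap).

(** The logarithmic derivative of [E t ^+ n * (1 - t * kap t)], the ratio of the determinants of the
    two metrics; this is why it governs the trace of the difference tensor. *)
Definition lam t : R := n%:R * defA E t + defX kap t * t - kap t.

(** The difference tensor with one argument fixed, in rank one pieces so that its trace and the
    trace of its square become dot products. The only piece that is neither scalar nor of rank one
    carries the factor [kap * beta(u)], which the hypotheses of [ricci_deform] annihilate. *)
Definition Tmx q u : 'M[R]_n :=
  A q *: ((dot (s q) u)%:M + (s q)^T *m u - (u *m g q)^T *m S q)
  + X q *: (dot (s q) u *: ((b q)^T *m B q) + dot (b q) u *: ((s q)^T *m B q))
  + (Y q * dot (b q) u) *: ((b q)^T *m S q)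
  - kap (f q) *: ((b q)^T *m Sv q u + dot (b q) u *: ((covmx g b q)^T *m ginv g q)).

Lemma mul_Tmx q u v : U q -> v *m Tmx q u = T q u v.
Proof.
move=> Uq; rewrite /Tmx /defT !(mulmxDr, mulmxN) -!scalemxAr !(mulmxDr, mulmxN) -!scalemxAr.
rewrite !mul_outer mul_mx_scalar mulmxA.
rewrite (dotC v (s q)) (dotC v (b q)) (dotC v (u *m _)) -/(gm g q u v).
congr (_ + _ + _ - _).
- by apply/rowP => i; rewrite !mxE; ring.
- by rewrite scalerA mulrA.
Qed.

Lemma tr_Tmx q u : U q -> \tr (Tmx q u) = lam (f q) * dot (s q) u.
Proof.
move=> Uq; rewrite /Tmx !(mxtraceD, mxtraceZ, raddfN) /= !(mxtraceD, mxtraceZ, raddfN) /=.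
rewrite mxtrace_scalar !tr_outer -/(divg g b q) (divg_killing gU bK Uq).
rewrite -/(gm g q u (S q)) (gm_sharpr gU)// -(normsqE gU b Uq).
rewrite (dot_sB gU bK)// (dot_bS gU bK)// (dot_bSv gU bK)// /lam.
move: (f q) (defA _ _) (defX _ _) (defY _ _ _) (kap _) => t a x z k.
by rewrite -mulr_natl; move: (dot _ _) (dot _ _) => s0 b0; ring.
Qed.

Lemma Gmx_deform q u : U q -> Gmx gb q u = Gmx g q u + Tmx q u.
Proof.
move=> Uq; apply: mulmx_inj_all => v; rewrite mulmxDr !mul_Gmx mul_Tmx//.
exact: (chr_deform gU bU bK UJ ES kapS E_gt0 Delta_gt0).
Qed.

Lemma trc_deform q u : U q -> trc gb q u = trc g q u + lam (f q) * dot (s q) u.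
Proof. by move=> Uq; rewrite !trcE Gmx_deform// mxtraceD tr_Tmx. Qed.

(* The hypotheses on [y] hold if either [beta] vanishes on [y] or the
   deformation is conformal. *)
Lemma ricci_deform p y (A1 X1 Y1 lam1 : R) : U p ->
  is_derive (f p) 1 (defA E) A1 -> is_derive (f p) 1 (defX kap) X1 ->
  is_derive (f p) 1 (defY E kap) Y1 -> is_derive (f p) 1 lam lam1 ->
  X p * dot (b p) y = 0 -> Y p * dot (b p) y = 0 -> Y1 * dot (b p) y = 0 ->
  kap (f p) * dot (b p) y = 0 ->
  ricci gb p y = ricci g p y
   + 4 * A1 * dot (s p) y ^+ 2 + 2 * A p * cov g s p y y
   - gm g p y y * (2 * A1 * dot (s p) (S p) + A p * divg g s p)
   - 2 * X p * dot (s p) y ^+ 2 - 2 * kap (f p) * t00 g b p y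
   - (2 * lam1 * dot (s p) y ^+ 2 + lam (f p) * cov g s p y y)
   + lam (f p) * (2 * A p * dot (s p) y ^+ 2 - A p * gm g p y y * dot (s p) (S p))
   - (n%:R * A p ^+ 2 * dot (s p) y ^+ 2
      + 2 * A p * dot (s p) y ^+ 2 * (X p * f p - kap (f p))
      + A p ^+ 2 * (2 * dot (s p) y ^+ 2 - 2 * gm g p y y * dot (s p) (S p))
      + (X p * f p - kap (f p)) ^+ 2 * dot (s p) y ^+ 2).
Proof.
move=> Up Ad Xd Yd lamd Xb Yb Y1b kb.
have gbU := deform_metric_on gU bU UJ ES kapS E_gt0 Delta_gt0.
have sU := sform_on gU bU bK.
have fd v := dd_normsq gU bU bK v Up.
have k1b : derive1 kap (f p) * dot (b p) y = 0.
  have -> : derive1 kap (f p) = Y p - A p * kap (f p) by rewrite /defY addrK.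
  by rewrite mulrBl Yb -mulrA kb mulr0 subr0.
(* This divergence is never evaluated: it cancels between the two instances of [ricci_chr]. *)
have [d0 d0div] : exists d0, isdiv p (fun q => chr g q y y) d0.
  eexists; split=> [i k|//]; exact: (Cm_derivable (chr_Cm gU 1 y y i) Up).
have d1 := ddZ 2 (ddM (dd_comp Ad (fd y)) (dd_form g y y sU Up)).
have d2 := ddD (ddN (ddM (dd_comp Ad (fd (S p))) (dd_gm_cst gU (S p) y y Up)))
  (ddM (dd_comp Yd (fd (S p))) (ddM (dd_form g (S p) y bU Up) (dd_form g (S p) y bU Up))).
have d3 := ddZ 2 (ddM (dd_comp Xd (fd (B p))) (ddM (dd_form g (B p) y sU Up) (dd_form g (B p) y bU Up))).
have kd := dd_comp (kap_is_derive UJ kapS Up) (fd (Sv p y)).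
have d4 := ddN (ddZ 2 (ddM kd (dd_form g (Sv p y) y bU Up))).
have D1 := isdivZ d1 (isdiv_cst p y).
have D2 := isdivZ d2 (isdiv_sharp gU sU Up).
have D3 := isdivZ d3 (isdiv_sharp gU bU Up).
have D4 := isdivZ d4 (isdiv_sharp gU (nab_form_on gU y bU) Up).
have DT := isdivD (isdivD (isdivD D1 D2) D3) D4.
(* Terms containing [beta(y)] are kept here, because the divergence differentiates them; they may be
   dropped only from values at [p], as in [TE]. *)
have dT : forall q, U q -> chr g q y y +
    ((2 * (A q * dot (s q) y)) *: y
     + (- (A q * gm g q y y) + Y q * (dot (b q) y * dot (b q) y)) *: S q
     + (2 * (X q * (dot (s q) y * dot (b q) y))) *: B q
     + (- (2 * (kap (f q) * dot (b q) y))) *: Sv q y) = chr gb q y y.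
  move=> q Uq; rewrite (chr_deform gU bU bK UJ ES kapS E_gt0 Delta_gt0)//; congr (_ + _).
  rewrite /defT; apply/rowP => i; rewrite !mxE.
  move: (S q 0 i) (B q 0 i) (Sv q y 0 i) (y 0 i) => r1 r2 r3 r4.
  move: (f q) (defA _ _) (defX _ _) (defY _ _ _) (kap _) => t a x z k.
  move: (dot (s q) y) (dot (b q) y) (gm g q y y) => s0 b0 a2; ring.
have Dall := isdiv_eq_on Uo Up dT (isdivD d0div DT).
rewrite (ricci_chr gbU Up Dall) (ricci_chr gU Up d0div).
have E2 : ddval p y (fun q => trc gb q y) = ddval p y (fun q => trc g q y)
    + (lam1 * (2 * dot (s p) y) * dot (s p) y
       + lam (f p) * (cov g s p y y + dot (s p) (chr g p y y))).
  have H1 : dd p y (fun q => trc g q y) (ddval p y (fun q => trc g q y)).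
    apply: dd_Cm Up; apply: Cm_sum => // k _; exact: (chr_Cm gU).
  have := ddD H1 (ddM (dd_comp lamd (fd y)) (dd_form g y y sU Up)).
  move/(dd_eq_on Uo Up (h := fun q => trc gb q y)) => H2.
  have [|_ <-] := H2; last by [].
  by move=> q Uq; rewrite trc_deform.
rewrite E2 trc_deform// (chr_deform gU bU bK UJ ES kapS E_gt0 Delta_gt0 y y Up).
have TE : T p y y = (2 * (A p * dot (s p) y)) *: y + (- (A p * gm g p y y)) *: S p.
  apply: (addrI (chr g p y y)).
  rewrite -(chr_deform gU bU bK UJ ES kapS E_gt0 Delta_gt0 y y Up) -dT//.
  congr (_ + _); rewrite [Y p * _]mulrA Yb mul0r addr0.
  rewrite [dot (s p) y * dot (b p) y]mulrC [X p * _]mulrA Xb kb mul0r mulr0 oppr0.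
  by rewrite !scale0r !addr0.
(* Under the hypotheses on [y], all pieces of [Tmx p y] with left factor [b] merge into one rank one
   matrix. *)
have [V VE] : exists V : 'rV[R]_n, V = (X p * dot (s p) y) *: B p - kap (f p) *: Sv p y.
  by eexists.
have Tm : Tmx p y = (A p * dot (s p) y)%:M + A p *: ((s p)^T *m y)
    - A p *: ((y *m g p)^T *m S p) + (b p)^T *m V.
  rewrite VE /Tmx Yb scale0r addr0 !scalerDr !scalerN !scalerA Xb kb !scale0r !addr0.
  by rewrite scale_scalar_mx mulmxBr -!scalemxAr addrA.
have bV : dot (b p) V = (X p * f p - kap (f p)) * dot (s p) y.
  rewrite VE dotBr !dotZr -(normsqE gU b Up) (dot_bSv gU bK)//.
  by move: (f p) (defX _ _) (kap _) (dot _ _) => *; ring.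
have trGT : \tr (Gmx g p y *m Tmx p y) = A p * dot (s p) y * trc g p y
   + A p * dot (s p) (chr g p y y) - A p * gm g p y (chr g p y (S p)) + dot (b p) (chr g p y V).
  rewrite Tm !(mulmxDr, mulmxN) -!scalemxAr mul_mx_scalar !(mxtraceD, mxtraceZ, raddfN) /=.
  by rewrite !mxtraceZ !tr_mul_outer !mul_Gmx trcE.
have trTT : \tr (Tmx p y *m Tmx p y) = n%:R * A p ^+ 2 * dot (s p) y ^+ 2
      + 2 * A p * dot (s p) y ^+ 2 * (X p * f p - kap (f p))
      + A p ^+ 2 * (2 * dot (s p) y ^+ 2 - 2 * gm g p y y * dot (s p) (S p))
      + (X p * f p - kap (f p)) ^+ 2 * dot (s p) y ^+ 2.
  rewrite Tm !(mulmxDr, mulmxDl, mulmxN, mulNmx) -!scalemxAr -!scalemxAl.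
  rewrite -!scalar_mxM !mul_scalar_mx !mul_mx_scalar.
  rewrite !(mxtraceD, mxtraceZ, raddfN) /= !mxtraceZ mxtrace_scalar !tr_outer_mul !tr_outer.
  rewrite (dotC V (b p)) bV (dotC (S p) (s p)).
  rewrite ?(dotC (S p) (y *m _)) -/(gm g p y (S p)) (gm_sharpr gU)//.
  rewrite (dotC (S p) (b p)) (dot_bS gU bK)// (dotC y (s p)) (dotC y (b p)).
  rewrite (dotC y (y *m _)) -/(gm g p y y).
  rewrite (dotC V (s p)).
  have -> : dot (s p) V = - kap (f p) * cov g b p (S p) y.
    rewrite VE dotBr !dotZr (dot_sB gU bK)// (dot_sSv b gU)//; ring.
  rewrite [dot (b p) y * _]mulrC.
  have -> : - kap (f p) * cov g b p (S p) y * dot (b p) y = 0.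
    by rewrite mulrAC mulNr kb oppr0 mul0r.
  rewrite -[(_ * _) *+ n]mulr_natl; move: n%:R => N.
  move: (f p) (defA _ _) (defX _ _) (kap _) => t a x k.
  move: (dot (s p) y) (dot (s p) (S p)) (gm g p y y) => s0 sg a2.
  by move: (dot V (y *m g p)) (dot (y *m g p) V) => w w'; ring.
rewrite Gmx_deform// tr_sqrD.
rewrite trTT trGT {trTT trGT Tm}.
rewrite (dotDr (chr g p y y) (T p y y)) (trcD g p (chr g p y y) (T p y y)) TE.
rewrite (trcD g p ((2 * _) *: _)) !trcZ (dotDr ((2 * _) *: _)) !dotZr.
rewrite (compat gU)// [gm g p (chr g p y (S p)) y](gmC gU)// (divg_killing gU bK Up).
have -> : dot (b p) (chr g p y V) = X p * dot (s p) y * dot (b p) (chr g p y (B p))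
    - kap (f p) * dot (b p) (chr g p y (Sv p y)).
  by rewrite VE chrDr chrNr !chrZr dotBr !dotZr.
have -> : cov g b p y (B p) = - dot (s p) y by rewrite (covN bK)// (dot_s gU bK).
rewrite (cov_ySv bK)// (dot_sB gU bK)//.
apply/eqP; rewrite -subr_eq0; apply/eqP.
clear -Xb Yb Y1b kb k1b.
move: (dot (s p) (chr g p y (B p))) (dot (b p) (chr g p y (B p))) (dot (b p) (chr g p y (Sv p y))) => c1 c2 c3.
move: (dot (b p) (chr g p y (S p))) (gm g p y (chr g p y (S p))) (dot (s p) (chr g p y y)) => c4 c5 c6.
move: (trc g p (chr g p y y)) (trc g p (Sv p y)) (trc g p (B p)) (trc g p (S p)) (trc g p y) => c7 c8 c9 c10 c11.
move: (ddval _ _ _) (\tr _) (divg g s p) (divg g ((nab g b)^~ y) p) => c12 c13 c14 c15.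
move: (cov g b p y (S p)) (cov g s p y (B p)) (cov g s p y y) (t00 g b p y) => m1 m2 m3 m4.
move: (dot (s p) (Sv p y)) (dot (s p) (S p)) (gm g p y y) => m5 m6 m7.
move: Xb Yb Y1b kb k1b.
move: (f p) (dot (s p) y) (dot (b p) y) n%:R => t s0 be N.
move: (lam t) (defX kap t) (defY E kap t) (defA E t) (kap t) (derive1 kap t) => l x z a k k1.
move=> Xb Yb Y1b kb k1b.
(* What is left is a combination of the five products with [beta(y)] that are known to vanish. *)
transitivity ((2 * (m2 + c1) - 2 * s0 * c9) * (x * be) + (2 * (m1 + c4) + be * (c14 - c10)) * (z * be)
  + 2 * m6 * be * (Y1 * be) - 2 * (c15 - c8) * (k * be) - 4 * m5 * (k1 * be)); first by ring.
by rewrite Xb Yb Y1b kb k1b !mulr0 subr0 !addr0 subr0.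
Qed.

End ricci_deformation.

Lemma line_in_open (R : realType) n (U : set 'rV[R]_n) (p v : 'rV[R]_n) :
  open U -> U p -> exists2 e : R, 0 < e & forall t, `|t| < e -> U (t *: v + p).
Proof.
move=> Uo Up; have := near_open Uo Up (fun q (Uq : U q) => Uq).
move=> /nbhs_ballP[d /= d0 dP].
have v1 : 0 < `|v| + 1 by rewrite ltr_wpDl.
exists (d / (`|v| + 1)); first by rewrite divr_gt0.
move=> t td; apply: dP; rewrite -ball_normE /= opprD addrCA subrr addr0 normrN normrZ.
apply: (@le_lt_trans _ _ (`|t| * (`|v| + 1))); first by rewrite ler_wpM2l// lerDl.
by rewrite -ltr_pdivlMr.
Qed.

Lemma partial_at_min (R : realType) n (U : set 'rV[R]_n) (h : 'rV[R]_n -> R) p k :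
  open U -> U p -> Cm 1 U h -> (forall q, U q -> h p <= h q) -> partial k h p = 0.
Proof.
move=> Uo Up hC hmin.
have [e e0 eU] := line_in_open (ecoord k) Uo Up.
have inU (t : R) : t \in `]- e, e[ -> U (t *: ecoord k + p).
  by rewrite in_itv /= -ltr_norml => /eU.
have D (t : R) : t \in `]- e, e[ -> derivable (fun r : R => h (r *: ecoord k + p)) t 1.
  move=> /inU Ut; have /is_derive_line Hd := Cm_is_derive k hC Ut.
  rewrite -{1}(subrr t) in Hd.
  have sd : is_derive t 1 (fun r : R => r - t) (1 - 0) by exact: is_derive_fctB.
  have := is_derive_fct_comp (f := fun r : R => r - t) Hd sd.
  have -> : (fun q : R => h ((q - t) *: ecoord k + (t *: ecoord k + p))) = (fun r : R => h (r *: ecoord k + p)).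
    by apply/funext => r; rewrite addrA -scalerDl subrK.
  by case.
have i0 : (0 : R) \in `]- e, e[ by rewrite in_itv /= oppr_lt0 e0.
have le_e : - e <= e by rewrite ge0_cp// ltW.
have m0 (t : R) : t \in `]- e, e[ -> h (0 *: ecoord k + p) <= h (t *: ecoord k + p).
  by move=> /inU Ut; rewrite scale0r add0r; exact: hmin.
by have [_] := derive1_at_min le_e D i0 m0; rewrite -derive_line.
Qed.

(** A symmetric [G] sees only the symmetric part of a matrix, and the diagonal values determine that
    part. The Hessian of [f] is known only on the diagonal. *)
Lemma polarize_tr (R : realType) n (M N G : 'M[R]_n) : G^T = G ->
  (forall y : 'rV[R]_n, dot (y *m M) y = dot (y *m N) y) -> \tr (M *m G) = \tr (N *m G).
Proof.
move=> GT MN.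
have E : M + M^T = N + N^T.
  apply/matrixP => i j; rewrite !mxE.
  have e (K : 'M[R]_n) x y : dot (ecoord x *m K) (ecoord y) = K x y.
    by rewrite dot_ecoord -rowE mxE.
  have := MN (ecoord i + ecoord j); have := MN (ecoord i); have := MN (ecoord j).
  rewrite !mulmxDl !dotDl !dotDr !e => -> ->.
  by move: (M i j) (M j i) (N i j) (N j i) (N i i) (N j j) => *; lra.
have T (K : 'M[R]_n) : \tr (K *m G) = 2^-1 * \tr ((K + K^T) *m G).
  rewrite mulmxDl mxtraceD -[X in _ * (_ + X)]mxtrace_tr trmx_mul trmxK GT [\tr (G *m _)]mxtrace_mulC.
  by move: (\tr _) => x; field.
by rewrite T E -T.
Qed.

(** * Einstein metrics with a special Killing form *)

Section einstein_killing.
Context {R : realType} {n : nat} (U : set 'rV[R]_n) (g : 'rV[R]_n -> 'M[R]_n).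
Context (b : 'rV[R]_n -> 'rV[R]_n) (a mu : R).
Hypothesis gU : metric_on U g.
Hypothesis bU : form_on U b.
Hypothesis bK : killing_on U g b.
Implicit Types (p q u v x y : 'rV[R]_n).

Let Uo : open U := metric_open gU.
Local Notation B q := (sharp g q (b q)).
Local Notation s := (sform g b).
Local Notation S q := (sharp g q (sform g b q)).
Local Notation Sv q u := (sharp g q (nab g b q u)).
Local Notation f := (normsq g b).
Local Notation w q := (a ^+ 2 - mu * normsq g b q).

Hypothesis a_neq0 : a != 0.
Hypothesis t00_eq : forall p, U p -> forall y, exists2 v : R,
  quotient_value (fun q => s0 g b q y ^+ 2) (fun q => w q) p v &
  t00 g b p y + w p * alpha2 g p y
    + mu * (f p * alpha2 g p y - beta b p y ^+ 2) - mu * v = 0.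
Hypothesis Rbb_eq : forall p, U p -> forall y,
  Rbb g b p y = mu * (f p * alpha2 g p y - beta b p y ^+ 2).

(** One and the same [v] occurs in both formulas, so that points where [w] vanishes can be treated
    without evaluating the limit. *)
Lemma t00_hess p y : U p -> exists v : R,
  [/\ quotient_value (fun q => s0 g b q y ^+ 2) (fun q => w q) p v,
      t00 g b p y = - a ^+ 2 * gm g p y y + mu * dot (b p) y ^+ 2 + mu * v
    & cov g s p y y = w p * gm g p y y - mu * v].
Proof.
move=> Up; have [v vq E] := t00_eq Up y; exists v.
have Et : t00 g b p y = - a ^+ 2 * gm g p y y + mu * dot (b p) y ^+ 2 + mu * v.
  move: E; rewrite alpha2E -[beta b p y]/(dot (b p) y).
  move: (f p) (t00 _ _ _ _) (gm _ _ _ _) (dot _ _) => t t0 a2 be /eqP.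
  rewrite subr_eq0 => /eqP E; rewrite -E; ring.
split=> //; rewrite (cov_sform gU bU bK)// Et Rbb_eq// alpha2E -[beta b p y]/(dot (b p) y).
by move: (f p) (gm _ _ _ _) (dot _ _) => t a2 be; ring.
Qed.

Lemma t00_hess_regular p y : U p -> w p != 0 ->
  t00 g b p y = - a ^+ 2 * gm g p y y + mu * dot (b p) y ^+ 2 + mu * (dot (s p) y ^+ 2 / w p)
  /\ cov g s p y y = w p * gm g p y y - mu * (dot (s p) y ^+ 2 / w p).
Proof.
by move=> Up wp; have [v [[/(_ wp) -> _] -> ->]] := t00_hess y Up; rewrite !s0E.
Qed.

(** Polarization of the formula for [t00] between [y] and the Killing vector: [t00] is minus a
    squared norm, and the derivative of [b] along its own dual vector is [- s], so the cross term is
    the wanted pairing. *)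
Lemma cov_S_regular p y : U p -> w p != 0 -> cov g b p (S p) y = - w p * dot (b p) y.
Proof.
move=> Up wp.
have t00Q z : t00 g b p z = - gm g p (Sv p z) (Sv p z).
  by rewrite (t00E bK)// (gm_sharp gU).
have SB : Sv p (B p) = - S p.
  apply: (gm_inj gU Up) => x; rewrite (gm_sharp gU)// dot_nab (covN bK)// -(dot_s gU bK)//.
  by rewrite gmNl (gm_sharp gU).
have SD : Sv p (y + B p) = Sv p y - S p.
  by rewrite -SB /nab /sharp !mulmxDl.
have [E1 _] := t00_hess_regular (y + B p) Up wp.
have [E2 _] := t00_hess_regular y Up wp.
have [E3 _] := t00_hess_regular (B p) Up wp.
have Sx : gm g p (Sv p y) (S p) = cov g b p (S p) y by rewrite (gm_sharp gU)// dot_nab.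
move: E1; rewrite t00Q SD !(gmDl, gmDr, gmNl, gmNr).
have -> : gm g p (Sv p y) (Sv p y) = - t00 g b p y by rewrite t00Q opprK.
have -> : gm g p (S p) (S p) = - t00 g b p (B p) by rewrite t00Q SB gmNl gmNr !opprK.
rewrite E2 E3 (gmC gU (S p) (Sv p y) Up) Sx !dotDr (dot_sB gU bK)// !(gm_sharpr gU)//.
rewrite (gm_sharp gU)// -(normsqE gU b Up).
move: wp; move: (f p) => t; move: (cov _ _ _ _ _) (gm _ _ _ _) (dot (b p) y) (dot (s p) y) => c a2 be s0 wp.
rewrite expr0n /= addr0 mul0r mulr0 addr0 => E.
by move: (s0 ^+ 2 / _) E => r E; lra.
Qed.

Lemma w_normsq_regular p : U p -> w p != 0 -> dot (s p) (S p) = f p * w p.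
Proof.
move=> Up wp; have := cov_S_regular (B p) Up wp.
rewrite (covN bK)// -(dot_s gU bK)// -(normsqE gU b Up) mulNr => /oppr_inj ->.
by rewrite mulrC.
Qed.

(** [f * w] is the squared norm of [s] at regular points, and where [f] vanishes [w] is [a ^+ 2]. *)
Lemma w_ge0 p : U p -> 0 <= w p.
Proof.
move=> Up; have [->//|wp] := eqVneq (w p) 0.
have f0 := normsq_ge0 b gU Up.
have := gm_ge0 gU (S p) Up; rewrite (gm_sharp gU)// w_normsq_regular//.
have [fz|fn] := eqVneq (f p) 0.
  by rewrite fz mulr0 subr0 sqr_ge0.
by rewrite pmulr_rge0// lt0r fn.
Qed.

(* Where [w] vanishes it is minimal, hence [s], half the differential of
   [normsq g b], vanishes too. *)
Lemma sform_singular p : U p -> w p = 0 -> s p = 0.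
Proof.
move=> Up wp0; apply/rowP => k; rewrite mxE.
have mu0 : mu != 0.
  apply/eqP => mu0; move: wp0; rewrite mu0 mul0r subr0 => /eqP.
  by rewrite sqrf_eq0 (negPf a_neq0).
have wC : Cm 1 U (fun q => w q).
  by apply: CmB => //; [exact: Cm_cst|apply: CmZ => //; exact: normsq_Cm].
have := partial_at_min k Uo Up wC; rewrite wp0 => /(_ w_ge0) pk0.
have [_] := ddB (dd_cst p (ecoord k) (a ^+ 2)) (ddZ mu (dd_normsq gU bU bK (ecoord k) Up)).
rewrite /ddval (bigD1 k)//= pk0 mulr0 add0r big1; last first.
  by move=> j /negPf jk; rewrite mxE eqxx jk mul0r.
rewrite dot_ecoord !mxE addr0 => /eqP; rewrite oppr_eq0 !mulf_eq0 (negPf mu0) pnatr_eq0 /=.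
by move/eqP.
Qed.

Lemma cov_S p y : U p -> cov g b p (S p) y = - w p * dot (b p) y.
Proof.
move=> Up; have [w0|] := eqVneq (w p) 0; last exact: cov_S_regular.
by rewrite w0 sform_singular// /sharp mul0mx /cov mul0mx dot0l oppr0 mul0r.
Qed.

Lemma w_normsq p : U p -> dot (s p) (S p) = f p * w p.
Proof.
move=> Up; have [w0|] := eqVneq (w p) 0; last exact: w_normsq_regular.
by rewrite w0 sform_singular// dot0l mulr0.
Qed.

(** The trace of the Hessian; by [w_normsq] the term in [s0 ^+ 2 / w] has trace [mu * f]. *)
Lemma divg_s p : U p -> w p != 0 -> divg g s p = n%:R * w p - mu * f p.
Proof.
move=> Up wp; rewrite /divg.
have GT := ginv_sym gU Up.
rewrite (polarize_tr (N := w p *: g p - (mu / w p) *: ((s p)^T *m s p)) GT); last first.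
  move=> y; have [_ E] := t00_hess_regular y Up wp.
  rewrite dot_mulmx trmxK dotC -/(cov g s p y y) E.
  rewrite mulmxBr dotBl -!scalemxAr !dotZl mul_outer dotZl (dotC y (s p)).
  by rewrite -/(gm g p y y); move: (w p)^-1 (w p) => x z; ring.
rewrite mulmxBl -!scalemxAl raddfB /= !mxtraceZ /ginv mulmxV ?(metric_unit gU)//.
rewrite mxtrace1 -mulmxA tr_outer -/(ginv g p) -/(sharp g p (s p)) w_normsq//.
by rewrite mulrC [f p * _]mulrC mulrA mulfVK.
Qed.

End einstein_killing.

(** * The algebraic system at a regular point *)

Section pointwise_system.
Variable F : fieldType.
Variables (N mu m aa t e A A1 k k1 k2 : F).
Let w := aa - mu * t.
Let D0 := 1 - t * k.
Let D1 := - (k + t * k1).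
Let D2 := - (2 * k1 + t * k2).
Let X := - (k1 + k ^+ 2) / D0.
Let X1 := - (k2 + 2 * k * k1) / D0 + (k1 + k ^+ 2) * D1 / D0 ^+ 2.
Let l := N * A + X * t - k.
Let l1 := N * A1 + (X1 * t + X) - k1.
Let M := D0 * e.
Let M1 := (D1 + D0 * A) * e.
Let M2 := (D2 + 2 * D1 * A + D0 * (A1 + A ^+ 2)) * e.
Let c := M + M1 * t.
Let c1 := 2 * M1 + M2 * t.

Hypotheses (t0 : t != 0) (e0 : e != 0) (D00 : D0 != 0) (N2 : N - 2 != 0).
(** [HE] and [HS] are the Ricci condition, [BE] and [BS] the [R_bb] condition; the second letter
    tells the direction, orthogonal to b and grad f for [E], along grad f for [S], after division by
    its squared length. [A] and [A1] stand for [E' / E] and its derivative, [aa] for [a ^+ 2], [M]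
    and [c] for [defN] and [defc] with [k = 1]. *)
Hypothesis HE : (N - 1) * mu + 2 * A * w - (2 * A1 * t * w + A * (N * w - mu * t))
  + 2 * k * aa - l * w - l * A * t * w + 2 * A ^+ 2 * t * w = (N - 1) * m * e.
Hypothesis HS : (N - 1) * mu + 2 * A1 * t * w + 2 * A * (w - mu * t) - A * (N * w - mu * t)
  - 2 * X * t * w + 2 * k * w - (2 * l1 * t * w + l * (w - mu * t)) + l * A * t * w
  - (N * A ^+ 2 + 2 * A * (X * t - k) + (X * t - k) ^+ 2) * t * w = (N - 1) * m * e.
Hypothesis BE : c * w + c * A * t * w = M ^+ 2 * aa / e - m * M * t * e.
Hypothesis BS : 2 * c1 * t * w + c * (w - mu * t) - c * A * t * w =
  (M ^+ 2 * w + t * w * (2 * M * M1 + M1 ^+ 2 * t + k / D0 * (M + M1 * t) ^+ 2)) / e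
  - m * M * t * e.

Let P := mu - 2 * t * w * A1 - (2 * w - mu * t) * A - m * e.
Let D := D1 / D0.
Let W := 2 * t * w * (D2 / D0) + 3 * w * D - D * mu * t + A * D * t * w - D ^+ 2 * t * w.

(** [HS] amounts to [(N - 1) * P = W] and [BS] to [W = P], so [(N - 2) * P = 0]. *)
Lemma system_second_order : mu - 2 * t * w * A1 - (2 * w - mu * t) * A = m * e.
Proof.
suff: P = 0 by rewrite /P => /eqP; rewrite subr_eq0 => /eqP.
have IS : (N - 1) * P = W.
  apply/eqP; rewrite -subr_eq0; apply/eqP; move/eqP: HS; rewrite -subr_eq0 => /eqP <-.
  by rewrite /P /W /D /l /l1 /X /X1 /D2 /D1; move: D00; rewrite /D0 => h; field; rewrite h.
have IB : W = P.
  apply/eqP; rewrite -subr_eq0; apply/eqP.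
  have h : e * D0 * t != 0 by rewrite !mulf_neq0.
  apply: (mulfI h); rewrite mulr0; move/eqP: BS; rewrite -subr_eq0 => /eqP <-.
  rewrite /P /W /D /c /c1 /M /M1 /M2 /D2 /D1; move: D00; rewrite /D0 => h'; field.
  by rewrite h' e0.
apply: (mulfI N2); rewrite mulr0 mulrBl.
have -> : N * P = W + P by rewrite -IS; ring.
by rewrite IB; ring.
Qed.

Lemma system_first_order :
  (D0 * (1 + t * A) + t * D1) * w * (1 + t * A) = D0 ^+ 2 * aa - m * D0 * t * e.
Proof.
apply: (mulfI e0); apply/eqP; rewrite -subr_eq0; apply/eqP.
move/eqP: BE; rewrite -subr_eq0 => /eqP <-.
by rewrite /c /M /M1; field.
Qed.

(** The two previous equations eliminate [A1] and [D1] from [HE]. The result involves only [E], [E']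
    and Delta, and can be differentiated once more. *)
Lemma system_trace : (N - 3) * (w * (1 + t * A) ^+ 2 + m * t * e) = aa * (N - 3 * D0).
Proof.
have P0 := system_second_order; have F0 := system_first_order.
apply/eqP; rewrite -subr_eq0; apply/eqP.
transitivity (t * ((N - 1) * m * e - ((N - 1) * mu + 2 * A * w - (2 * A1 * t * w + A * (N * w - mu * t))
  + 2 * k * aa - l * w - l * A * t * w + 2 * A ^+ 2 * t * w))
  + t * (mu - 2 * t * w * A1 - (2 * w - mu * t) * A - m * e)
  + D0^-1 * (D0 ^+ 2 * aa - m * D0 * t * e - (D0 * (1 + t * A) + t * D1) * w * (1 + t * A))); last first.
  by rewrite HE P0 F0 !subrr !mulr0 !addr0.
by rewrite /l /X /w /D1; move: D00; rewrite /D0 => h; field; rewrite h.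
Qed.

Lemma pointwise_system :
  [/\ mu - 2 * t * w * A1 - (2 * w - mu * t) * A = m * e,
      (D0 * (1 + t * A) + t * D1) * w * (1 + t * A) = D0 ^+ 2 * aa - m * D0 * t * e
    & (N - 3) * (w * (1 + t * A) ^+ 2 + m * t * e) = aa * (N - 3 * D0)].
Proof.
by split; [exact: system_second_order|exact: system_first_order|exact: system_trace].
Qed.

End pointwise_system.

(** * Derivatives of the coefficient functions *)

Section line_derivatives.
Context {R : realType} {J : set R} {E kap : R -> R}.
Hypotheses (ES : smooth_on_line J E) (kapS : smooth_on_line J kap).
Implicit Types (t : R) (phi : R -> R).

Lemma line_derive phi t : smooth_on_line J phi -> J t -> is_derive t 1 phi (derive1 phi t).
Proof. by move=> phiS Jt; rewrite derive1E; apply: derivableP; exact: (@phiS 0%N _ Jt). Qed.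

Lemma line_derive2 phi t : smooth_on_line J phi -> J t ->
  is_derive t 1 (derive1 phi) (derive1 (derive1 phi) t).
Proof. by move=> phiS Jt; rewrite derive1E; apply: derivableP; exact: (@phiS 1%N _ Jt). Qed.

Lemma is_derive_fct_div (x y : R -> R) t dx dy : y t != 0 ->
  is_derive t 1 x dx -> is_derive t 1 y dy ->
  is_derive t 1 (fun r => x r / y r) (dx / y t - x t * dy / y t ^+ 2).
Proof.
move=> y0 xd yd; apply: is_derive_eq (is_derive_fctM xd (is_derive_fctV y0 yd)) _.
by move: (x t) (y t) y0 => a b b0; field.
Qed.

Definition defA1 t : R := derive1 (derive1 E) t / E t - defA E t ^+ 2.

Lemma defA_is_derive t : J t -> E t != 0 -> is_derive t 1 (defA E) (defA1 t).
Proof.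
move=> Jt e0; apply: is_derive_eq (is_derive_fct_div e0 (line_derive2 ES Jt) (line_derive ES Jt)) _.
by rewrite /defA1 /defA; move: (E t) e0 => e e0; field.
Qed.

Definition defX1 t : R := - (derive1 (derive1 kap) t + 2 * kap t * derive1 kap t) / (1 - t * kap t)
  + (derive1 kap t + kap t ^+ 2) * - (kap t + t * derive1 kap t) / (1 - t * kap t) ^+ 2.

Lemma defX_is_derive t : J t -> 1 - t * kap t != 0 -> is_derive t 1 (defX kap) (defX1 t).
Proof.
move=> Jt d0.
have id1 := is_derive_id t (1 : R).
have kd := line_derive kapS Jt; have kd2 := line_derive2 kapS Jt.
have dD : is_derive t 1 (fun r => 1 - r * kap r) (- (kap t + t * derive1 kap t)).
  apply: is_derive_eq (is_derive_fctB (is_derive_cst (1 : R) t 1) (is_derive_fctM id1 kd)) _.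
  by rewrite /=; ring.
have dN : is_derive t 1 (fun r => - (derive1 kap r + kap r ^+ 2))
    (- (derive1 (derive1 kap) t + 2 * kap t * derive1 kap t)).
  apply: is_derive_eq (is_derive_fctN (is_derive_fctD kd2 (is_derive_fctM kd kd))) _.
  by move: (kap t) (derive1 kap t) (derive1 _ _) => *; ring.
have H := is_derive_fct_div (y := fun r => 1 - r * kap r) (t := t) d0 dN dD; apply: (is_derive_eq H).
rewrite /defX1; move: (kap t) (derive1 kap t) (derive1 _ _) d0 => k k1 k2 d0.
by field.
Qed.

Lemma defY_is_derive t : J t -> E t != 0 -> is_derive t 1 (defY E kap)
  (derive1 (derive1 kap) t + (defA1 t * kap t + defA E t * derive1 kap t)).
Proof.
move=> Jt e0; apply: is_derive_fctD; first exact: line_derive2 kapS Jt.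
by apply: is_derive_fctM; [exact: defA_is_derive|exact: line_derive kapS Jt].
Qed.

Lemma lam_is_derive (n : nat) t : J t -> E t != 0 -> 1 - t * kap t != 0 ->
  is_derive t 1 (lam (n := n) E kap)
    (n%:R * defA1 t + (defX1 t * t + defX kap t) - derive1 kap t).
Proof.
move=> Jt e0 d0; apply: is_derive_fctB; last exact: line_derive kapS Jt.
have nA := is_derive_fctM (is_derive_cst (n%:R : R) t (1 : R)) (defA_is_derive Jt e0).
have Xt := is_derive_fctM (defX_is_derive Jt d0) (is_derive_id t (1 : R)).
apply: is_derive_eq (is_derive_fctD nA Xt) _.
by rewrite /= mulr1 mul0r add0r.
Qed.

(** Written with [defA] and [defA1] in place of the derivatives of [E], to match the shape of [c1]
    in the pointwise system. *)
Definition defc1 (k t : R) : R :=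
  let D0 := 1 - t * kap t in let D1 := - (kap t + t * derive1 kap t) in
  let D2 := - (2 * derive1 kap t + t * derive1 (derive1 kap) t) in
  k * (2 * ((D1 + D0 * defA E t) * E t * k)
       + (D2 + 2 * D1 * defA E t + D0 * (defA1 t + defA E t ^+ 2)) * E t * k * t).

Lemma defc_is_derive k t : J t -> E t != 0 -> is_derive t 1 (defc E kap k) (defc1 k t).
Proof.
move=> Jt e0.
have id1 := is_derive_id t (1 : R).
have kd := line_derive kapS Jt; have kd2 := line_derive2 kapS Jt.
have ed := line_derive ES Jt; have ed2 := line_derive2 ES Jt.
have dD : is_derive t 1 (fun r => k * (1 - r * kap r)) (k * - (kap t + t * derive1 kap t)).
  apply: is_derive_eq (is_derive_fctM (is_derive_cst k t 1) (is_derive_fctB (is_derive_cst (1 : R) t 1) (is_derive_fctM id1 kd))) _.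
  by rewrite /=; move: (kap t) (derive1 kap t) => *; ring.
have dD1 : is_derive t 1 (fun r => k * (- (kap r + r * derive1 kap r)))
    (k * - (2 * derive1 kap t + t * derive1 (derive1 kap) t)).
  apply: is_derive_eq (is_derive_fctM (is_derive_cst k t 1) (is_derive_fctN (is_derive_fctD kd (is_derive_fctM id1 kd2)))) _.
  by rewrite /=; move: (kap t) (derive1 kap t) (derive1 _ _) => *; ring.
have dN := is_derive_fctM dD ed.
have dN1 := is_derive_fctD (is_derive_fctM dD1 ed) (is_derive_fctM dD ed2).
have dc := is_derive_fctM (is_derive_cst k t 1) (is_derive_fctD dN (is_derive_fctM dN1 id1)).
apply: is_derive_eq dc _; rewrite /defc1 /defA1 /defA /=.
move: e0; move: (derive1 (derive1 kap) t) (derive1 (derive1 E) t) => k2 e2.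
move: (derive1 kap t) (derive1 E t) => k1 e1; move: (kap t) (E t) => c e e0.
by field.
Qed.

End line_derivatives.

Lemma exists_orthogonal (R : realType) n (b s : 'rV[R]_n) : (2 < n)%N ->
  exists2 y : 'rV[R]_n, y != 0 & dot b y = 0 /\ dot s y = 0.
Proof.
move=> n2; pose K := (col_mx b s)^T.
have K0 : kermx K != 0.
  rewrite kermx_eq0 /row_free neq_ltn; apply/orP; left.
  by apply: leq_ltn_trans n2; rewrite mxrank_tr; exact: rank_leq_row.
exists (nz_row (kermx K)); first by rewrite nz_row_eq0.
have /sub_kermxP : (nz_row (kermx K) <= kermx K)%MS by exact: nz_row_sub.
rewrite /K tr_col_mx mul_mx_row => /eqP; rewrite row_mx_eq0 => /andP[/eqP e1 /eqP e2].
by rewrite !(dotC _ (nz_row _)) !dotE e1 e2 !mxE.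
Qed.

(** * The barred conditions at a regular point *)

Section regular_point.
Context {R : realType} {n : nat} (U : set 'rV[R]_n) (g : 'rV[R]_n -> 'M[R]_n).
Context (b : 'rV[R]_n -> 'rV[R]_n) (a mu m : R).
Hypothesis gU : metric_on U g.
Hypothesis bU : form_on U b.
Hypothesis bK : killing_on U g b.
Implicit Types (p q u v x y : 'rV[R]_n).

Let Uo : open U := metric_open gU.
Local Notation B q := (sharp g q (b q)).
Local Notation s := (sform g b).
Local Notation S q := (sharp g q (sform g b q)).
Local Notation f := (normsq g b).
Local Notation w q := (a ^+ 2 - mu * normsq g b q).

Hypothesis n_gt2 : (2 < n)%N.
Hypothesis a_neq0 : a != 0.
Hypothesis t00_eq : forall p, U p -> forall y, exists2 v : R,
  quotient_value (fun q => s0 g b q y ^+ 2) (fun q => w q) p v &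
  t00 g b p y + w p * alpha2 g p y
    + mu * (f p * alpha2 g p y - beta b p y ^+ 2) - mu * v = 0.
Hypothesis Rbb_eq : forall p, U p -> forall y,
  Rbb g b p y = mu * (f p * alpha2 g p y - beta b p y ^+ 2).
Hypothesis ricci_eq : forall p, U p -> forall y,
  ricci g p y = n.-1%:R * mu * alpha2 g p y.

Variables (J : set R) (E kap : R -> R).
Hypothesis UJ : forall q, U q -> J (f q).
Hypothesis ES : smooth_on_line J E.
Hypothesis kapS : smooth_on_line J kap.
Hypothesis E_gt0 : forall q, U q -> 0 < E (f q).
Hypothesis Delta_gt0 : forall q, U q -> 0 < 1 - f q * kap (f q).

Local Notation gb := (deform g b E kap).
Local Notation bb := (dual_form g b E kap 1).

Hypothesis ricci_bar : forall p, U p -> forall y,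
  ricci gb p y = n.-1%:R * m * alpha2 gb p y.
Hypothesis Rbb_bar : forall p, U p -> forall y,
  Rbb gb bb p y = m * (normsq gb bb p * alpha2 gb p y - beta bb p y ^+ 2).

(** This is [cov_sform] for the barred pair with the prescribed [Rbb] inserted: the barred Hessian
    on the left, minus [t00] minus [Rbb] on the right. No component of the barred curvature
    remains. *)
Lemma Rbb_bar_eq p y : U p -> dot (b p) y = 0 ->
  2 * defc1 (E := E) (kap := kap) 1 (f p) * dot (s p) y ^+ 2 + defc E kap 1 (f p) * cov g s p y y
    - defc E kap 1 (f p) * (defA E (f p) * (2 * dot (s p) y ^+ 2 - gm g p y y * dot (s p) (S p))) =
  (E (f p))^-1 * (defN E kap 1 (f p) ^+ 2 * - t00 g b p y
   + 2 * defN E kap 1 (f p) * defN1 E kap 1 (f p) * dot (s p) y ^+ 2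
   + defN1 E kap 1 (f p) ^+ 2 * dot (s p) y ^+ 2 * f p
   + kap (f p) / (1 - f p * kap (f p)) *
     (defN E kap 1 (f p) * dot (s p) y + defN1 E kap 1 (f p) * dot (s p) y * f p) ^+ 2)
  - m * (defN E kap 1 (f p) * f p) * (E (f p) * gm g p y y).
Proof.
move=> Up by0.
have gbU := deform_metric_on gU bU UJ ES kapS E_gt0 Delta_gt0.
have bbU := dual_form_on gU bU UJ ES kapS 1.
have bbK := killing_dual gU bU bK UJ ES kapS E_gt0 Delta_gt0 1.
have e0 : E (f p) != 0 by rewrite gt_eqF// E_gt0.
have := cov_sform gbU bbU bbK y Up.
rewrite (cov_sform_dual gU bU bK UJ ES kapS E_gt0 Delta_gt0 y Up (defc_is_derive ES kapS 1 (UJ Up) e0)).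
rewrite Rbb_bar// (t00_dual gU bU bK UJ ES kapS E_gt0 Delta_gt0)//.
rewrite (normsq_dual gU bU UJ ES kapS E_gt0 Delta_gt0)//.
rewrite alpha2E gm_deform -[beta bb p y]/(dot (bb p) y) /dual_form dotZl (dot_sT gU bK E kap)// by0.
rewrite !(mulr0, mul0r, mulr1, mul1r, addr0, subr0, add0r, expr0n) /=.
move/eqP; rewrite -subr_eq0 => /eqP H; apply/eqP; rewrite -subr_eq0 -H; apply/eqP.
move: {H} (f p) => t.
move: (defc E kap 1 t) (defc1 1 t) (defA E t) (defN E kap 1 t) (defN1 E kap 1 t) => c c1 A N N1.
move: (dot (s p) y) (cov g s p y y) (gm g p y y) (dot (s p) (S p)) (t00 g b p y) => s0 h a2 sg t0.
move: (E t)^-1 (E t) (kap t / _) => e' e k.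
by ring.
Qed.

Lemma ricci_bar_eq p y : U p -> w p != 0 -> dot (b p) y = 0 ->
  let A := defA E (f p) in let A1 := defA1 (E := E) (f p) in
  let X := defX kap (f p) in let l := lam (n := n) E kap (f p) in
  let l1 := n%:R * A1 + (defX1 (kap := kap) (f p) * f p + X) - derive1 kap (f p) in
  let k := kap (f p) in let a2 := gm g p y y in let s0 := dot (s p) y in
  let sg := f p * w p in
  n.-1%:R * mu * a2 + 4 * A1 * s0 ^+ 2 + 2 * A * (w p * a2 - mu * (s0 ^+ 2 / w p))
   - a2 * (2 * A1 * sg + A * (n%:R * w p - mu * f p))
   - 2 * X * s0 ^+ 2 - 2 * k * (- a ^+ 2 * a2 + mu * (s0 ^+ 2 / w p))
   - (2 * l1 * s0 ^+ 2 + l * (w p * a2 - mu * (s0 ^+ 2 / w p)))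
   + l * (2 * A * s0 ^+ 2 - A * a2 * sg)
   - (n%:R * A ^+ 2 * s0 ^+ 2 + 2 * A * s0 ^+ 2 * (X * f p - k)
      + A ^+ 2 * (2 * s0 ^+ 2 - 2 * a2 * sg) + (X * f p - k) ^+ 2 * s0 ^+ 2) =
  n.-1%:R * m * (E (f p) * a2).
Proof.
move=> Up wp by0 A A1 X l l1 k a2 s0 sg.
have Jp := UJ Up.
have e0 : E (f p) != 0 by rewrite gt_eqF// E_gt0.
have d0 : 1 - f p * kap (f p) != 0 by rewrite gt_eqF// Delta_gt0.
have z0 (c : R) : c * dot (b p) y = 0 by rewrite by0 mulr0.
have := ricci_deform gU bU bK UJ ES kapS E_gt0 Delta_gt0 Up
  (defA_is_derive ES Jp e0) (defX_is_derive kapS Jp d0) (defY_is_derive ES kapS Jp e0)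
  (lam_is_derive ES kapS n Jp e0 d0) (z0 _) (z0 _) (z0 _) (z0 _).
have [t0E hE] := t00_hess_regular gU bU bK t00_eq Rbb_eq y Up wp.
rewrite ricci_bar// ricci_eq// !alpha2E gm_deform hE t0E by0 mulr0 subr0.
rewrite (w_normsq gU bU bK a_neq0 t00_eq Rbb_eq)// (divg_s gU bU bK a_neq0 t00_eq Rbb_eq)//.
by rewrite expr0n /= mulr0 addr0 => ->.
Qed.

Lemma regular_system p : U p -> f p != 0 -> w p != 0 ->
  let t := f p in let A := defA E t in let A1 := defA1 (E := E) t in
  let D0 := 1 - t * kap t in let D1 := - (kap t + t * derive1 kap t) in
  [/\ mu - 2 * t * w p * A1 - (2 * w p - mu * t) * A = m * E t,
      (D0 * (1 + t * A) + t * D1) * w p * (1 + t * A) = D0 ^+ 2 * a ^+ 2 - m * D0 * t * E t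
    & (n%:R - 3) * (w p * (1 + t * A) ^+ 2 + m * t * E t) = a ^+ 2 * (n%:R - 3 * D0)].
Proof.
move=> Up fp wp t A A1 D0 D1.
have e0 : E t != 0 by rewrite gt_eqF// E_gt0.
have d0 : D0 != 0 by rewrite gt_eqF// Delta_gt0.
have n20 : n%:R - 2 != 0 :> R by rewrite subr_eq0 eqr_nat gtn_eqF.
have n1E : n.-1%:R = n%:R - 1 :> R.
  by rewrite -[in RHS](prednK (ltn_trans (isT : (0 < 2)%N) n_gt2)) -natr1 addrK.
(* This vector gives the equations [HE] and [BE], and [S p] gives [HS] and [BS]; beta vanishes on
   both. *)
have [y y0 [by0 sy0]] := exists_orthogonal (b p) (s p) n_gt2.
have a20 : gm g p y y != 0 by rewrite gt_eqF// -alpha2E (metric_pos gU Up y0).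
have SS : gm g p (S p) (S p) = t * w p.
  by rewrite (gm_sharp gU)// (w_normsq gU bU bK a_neq0 t00_eq Rbb_eq).
have sS : dot (s p) (S p) = t * w p by rewrite (w_normsq gU bU bK a_neq0 t00_eq Rbb_eq).
have sg0 : t * w p != 0 by rewrite mulf_neq0.
have bS := dot_bS gU bK Up.
have HE := ricci_bar_eq Up wp by0; have HS := ricci_bar_eq Up wp bS.
have [t0y hy] := t00_hess_regular gU bU bK t00_eq Rbb_eq y Up wp.
have [t0S hS] := t00_hess_regular gU bU bK t00_eq Rbb_eq (S p) Up wp.
have BE := Rbb_bar_eq Up by0; have BS := Rbb_bar_eq Up bS.
rewrite t0y hy by0 sy0 sS in BE; rewrite t0S hS bS SS sS in BS.
rewrite sy0 in HE; rewrite SS sS in HS.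
rewrite n1E in HE HS.
move: HE HS BE BS; rewrite /= /lam /defc /defc1 /defX1 /defX /defN1 /defN -/t -/A -/A1.
have EA : derive1 E t = A * E t by rewrite /A /defA mulfVK.
rewrite !EA => HE HS BE BS.
have ne0 : t * (a ^+ 2 - mu * t) != 0 := mulf_neq0 fp wp.
have wpt : a ^+ 2 - mu * t != 0 by [].
apply: (@pointwise_system _ n%:R mu m (a ^+ 2) t (E t) A A1 (kap t) (derive1 kap t)
  (derive1 (derive1 kap) t) fp e0 d0 n20).
- apply: (mulIf a20); apply/eqP; rewrite -subr_eq0; move/eqP: HE; rewrite -subr_eq0 => /eqP <-.
  apply/eqP; move: (d0); rewrite /D0 => {}d0.
  clearbody A A1 t; move: (gm g p y y) => a2.
  move: (derive1 (derive1 kap) t) => k2; move: (derive1 kap t) (kap t) (E t) d0 => k1 k e d0.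
  by field; rewrite ?wpt ?d0.
- apply: (mulIf ne0); apply/eqP; rewrite -subr_eq0; move/eqP: HS; rewrite -subr_eq0 => /eqP <-.
  apply/eqP; move: (d0); rewrite /D0 => {}d0.
  clearbody A A1 t; move: (derive1 (derive1 kap) t) => k2; move: (derive1 kap t) (kap t) (E t) d0 => k1 k e d0.
  by field; rewrite ?wpt ?d0.
- apply: (mulIf a20); apply/eqP; rewrite -subr_eq0; move/eqP: BE; rewrite -subr_eq0 => /eqP <-.
  apply/eqP; move: (d0); rewrite /D0 => {}d0.
  clearbody A A1 t; move: (gm g p y y) => a2.
  move: (derive1 (derive1 kap) t) => k2; move: (derive1 kap t) (kap t) (E t) d0 e0 => k1 k e d0 e0.
  by field; rewrite ?wpt ?d0 ?e0.
- apply: (mulIf ne0); apply/eqP; rewrite -subr_eq0; move/eqP: BS; rewrite -subr_eq0 => /eqP <-.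
  apply/eqP; move: (d0); rewrite /D0 => {}d0.
  clearbody A A1 t; move: (derive1 (derive1 kap) t) => k2; move: (derive1 kap t) (kap t) (E t) d0 e0 => k1 k e d0 e0.
  by field; rewrite ?wpt ?d0 ?e0.
Qed.

End regular_point.

(** * Conformal deformations *)

Section locality.
Context {R : realType} {n : nat} (U : set 'rV[R]_n).
Hypothesis Uo : open U.
Implicit Types (g : 'rV[R]_n -> 'M[R]_n) (b : 'rV[R]_n -> 'rV[R]_n).

(** The forms [deform_form] and [dual_form] need agree only over a chart domain, where the relation
    between [nu] and [rho] is assumed; the tensors below depend only on the germ of the form. *)
Lemma covd_eq_on g b b' p i j : U p -> (forall q, U q -> b q = b' q) ->
  covd g b p i j = covd g b' p i j.
Proof.
move=> Up bb'; rewrite /covd (bb' _ Up); congr (_ - _).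
by apply: (partial_eq_on _ Uo Up) => q Uq; rewrite bb'.
Qed.

Lemma sij_eq_on g b b' p i j : U p -> (forall q, U q -> b q = b' q) ->
  sij g b p i j = sij g b' p i j.
Proof. by move=> Up bb'; rewrite /sij !(covd_eq_on g _ _ Up bb'). Qed.

Lemma s0_eq_on g b b' p y : U p -> (forall q, U q -> b q = b' q) ->
  s0 g b p y = s0 g b' p y.
Proof.
move=> Up bb'; apply: eq_bigr => i _; congr (_ * _); apply: eq_bigr => k _.
by rewrite (sij_eq_on g _ _ Up bb') /bup bb'.
Qed.

Lemma t00_eq_on g b b' p y : U p -> (forall q, U q -> b q = b' q) ->
  t00 g b p y = t00 g b' p y.
Proof.
move=> Up bb'; apply: eq_bigr => i _; apply: eq_bigr => j _; congr (_ * _ * _).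
apply: eq_bigr => k _; apply: eq_bigr => l _.
by rewrite !(sij_eq_on g _ _ Up bb').
Qed.

Lemma normsq_eq_at g b b' p : b p = b' p -> normsq g b p = normsq g b' p.
Proof. by move=> e; rewrite /normsq /bup e. Qed.

Lemma quotient_value_eq_on (N N' D D' : 'rV[R]_n -> R) p v : U p ->
  (forall q, U q -> N q = N' q) -> (forall q, U q -> D q = D' q) ->
  quotient_value N D p v -> quotient_value N' D' p v.
Proof.
move=> Up NN DD [q1 q2]; split; rewrite -DD// -?NN//.
move=> /q2[cl lim]; split.
  move=> V Vp.
  have VU : nbhs p (V `&` U) by apply: filterI => //; exact: (open_nbhs_nbhs (conj Uo Up)).
  have [r [Dr [Vr Ur]]] := cl _ VU; exists r; split => //.
  by rewrite /= -DD.
apply: cvg_trans lim => P /= wP.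
have Un : nbhs p U by exact: (open_nbhs_nbhs (conj Uo Up)).
have wP' : nbhs p (fun q => D q != 0 -> P (N q / D q)) := wP.
change (nbhs p (fun q => D' q != 0 -> P (N' q / D' q))).
apply: filterS (filterI wP' Un) => q [Pq Uq] D0.
by rewrite -NN// -DD//; apply: Pq; rewrite /= DD.
Qed.

End locality.

Section concircular.
Context {R : realType} {n : nat} (U : set 'rV[R]_n) (g : 'rV[R]_n -> 'M[R]_n).
Context (b : 'rV[R]_n -> 'rV[R]_n) (a mu m : R).
Hypothesis gU : metric_on U g.
Hypothesis bU : form_on U b.
Hypothesis bK : killing_on U g b.
Implicit Types (p q u x y : 'rV[R]_n).

Let Uo : open U := metric_open gU.
Local Notation B q := (sharp g q (b q)).
Local Notation s := (sform g b).
Local Notation S q := (sharp g q (sform g b q)).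
Local Notation f := (normsq g b).
Local Notation w q := (a ^+ 2 - mu * normsq g b q).

Hypothesis n_gt2 : (2 < n)%N.
Hypothesis a_neq0 : a != 0.
Hypothesis t00_eq : forall p, U p -> forall y, exists2 v : R,
  quotient_value (fun q => s0 g b q y ^+ 2) (fun q => w q) p v &
  t00 g b p y + w p * alpha2 g p y
    + mu * (f p * alpha2 g p y - beta b p y ^+ 2) - mu * v = 0.
Hypothesis Rbb_eq : forall p, U p -> forall y,
  Rbb g b p y = mu * (f p * alpha2 g p y - beta b p y ^+ 2).
Hypothesis ricci_eq : forall p, U p -> forall y,
  ricci g p y = n.-1%:R * mu * alpha2 g p y.

Variables (J : set R) (E kap : R -> R).
Hypothesis UJ : forall q, U q -> J (f q).
Hypothesis ES : smooth_on_line J E.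
Hypothesis kapS : smooth_on_line J kap.
Hypothesis E_gt0 : forall q, U q -> 0 < E (f q).
Hypothesis kap0 : forall q, U q -> kap (f q) = 0.
Hypothesis kap1 : forall q, U q -> derive1 kap (f q) = 0.
Hypothesis kap2 : forall q, U q -> derive1 (derive1 kap) (f q) = 0.

Local Notation gb := (deform g b E kap).
Local Notation bb := (dual_form g b E kap).
Local Notation A q := (defA E (f q)).
Local Notation A1 q := (defA1 (E := E) (f q)).

(** With [A = - 2 phi' / phi], [A_second] is [(phi' sqrt w)' = 0] freed of roots and [A_energy] is
    the first integral. [A_first] is [A_energy] divided by [f], stated separately because [f] may
    vanish. *)
Hypothesis A_singular : forall q, U q -> w q = 0 -> A q = 0.
Hypothesis A1_singular : forall q, U q -> w q = 0 -> A1 q = 0.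
Hypothesis A_second : forall q, U q -> 2 * w q * A1 q = mu * A q + w q * A q ^+ 2.
Hypothesis A_energy : forall q, U q ->
  w q * (1 + f q * A q) ^+ 2 + m * f q * E (f q) = a ^+ 2.
Hypothesis A_first : forall q, U q ->
  mu - (2 * A q + A q ^+ 2 * f q) * w q = m * E (f q).

Let Delta_gt0 q : U q -> 0 < 1 - f q * kap (f q).
Proof. by move=> Uq; rewrite kap0// mulr0 subr0. Qed.

Let E_neq0 q : U q -> E (f q) != 0.
Proof. by move=> Uq; rewrite gt_eqF// E_gt0. Qed.

Let defX_eq0 q : U q -> defX kap (f q) = 0.
Proof. by move=> Uq; rewrite /defX kap0// kap1// expr0n /= addr0 oppr0 mul0r. Qed.

Let defY_eq0 q : U q -> defY E kap (f q) = 0.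
Proof. by move=> Uq; rewrite /defY kap0// kap1// mulr0 addr0. Qed.

Let defN_eq k q : U q -> defN E kap k (f q) = k * E (f q).
Proof. by move=> Uq; rewrite /defN kap0// mulr0 subr0 mulr1. Qed.

Let defN1_eq k q : U q -> defN1 E kap k (f q) = k * A q * E (f q).
Proof.
move=> Uq; rewrite /defN1 kap0// kap1// !(mulr0, addr0, oppr0, mul0r, add0r, mulr1).
by rewrite /defA -mulrA mulfVK// E_neq0.
Qed.

Let defc_eq k q : U q -> defc E kap k (f q) = k ^+ 2 * E (f q) * (1 + f q * A q).
Proof.
move=> Uq; rewrite /defc defN_eq// defN1_eq//.
by move: (f q) => t; move: (E t) (defA E t) => e x; ring.
Qed.

Lemma deform_conformal p y : U p -> gm gb p y y = E (f p) * gm g p y y.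
Proof. by move=> Up; rewrite gm_deform kap0// !mul0r subr0. Qed.

Lemma ricci_concircular p y : U p -> ricci gb p y = n.-1%:R * m * alpha2 gb p y.
Proof.
move=> Up; have Jp := UJ Up; have e0 := E_neq0 Up.
have d0 : 1 - f p * kap (f p) != 0 by rewrite gt_eqF// Delta_gt0.
have Y1 : derive1 (derive1 kap) (f p) + (A1 p * kap (f p) + A p * derive1 kap (f p)) = 0.
  by rewrite kap0// kap1// kap2// !mulr0 !addr0.
have Xb : defX kap (f p) * dot (b p) y = 0 by rewrite defX_eq0// mul0r.
have Yb : defY E kap (f p) * dot (b p) y = 0 by rewrite defY_eq0// mul0r.
have Y1b : (derive1 (derive1 kap) (f p) + (A1 p * kap (f p) + A p * derive1 kap (f p))) * dot (b p) y = 0.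
  by rewrite Y1 mul0r.
have kb : kap (f p) * dot (b p) y = 0 by rewrite kap0// mul0r.
have X1 : defX1 (kap := kap) (f p) = 0.
  by rewrite /defX1 kap0// kap1// kap2// !(mulr0, mul0r, addr0, oppr0).
rewrite (ricci_deform gU bU bK UJ ES kapS E_gt0 Delta_gt0 Up
  (defA_is_derive ES Jp e0) (defX_is_derive kapS Jp d0) (defY_is_derive ES kapS Jp e0)
  (lam_is_derive ES kapS n Jp e0 d0) Xb Yb Y1b kb).
rewrite /lam X1 defX_eq0// kap0// kap1// ricci_eq// !alpha2E deform_conformal//.
rewrite !(mul0r, mulr0, addr0, subr0, add0r) (w_normsq gU bU bK a_neq0 t00_eq Rbb_eq)//.
have [v [vq _ ->]] := t00_hess gU bU bK t00_eq Rbb_eq y Up.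
(* Where [w] vanishes so do [A] and [A1], and only [mu = m * E] is left; elsewhere [A_second]
   determines [A1]. *)
have [w0|w0] := eqVneq (w p) 0.
  have := A_first Up; rewrite (A_singular Up w0) (A1_singular Up w0) w0.
  move: (f p) => t; rewrite !mulr0 subr0 => muE.
  by rewrite muE; move: (E t) (n.-1%:R) (gm _ _ _ _) (dot _ _) => *; ring.
have -> : v = dot (s p) y ^+ 2 / w p by rewrite -(s0E g b); exact: vq.1.
rewrite (divg_s gU bU bK a_neq0 t00_eq Rbb_eq)//.
have n1E : n.-1%:R = n%:R - 1 :> R.
  by rewrite -[in RHS](prednK (ltn_trans (isT : (0 < 2)%N) n_gt2)) -natr1 addrK.
have H1 := A_first Up; have H2 := A_second Up; rewrite n1E.
have -> : (n%:R - 1) * m * (E (f p) * gm g p y y) = (n%:R - 1) * (m * E (f p)) * gm g p y y by ring.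
rewrite -H1.
have A1E : A1 p = (mu * A p + w p * A p ^+ 2) / (2 * w p).
  by rewrite -H2; field; rewrite w0.
rewrite A1E.
move: w0; move: (f p) => t; move: (defA E t) (gm _ _ _ _) (dot _ _) n%:R => x a2 s0 N w0.
by field; rewrite w0.
Qed.

Lemma t00_concircular k p y v : U p ->
  quotient_value (fun q => s0 g b q y ^+ 2) (fun q => w q) p v ->
  t00 g b p y = - a ^+ 2 * gm g p y y + mu * dot (b p) y ^+ 2 + mu * v ->
  t00 gb (bb k) p y = k ^+ 2 * E (f p) *
    (- a ^+ 2 * gm g p y y + m * E (f p) * dot (b p) y ^+ 2 + m * E (f p) * v).
Proof.
move=> Up vq t0E; rewrite (t00_dual gU bU bK UJ ES kapS E_gt0 Delta_gt0)//.
rewrite t0E kap0// defN_eq// defN1_eq// (cov_S gU bU bK a_neq0 t00_eq Rbb_eq)//.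
rewrite (w_normsq gU bU bK a_neq0 t00_eq Rbb_eq)// -A_first//.
have e0 := E_neq0 Up.
(* Valid also where [w] vanishes, because [A] does; it lets the limit [v] stand for the quotient. *)
have sv : A p * dot (s p) y ^+ 2 = A p * w p * v.
  have [w0|w0] := eqVneq (w p) 0; first by rewrite A_singular// !mul0r.
  by rewrite (vq.1 w0) s0E; field.
apply/eqP; rewrite -subr_eq0; apply/eqP.
transitivity (- k ^+ 2 * E (f p) * (2 + A p * f p) * (A p * dot (s p) y ^+ 2 - A p * w p * v)); last first.
  by rewrite sv subrr mulr0.
move: {t0E vq sv} e0; move: (f p) => t; move: (E t) (defA E t) => e x.
by move: (gm _ _ _ _) (dot _ _) (dot _ _) => a2 be s0 e0; field.
Qed.

(** Here [cov_sform] of the barred pair is solved for [Rbb], its Hessian and its [t00] being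
    known. *)
Lemma Rbb_concircular k p y : U p -> Rbb gb (bb k) p y =
  m * (normsq gb (bb k) p * alpha2 gb p y - beta (bb k) p y ^+ 2).
Proof.
move=> Up; have Jp := UJ Up; have e0 := E_neq0 Up.
have gbU := deform_metric_on gU bU UJ ES kapS E_gt0 Delta_gt0.
have bbU := dual_form_on gU bU UJ ES kapS k.
have bbK := killing_dual gU bU bK UJ ES kapS E_gt0 Delta_gt0 k.
have := cov_sform gbU bbU bbK y Up.
rewrite (cov_sform_dual gU bU bK UJ ES kapS E_gt0 Delta_gt0 y Up (defc_is_derive ES kapS k Jp e0)).
have [v [vq t0E hE]] := t00_hess gU bU bK t00_eq Rbb_eq y Up.
rewrite (t00_concircular k Up vq t0E) hE.
rewrite (normsq_dual gU bU UJ ES kapS E_gt0 Delta_gt0)//.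
rewrite alpha2E deform_conformal// -[beta (bb k) p y]/(dot (bb k p) y) /dual_form dotZl.
rewrite (dot_sT gU bK E kap)// defY_eq0// kap0// defN_eq// defc_eq// /defc1 kap0// kap1// kap2//.
rewrite (w_normsq gU bU bK a_neq0 t00_eq Rbb_eq)//.
move/esym/(canRL (subKr _)) => ->.
have H3 := A_energy Up; have H2 := A_second Up; have H1 := A_first Up.
have H3' : m * f p * E (f p) = a ^+ 2 - w p * (1 + f p * A p) ^+ 2.
  by rewrite (canRL (addKr _) H3) addrC.
have [w0|w0] := eqVneq (w p) 0.
  have := H1; rewrite (A_singular Up w0) (A1_singular Up w0) w0.
  rewrite w0 mul0r subr0 in H3'.
  rewrite !mulr0 subr0 => muE.
  have aE : a ^+ 2 = mu * f p by apply/eqP; rewrite -subr_eq0 w0.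
  rewrite aE muE; move: (f p) => t; move: (E t) (gm _ _ _ _) (dot _ _) (dot _ _) => e a2 be s0.
  by ring.
have -> : v = dot (s p) y ^+ 2 / w p by rewrite -(s0E g b); exact: vq.1.
apply/eqP; rewrite -subr_eq0; apply/eqP.
transitivity (k ^+ 2 * E (f p) * gm g p y y * (a ^+ 2 - w p * (1 + f p * A p) ^+ 2 - m * f p * E (f p))
  + k ^+ 2 * E (f p) * f p * dot (s p) y ^+ 2 / w p * (mu * A p + w p * A p ^+ 2 - 2 * w p * A1 p)
  + k ^+ 2 * E (f p) * dot (s p) y ^+ 2 / w p * (mu - (2 * A p + A p ^+ 2 * f p) * w p - m * E (f p))); last first.
  by rewrite H3' H2 H1 !subrr !mulr0 !addr0.
move: w0; rewrite {H1 H2 H3 H3'}.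
move: (f p) => t; move: (E t) (defA E t) (defA1 t) => e x x1.
move: (gm _ _ _ _) (dot _ _) (dot _ _) => a2 be s0 w0.
by field; rewrite w0.
Qed.

(** With [psi = 1 + f * A], the barred numerator is [(k ^+ 2 * E * psi) ^+ 2 * s0 ^+ 2] and, by
    [A_energy], the barred denominator is [k ^+ 2 * w * psi ^+ 2]. The quotient is [k ^+ 2 * E ^+ 2]
    times the old one, but the zeros of [psi] become singular points. *)
Lemma t00_condition_concircular k abar p y : k != 0 -> abar ^+ 2 = k ^+ 2 * a ^+ 2 -> U p ->
  exists2 v : R,
  quotient_value (fun q => s0 gb (bb k) q y ^+ 2)
    (fun q => abar ^+ 2 - m * normsq gb (bb k) q) p v &
  t00 gb (bb k) p y + (abar ^+ 2 - m * normsq gb (bb k) p) * alpha2 gb p y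
    + m * (normsq gb (bb k) p * alpha2 gb p y - beta (bb k) p y ^+ 2) - m * v = 0.
Proof.
move=> k0 abarE Up; have Jp := UJ Up; have e0 := E_neq0 Up.
have [v [vq t0E hE]] := t00_hess gU bU bK t00_eq Rbb_eq y Up.
exists (k ^+ 2 * E (f p) ^+ 2 * v); last first.
  rewrite (t00_concircular k Up vq t0E) alpha2E deform_conformal//.
  rewrite -[beta (bb k) p y]/(dot (bb k p) y) /dual_form dotZl defN_eq// abarE.
  move: (normsq gb (bb k) p) (f p) => t' t; move: (E t) => e.
  by move: (gm _ _ _ _) (dot _ _) => a2 be; ring.
pose psi q := 1 + f q * A q.
have ND q : U q -> s0 gb (bb k) q y ^+ 2 =
    (k ^+ 2 * E (f q) * psi q) ^+ 2 * s0 g b q y ^+ 2.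
  move=> Uq; rewrite !s0E (sform_dual gU bU bK UJ ES kapS E_gt0 Delta_gt0)// dotZl defc_eq//.
  by rewrite exprMn.
have DD q : U q -> abar ^+ 2 - m * normsq gb (bb k) q = k ^+ 2 * w q * psi q ^+ 2.
  move=> Uq; rewrite abarE (normsq_dual gU bU UJ ES kapS E_gt0 Delta_gt0)// defN_eq//.
  rewrite /psi -[RHS]mulrA (canRL (addrK _) (A_energy Uq)).
  by move: (f q) => t; move: (E t) => e; ring.
apply: (quotient_value_eq_on Uo Up (fun q Uq => esym (ND q Uq)) (fun q Uq => esym (DD q Uq))).
have fc : {for p, continuous f} by exact: Cm_continuous (normsq_Cm gU bU 0) Up.
have Ec : {for p, continuous (fun q => E (f q))}.
  apply: continuous_comp fc _; apply: differentiable_continuous; apply/derivable1_diffP.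
  by case: (line_derive ES Jp).
have psic : {for p, continuous psi}.
  apply: continuousD; first exact: cst_continuous.
  apply: continuousM => //; apply: continuous_comp fc _.
  apply: differentiable_continuous; apply/derivable1_diffP.
  by case: (defA_is_derive ES Jp e0).
have s0c : {for p, continuous (fun q => s0 g b q y)}.
  have sC : Cm 0 U (fun q => s0 g b q y).
    apply: Cm_sum => // i _; apply: CmM => //; last exact: Cm_cst.
    apply: (@Cm_eq_on _ _ _ _ (fun q => s q 0 i)) => //; first by move=> q _; rewrite mxE.
    exact: (form_Cm (sform_on gU bU bK)).
  exact: Cm_continuous sC Up.
have wc : {for p, continuous (fun q => w q)}.
  apply: continuousB; first exact: cst_continuous.
  by apply: continuousM => //; exact: cst_continuous.
have Un : nbhs p U by exact: (open_nbhs_nbhs (conj Uo Up)).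
split=> [|].
  move=> D0.
  have wp : w p != 0 by apply: contraNneq D0 => ->; rewrite mulr0 mul0r.
  have psip : psi p != 0 by apply: contraNneq D0 => ->; rewrite expr0n mulr0.
  rewrite (vq.1 wp); move: (psi p) (f p) (s0 _ _ _ _) wp psip => z t s' wp psip.
  by field; rewrite wp k0 psip.
move=> Dp.
(* As [w] is nonzero on [DB], it is enough that [DB] accumulates at [p] and that the old quotient
   converges along it. *)
pose DB : set 'rV[R]_n := [set q | k ^+ 2 * w q * psi q ^+ 2 != 0].
have DBw q : DB q -> w q != 0.
  by rewrite /DB /= => D0; apply: contraNneq D0 => ->; rewrite mulr0 mul0r.
have [cl lim] : closure DB p /\
    (fun q => s0 g b q y ^+ 2 / w q) @ within DB (nbhs p) --> v.
  (* At an old singular point [psi] is 1, so near [p] the set [DB] contains every point where [w] is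
     nonzero. *)
  have [w0|w0] := eqVneq (w p) 0.
    have psi1 : psi p != 0 by rewrite /psi A_singular// mulr0 addr0 oner_neq0.
    have psin : \forall q \near p, psi q != 0.
      exact: (psic _ (open_nbhs_nbhs (conj (@open_neq R 0) psi1))).
    have [cl lim] := vq.2 w0; split.
      move=> V Vp; have [r [wr [Vr pr]]] := cl _ (filterI Vp psin).
      by exists r; split => //; rewrite /DB /= !mulf_neq0// expf_neq0.
    apply: cvg_trans lim => P wP.
    have wP' : nbhs p (fun q => w q != 0 -> P (s0 g b q y ^+ 2 / w q)) := wP.
    change (nbhs p (fun q => DB q -> P (s0 g b q y ^+ 2 / w q))).
    by apply: filterS wP' => q Pq /DBw; exact: Pq.
  split; last first.
    rewrite (vq.1 w0); apply: cvg_within_filter.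
    by apply: cvgM; [exact: (continuousM s0c s0c)|apply: cvgV].
  have psip : psi p = 0.
    by apply/eqP; move/eqP: Dp; apply: contraTT => z0; rewrite !mulf_neq0.
  have fA : f p * A p = - 1 by apply/eqP; rewrite -addr_eq0 addrC; apply/eqP.
  have fp0 : f p != 0 by apply: contra_eqN fA => /eqP ->; rewrite mul0r eq_sym oppr_eq0 oner_neq0.
  have mfE : m * f p * E (f p) = a ^+ 2.
    by have := A_energy Up; rewrite fA subrr expr0n mulr0 add0r.
  (* If [DB] did not accumulate at [p], [psi] would vanish near [p], hence also its derivative along
     [S p], which is [f p] times this number. *)
  have d0 : 2 * w p * (A p + f p * A1 p) != 0.
    have -> : 2 * w p * (A p + f p * A1 p) = - (m * E (f p)).
      rewrite -(A_first Up) mulrDr [2 * w p * (f p * _)]mulrCA (A_second Up).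
      apply/eqP; rewrite -subr_eq0; apply/eqP.
      transitivity ((f p * A p + 1) * mu); last by rewrite fA addNr mul0r.
      by move: (f p) => t; move: (defA E t) => x; ring.
    have : m * f p * E (f p) != 0 by rewrite mfE expf_neq0.
    by rewrite oppr_eq0; apply: contraNneq => mE0; rewrite mulrAC mE0 mul0r.
  move=> V Vp; apply/set0P/negP => /eqP VD.
  have wn : \forall q \near p, w q != 0.
    exact: (wc _ (open_nbhs_nbhs (conj (@open_neq R 0) w0))).
  have VUw : nbhs p ((V `&` U) `&` [set q | w q != 0]) by apply: filterI => //; exact: filterI.
  have [W [Wo Wp] WS] : exists2 W, open_nbhs p W & W `<=` (V `&` U) `&` [set q | w q != 0].
    by move: VUw; rewrite nbhsE.
  have psi0 q : W q -> 0 = psi q.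
    move=> /WS[[Vq Uq] wq]; apply/eqP; rewrite eq_sym; apply/negPn/negP => z0.
    have : (DB `&` V) q by split => //; rewrite /DB /= !mulf_neq0// expf_neq0.
    by rewrite VD.
  have fd := dd_normsq gU bU bK (S p) Up.
  have H1 := ddD (dd_cst p (S p) 1) (ddM fd (dd_comp (defA_is_derive ES Jp e0) fd)).
  have H2 := dd_eq_on Wo Wp psi0 (dd_cst p (S p) 0).
  have := dd_unique H2 H1; rewrite (w_normsq gU bU bK a_neq0 t00_eq Rbb_eq)//.
  move=> E0; move/negP: d0; apply; apply/eqP; apply: (mulfI fp0).
  rewrite mulr0 E0; move: (f p) => t; move: (defA E t) (defA1 t) => x x1; ring.
split=> //.
have L : (fun q => k ^+ 2 * E (f q) ^+ 2 * (s0 g b q y ^+ 2 / w q)) @ within DB (nbhs p)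
    --> k ^+ 2 * E (f p) ^+ 2 * v.
  apply: cvgM lim; apply: cvg_within_filter.
  by apply: cvgM; [exact: cvg_cst|exact: (continuousM Ec Ec)].
apply: cvg_trans L; apply: near_eq_cvg.
have H : nbhs p (fun q => DB q -> k ^+ 2 * E (f q) ^+ 2 * (s0 g b q y ^+ 2 / w q) =
    (k ^+ 2 * E (f q) * psi q) ^+ 2 * s0 g b q y ^+ 2 / (k ^+ 2 * w q * psi q ^+ 2)).
  apply: filterE => q Dq; have wq := DBw q Dq.
  have psiq : psi q != 0 by move: Dq; apply: contraNneq => ->; rewrite expr0n mulr0.
  move: (psi q) (s0 _ _ _ _) (E (f q)) (f q) wq psiq => z s' e t wq psiq.
  by field; rewrite wq k0 psiq.
exact: H.
Qed.

End concircular.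

(** * Functions on the interval of values of b^2 *)

Section one_variable.
Context {R : realType}.
Implicit Types (h phi : R -> R) (t z d : R) (I J : set R).

Lemma vanish_at_end h t z : z != t ->
  (forall r, 0 < r < 1 -> h (t + r * (z - t)) = 0) -> {for t, continuous h} -> h t = 0.
Proof.
move=> zt h0 hc; apply/eqP/negPn/negP => ht.
have e0 : 0 < `|h t| by rewrite normr_gt0.
have : \forall x \near t, `|h t - h x| < `|h t|.
  by move: hc => /cvgrPdist_lt /(_ _ e0).
move=> /nbhs_ballP[e /= ep eP].
have zt0 : 0 < `|z - t| by rewrite normr_gt0 subr_eq0.
pose r := Num.min (1 / 2) (e / (2 * `|z - t|)).
have r0 : 0 < r by rewrite lt_min !divr_gt0// mulr_gt0.
have r1 : r < 1 by rewrite gt_min ltr_pdivrMr// mul1r ltr1n.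
have := eP (t + r * (z - t)); rewrite h0 ?r0// subr0 ltxx => H.
suff : false by [].
apply: H; rewrite /ball /= opprD addrA subrr sub0r normrN normrM (gtr0_norm r0).
apply: (@le_lt_trans _ _ (e / (2 * `|z - t|) * `|z - t|)).
  by rewrite ler_wpM2r// ge_min lexx orbT.
rewrite invfM mulrA mulfVK ?gt_eqF//.
by rewrite ltr_pdivrMr// ltr_pMr// ltr1n.
Qed.

(** Nothing is known on the other side of [t], but the derivative is two-sided, so difference
    quotients towards [z] determine it. *)
Lemma vanish_derive h t z d : z != t ->
  (forall r, 0 < r < 1 -> h (t + r * (z - t)) = 0) -> is_derive t 1 h d ->
  h t = 0 /\ d = 0.
Proof.
move=> zt h0 hd.
have hc : {for t, continuous h}.
  by apply: differentiable_continuous; apply/derivable1_diffP; case: hd.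
have ht := vanish_at_end zt h0 hc; split=> //.
pose F (r : R) := r^-1 *: (h (r *: (1 : R) + t) - h t).
have Fc : F @ 0^' --> d by case: hd => hd <-; exact: hd.
apply/eqP/negPn/negP => dn0.
have e0 : 0 < `|d| by rewrite normr_gt0.
have := Fc => /cvgrPdist_lt /(_ _ e0) /nbhs_ballP[e /= ep eP].
have zt0 : 0 < `|z - t| by rewrite normr_gt0 subr_eq0.
pose r := Num.min (1 / 2) (e / (2 * `|z - t|)).
have r0 : 0 < r by rewrite lt_min !divr_gt0// mulr_gt0.
have r1 : r < 1 by rewrite gt_min ltr_pdivrMr// mul1r ltr1n.
have rz0 : r * (z - t) != 0 by apply: mulf_neq0; [rewrite gt_eqF|rewrite subr_eq0].
have := eP (r * (z - t)); rewrite /F ht subr0.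
have -> : (r * (z - t)) *: (1 : R) + t = t + r * (z - t) by rewrite addrC [_ *: _]mulr1.
rewrite h0 ?r0// scaler0 subr0 ltxx => H.
suff : false by [].
apply: H => //; rewrite /ball /= sub0r normrN normrM (gtr0_norm r0).
apply: (@le_lt_trans _ _ (e / (2 * `|z - t|) * `|z - t|)).
  by rewrite ler_wpM2r// ge_min lexx orbT.
rewrite invfM mulrA mulfVK ?gt_eqF//.
by rewrite ltr_pdivrMr// ltr_pMr// ltr1n.
Qed.

(** The values that are not extremal; at the extremal ones [t] or [w] may vanish, see [interior_gt0]
    and [interior_w]. *)
Definition interior_of I t : Prop := exists x y, [/\ I x, I y & x < t < y].

Lemma interior_of_sub I t : is_interval I -> interior_of I t -> I t.
Proof. by move=> Iint [x [y [Ix Iy /andP[/ltW xt /ltW ty]]]]; apply: (Iint x y) => //; rewrite xt. Qed.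

Lemma interior_segment I t z r : I t -> I z -> z != t -> 0 < r < 1 -> interior_of I (t + r * (z - t)).
Proof.
move=> It Iz; rewrite neq_lt => /orP[zt|tz] /andP[r0 r1].
  have h1 : 0 < r * (t - z) by rewrite mulr_gt0 ?subr_gt0.
  have h2 : 0 < (1 - r) * (t - z) by rewrite mulr_gt0 ?subr_gt0.
  by exists z, t; split=> //; lra.
have h1 : 0 < r * (z - t) by rewrite mulr_gt0 ?subr_gt0.
have h2 : 0 < (1 - r) * (z - t) by rewrite mulr_gt0 ?subr_gt0.
by exists t, z; split=> //; lra.
Qed.

Lemma agree_at I h t : (exists2 z, I z & z != t) -> I t ->
  (forall z, interior_of I z -> h z = 0) -> {for t, continuous h} -> h t = 0.
Proof.
move=> [z Iz zt] It h0 hc; apply: (vanish_at_end zt) hc => r r01.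
by apply: h0; exact: interior_segment.
Qed.

Lemma agree_derive I h t d : (exists2 z, I z & z != t) -> I t ->
  (forall z, interior_of I z -> h z = 0) -> is_derive t 1 h d -> h t = 0 /\ d = 0.
Proof.
move=> [z Iz zt] It h0 hd; apply: (vanish_derive zt _ hd) => r r01.
by apply: h0; exact: interior_segment.
Qed.

Lemma const_on_interior I h : is_interval I ->
  (forall z, interior_of I z -> is_derive z 1 h 0) ->
  forall x y, interior_of I x -> interior_of I y -> h x = h y.
Proof.
move=> Iint hd.
suff W x y : x < y -> interior_of I x -> interior_of I y -> h x = h y.
  move=> x y Ix Iy; have [xy|yx|->//] := ltgtP x y; first exact: W.
  by rewrite (W y x).
move=> xy [x0 [x1 [Ix0 _ /andP[x0x _]]]] [y0 [y1 [_ Iy1 /andP[_ yy1]]]].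
have inI z : x <= z <= y -> interior_of I z.
  by move=> /andP[xz zy]; exists x0, y1; split=> //; lra.
have hc : {within `[x, y], continuous h}.
  apply: derivable_within_continuous => z; rewrite in_itv /= => /inI /hd.
  by case.
have oc z : z \in `]x, y[ -> is_derive z 1 h 0.
  by rewrite in_itv /= => /andP[/ltW xz /ltW zy]; apply/hd/inI; rewrite xz.
have [c _] := MVT xy oc hc.
by rewrite mul0r => /eqP; rewrite subr_eq0 => /eqP.
Qed.

(** The recursive form of [smooth_on_line], with the same purpose as [Cm]. *)
Fixpoint line_Cm (m : nat) J phi : Prop :=
  if m is m'.+1 then
    (forall t, J t -> derivable phi t 1) /\ line_Cm m' J (derive1 phi)
  else True.

Lemma line_CmP J phi : smooth_on_line J phi <-> forall m, line_Cm m J phi.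
Proof.
split=> [phiS m|phiC m].
  elim: m phi phiS => // m IH phi phiS; split; first exact: (phiS 0%N).
  by apply: IH => j t Jt; rewrite -derive1Sn; exact: phiS.
elim: m phi phiC => [|m IH] phi phiC t Jt; first exact: (phiC 1%N).1.
by rewrite derive1Sn; apply: (IH _ _ t Jt) => j; exact: (phiC j.+1).2.
Qed.

Lemma derive1_eq_on J phi h t : open J -> J t -> (forall x, J x -> phi x = h x) ->
  derive1 phi t = derive1 h t.
Proof.
move=> Jo Jt ph; rewrite !derive1E; apply: near_eq_derive.
by apply: filterS (open_nbhs_nbhs (conj Jo Jt)).
Qed.

Lemma line_Cm_eq_on m J phi h : open J -> (forall x, J x -> phi x = h x) ->
  line_Cm m J phi -> line_Cm m J h.
Proof.
move=> Jo; elim: m phi h => // m IH phi h ph [pd pC]; split.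
  move=> t Jt; apply: near_eq_derivable (pd t Jt).
  by apply: filterS (open_nbhs_nbhs (conj Jo Jt)).
by apply: IH pC => x Jx; exact: derive1_eq_on Jo Jx ph.
Qed.

Lemma line_CmS m J phi : line_Cm m.+1 J phi -> line_Cm m J phi.
Proof. by elim: m phi => // m IH phi [pd pC]; split=> //; exact: IH. Qed.

Lemma line_CmD m J phi h : open J -> line_Cm m J phi -> line_Cm m J h ->
  line_Cm m J (fun t => phi t + h t).
Proof.
move=> Jo; elim: m phi h => // m IH phi h [pd pC] [hd hC]; split.
  by move=> t Jt; apply: derivableD; [exact: pd|exact: hd].
apply: line_Cm_eq_on (IH _ _ pC hC) => // t Jt.
by rewrite !derive1E deriveD//; [exact: pd|exact: hd].
Qed.

Lemma line_CmM m J phi h : open J -> line_Cm m J phi -> line_Cm m J h ->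
  line_Cm m J (fun t => phi t * h t).
Proof.
move=> Jo; elim: m phi h => // m IH phi h pC' hC'.
have [pd pC] := pC'; have [hd hC] := hC'; split.
  by move=> t Jt; apply: derivableM; [exact: pd|exact: hd].
have := line_CmD Jo (IH _ _ pC (line_CmS hC')) (IH _ _ (line_CmS pC') hC).
apply: line_Cm_eq_on => // t Jt.
have [_] := is_derive_fctM (derivableP (pd t Jt)) (derivableP (hd t Jt)).
by rewrite !derive1E => ->.
Qed.

Lemma smooth_expR J rho : open J -> smooth_on_line J rho ->
  smooth_on_line J (fun t => expR (rho t) ^+ 2).
Proof.
move=> Jo rhoS.
have ed t : J t -> is_derive t 1 (fun t => expR (rho t)) (derive1 rho t * expR (rho t)).
  move=> Jt; rewrite mulrC; apply: is_derive_fct_comp (is_derive_expR _) _.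
  exact: line_derive rhoS Jt.
have eC m : line_Cm m J (fun t => expR (rho t)).
  elim: m => // m IH; split; first by move=> t /ed[].
  have rC : line_Cm m J (derive1 rho) by have /line_CmP /(_ m.+1)[] := rhoS.
  apply: line_Cm_eq_on (line_CmM Jo rC IH) => // t Jt.
  by have [_ <-] := ed t Jt; rewrite derive1E.
by apply/line_CmP => m; exact: (line_CmM Jo (eC m) (eC m)).
Qed.

End one_variable.

(** * The differential equations on the interval of values *)

Section value_interval.
Context {R : realType} (I J : set R) (rho kap : R -> R) (a mu m : R).
Hypothesis I_interval : is_interval I.
Hypothesis I_nontrivial : exists x y, [/\ I x, I y & x < y].
Hypothesis J_open : open J.
Hypothesis IJ : forall t, I t -> J t.
Hypothesis rhoS : smooth_on_line J rho.
Hypothesis kapS : smooth_on_line J kap.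
Hypothesis a_neq0 : a != 0.
Hypothesis I_ge0 : forall t, I t -> 0 <= t.
Hypothesis w_ge0 : forall t, I t -> 0 <= a ^+ 2 - mu * t.

Local Notation w t := (a ^+ 2 - mu * t).
Local Notation E := (fun t => expR (rho t) ^+ 2).
Local Notation In := (interior_of I).
Local Notation r1 := (derive1 rho).
Local Notation r2 := (derive1 (derive1 rho)).
Local Notation A := (defA E).
Local Notation A1 := (defA1 (E := E)).

Definition special_deformation : Prop :=
  (forall t, I t -> 1 - t * kap t = 1) /\
  exists C D : R,
    (mu = 0 ->
       (forall t, I t -> 0 < C + D * t /\ rho t = - ln (C + D * t)) /\
       m = 4 * C * D * a ^+ 2) /\
    (mu <> 0 ->
       (forall t, I t -> 0 < C + D * Num.sqrt (w t) /\
          rho t = - ln (C + D * Num.sqrt (w t))) /\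
       m = (C ^+ 2 - D ^+ 2 * a ^+ 2) * mu).

Let ES : smooth_on_line J E := smooth_expR J_open rhoS.

Let In_I t : In t -> I t := @interior_of_sub R I t I_interval.

Let E_neq0 t : E t != 0.
Proof. by rewrite expf_neq0// gt_eqF// expR_gt0. Qed.

Lemma other_point t : I t -> exists2 z, I z & z != t.
Proof.
move=> It; have [x [y [Ix Iy xy]]] := I_nontrivial.
by have [e|e] := eqVneq x t; [exists y => //; rewrite -e gt_eqF|exists x].
Qed.

Lemma interior_inhabited : exists t, In t.
Proof.
have [x [y [Ix Iy xy]]] := I_nontrivial.
by exists ((x + y) / 2), x, y; split=> //; lra.
Qed.

Lemma interior_gt0 t : In t -> 0 < t.
Proof. by move=> [x [y [/I_ge0 x0 _ /andP[xt _]]]]; apply: le_lt_trans xt. Qed.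

Lemma interior_w t : In t -> 0 < w t.
Proof.
move=> [x [y [/w_ge0 wx /w_ge0 wy /andP[xt ty]]]].
have a20 : 0 < a ^+ 2 by rewrite lt0r sqrf_eq0 a_neq0 sqr_ge0.
have [mu0|mu0|->] := ltgtP mu 0; last by rewrite mul0r subr0.
- by apply: le_lt_trans wx _; rewrite ltrD2l ltrN2 ltr_nM2l.
- by apply: le_lt_trans wy _; rewrite ltrD2l ltrN2 ltr_pM2l.
Qed.

Lemma defA_rho t : J t -> A t = 2 * r1 t.
Proof.
move=> Jt; rewrite /defA; apply: (mulIf (E_neq0 t)); rewrite mulfVK ?E_neq0//.
have ed := is_derive_fct_comp (is_derive_expR (rho t)) (line_derive rhoS Jt).
have [_ ee] := is_derive_fctM ed ed.
rewrite derive1E -[in RHS]mulrA; move: ee; rewrite /= => ->.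
by move: (expR _) (derive1 _ _) => *; ring.
Qed.

Lemma defA1_rho t : J t -> A1 t = 2 * r2 t.
Proof.
move=> Jt; have [_ <-] := defA_is_derive ES Jt (E_neq0 t).
have H : is_derive t 1 (fun x => 2 * r1 x) (2 * r2 t).
  apply: is_derive_eq (is_derive_fctM (is_derive_cst (2 : R) t (1 : R)) (line_derive2 rhoS Jt)) _.
  by rewrite /= mul0r add0r.
have n : \forall x \near t, 2 * r1 x = A x.
  by apply: filterS (open_nbhs_nbhs (conj J_open Jt)) => x Jx; rewrite defA_rho.
by have [_ ->] := near_eq_is_derive n H.
Qed.

(* [Fi] is [exp(-rho)], the function which turns out to be [C + D t], resp.
   [C + D sqrt (a^2 - mu t)]. *)
Definition Fi t : R := expR (- rho t).

Lemma Fi_gt0 t : 0 < Fi t.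
Proof. exact: expR_gt0. Qed.

Lemma E_Fi t : E t = Fi t ^- 2.
Proof. by rewrite /Fi expRN exprVn invrK. Qed.

Lemma Fi_derive t : J t -> is_derive t 1 Fi (- r1 t * Fi t).
Proof.
move=> Jt; rewrite mulrC.
exact: is_derive_fct_comp (is_derive_expR _) (is_derive_fctN (line_derive rhoS Jt)).
Qed.

Lemma w_derive (t : R) : is_derive t (1 : R) (fun x : R => w x) (- mu).
Proof.
apply: is_derive_eq (is_derive_fctB (is_derive_cst (a ^+ 2) t 1) (is_derive_fctM (is_derive_cst mu t 1) (is_derive_id t (1 : R)))) _.
by rewrite /=; ring.
Qed.

Section forward.
Variable N : R.
Hypothesis N_gt2 : 2 < N.
Hypothesis Delta_gt0 : forall t, I t -> 0 < 1 - t * kap t.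
Hypothesis sys : forall t, In t ->
  let D0 := 1 - t * kap t in let D1 := - (kap t + t * derive1 kap t) in
  [/\ mu - 2 * t * w t * A1 t - (2 * w t - mu * t) * A t = m * E t,
      (D0 * (1 + t * A t) + t * D1) * w t * (1 + t * A t) = D0 ^+ 2 * a ^+ 2 - m * D0 * t * E t
    & (N - 3) * (w t * (1 + t * A t) ^+ 2 + m * t * E t) = a ^+ 2 * (N - 3 * D0)].

(** Differentiating the third equation gives [3 * a ^+ 2 * D1] up to a multiple of the first, so
    [D1 = 0]. The second then says that the bracket in the third is [D0 * a ^+ 2], and the third
    becomes [N * D0 = N]. *)
Lemma interior_Delta t : In t ->
  1 - t * kap t = 1 /\ w t * (1 + t * A t) ^+ 2 + m * t * E t = a ^+ 2.
Proof.
move=> It; have Jt := IJ (In_I It).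
have [S1 S2 S3] := sys It.
have D00 : 1 - t * kap t != 0 by rewrite gt_eqF//; exact/Delta_gt0/In_I.
pose h x := (N - 3) * (w x * ((1 + x * A x) * (1 + x * A x)) + m * x * E x)
  - a ^+ 2 * (N - 3 * (1 - x * kap x)).
have h0 x : In x -> h x = 0.
  by move=> Ix; have [_ _ e] := sys Ix; rewrite /h -expr2 e subrr.
have id1 := is_derive_id t (1 : R).
have Ad := defA_is_derive ES Jt (E_neq0 t).
have Ed := line_derive ES Jt; have kd := line_derive kapS Jt.
have psid := is_derive_fctD (is_derive_cst (1 : R) t 1) (is_derive_fctM id1 Ad).
have hd := is_derive_fctB
  (is_derive_fctM (is_derive_cst (N - 3) t 1) (is_derive_fctD
     (is_derive_fctM (w_derive t) (is_derive_fctM psid psid))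
     (is_derive_fctM (is_derive_fctM (is_derive_cst m t 1) id1) Ed)))
  (is_derive_fctM (is_derive_cst (a ^+ 2) t 1) (is_derive_fctB (is_derive_cst N t 1)
     (is_derive_fctM (is_derive_cst (3 : R) t 1) (is_derive_fctB (is_derive_cst (1 : R) t 1) (is_derive_fctM id1 kd))))).
have [_] := agree_derive (other_point (In_I It)) (In_I It) h0 hd.
have E1 : derive1 E t = A t * E t by rewrite /defA mulfVK.
rewrite E1 /= {hd psid Ad Ed h0 h kd E1}.
move: S1 S2 S3 D00; move: (A t) (A1 t) (E t) (kap t) (derive1 kap t) => x x1 e k k1 S1 S2 S3 D00 H.
have a20 : a ^+ 2 != 0 by rewrite sqrf_eq0.
have D1 : - (k + t * k1) = 0.
  have a23 : 3 * a ^+ 2 != 0 by rewrite mulf_neq0.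
  apply: (mulfI a23); rewrite mulr0 -H.
  apply/eqP; rewrite -subr_eq0; apply/eqP.
  transitivity ((N - 3) * (1 + t * x) * (mu - 2 * t * w t * x1 - (2 * w t - mu * t) * x - m * e)).
    by ring.
  by rewrite S1 subrr mulr0.
rewrite D1 in S2.
have S2' : w t * (1 + t * x) ^+ 2 + m * t * e = (1 - t * k) * a ^+ 2.
  apply: (mulfI D00); apply/eqP; rewrite -subr_eq0; apply/eqP.
  transitivity (((1 - t * k) * (1 + t * x) + t * 0) * w t * (1 + t * x) - ((1 - t * k) ^+ 2 * a ^+ 2 - m * (1 - t * k) * t * e)).
    by ring.
  by rewrite S2 subrr.
have D01 : 1 - t * k = 1.
  have N0 : N * a ^+ 2 != 0 by rewrite mulf_neq0// gt_eqF// (lt_trans _ N_gt2).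
  apply: (mulfI N0); apply/eqP; rewrite -subr_eq0; apply/eqP.
  rewrite S2' in S3; transitivity ((N - 3) * ((1 - t * k) * a ^+ 2) - a ^+ 2 * (N - 3 * (1 - t * k))).
    by ring.
  by rewrite S3 subrr.
by split=> //; rewrite S2' D01 mul1r.
Qed.

(** Elimination of [m] between the second-order equation and the first integral. In terms of [Fi]
    the result is [(Fi' sqrt w)' = 0]. *)
Lemma interior_rho t : In t -> w t * (r2 t - r1 t ^+ 2) = mu * r1 t / 2.
Proof.
move=> It; have Jt := IJ (In_I It).
have [S1 _ _] := sys It; have [_ S3] := interior_Delta It.
have t0 : t != 0 by rewrite gt_eqF// interior_gt0.
rewrite defA_rho// in S1 S3; rewrite defA1_rho// in S1.
have h : 4 * t ^+ 2 != 0 by rewrite mulf_neq0// expf_neq0.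
move: S1 S3; move: (r1 t) (r2 t) (E t) => x y e S1 S3.
apply: (mulfI h); apply/eqP; rewrite -subr_eq0; apply/eqP.
transitivity (- t * (mu - 2 * t * w t * (2 * y) - (2 * w t - mu * t) * (2 * x) - m * e)
  + (a ^+ 2 - (w t * (1 + t * (2 * x)) ^+ 2 + m * t * e))); first by field.
by rewrite S1 S3 !subrr mulr0 addr0.
Qed.

Lemma Fi_const c : (forall t, J t -> {for t, continuous c}) ->
  (forall t, In t -> Fi t = c t) -> forall t, I t -> 0 < c t /\ rho t = - ln (c t).
Proof.
move=> cc Fic t It; have Jt := IJ It.
have Fc : {for t, continuous Fi}.
  by apply: differentiable_continuous; apply/derivable1_diffP; case: (Fi_derive Jt).
have : Fi t - c t = 0.
  apply: (agree_at (h := fun x : R => Fi x - c x) (other_point It) It).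
    by move=> z Iz; rewrite Fic// subrr.
  by apply: continuousB => //; exact: cc.
move/eqP; rewrite subr_eq0 => /eqP <-; split; first exact: Fi_gt0.
by rewrite /Fi expRK opprK.
Qed.

Lemma forward : special_deformation.
Proof.
split.
  move=> t It; have Jt := IJ It.
  have kc : {for t, continuous (fun x : R => x * kap x)}.
    apply: differentiable_continuous; apply/derivable1_diffP.
    by case: (is_derive_fctM (is_derive_id t (1 : R)) (line_derive kapS Jt)).
  rewrite (agree_at (h := fun x => x * kap x) (other_point It) It _ kc) ?subr0// => z Iz.
  by have [e _] := interior_Delta Iz; rewrite -[LHS](subKr 1) e subrr.
have [t0 It0] := interior_inhabited.
have J0 := IJ (In_I It0).
have rd t : In t -> is_derive t 1 r1 (r2 t) by move=> It; exact: (line_derive2 rhoS (IJ (In_I It))).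
have Fd t : In t -> is_derive t 1 Fi (- r1 t * Fi t) by move=> It; exact: (Fi_derive (IJ (In_I It))).
have [_ S3] := interior_Delta It0; rewrite defA_rho// E_Fi in S3.
have F0 : Fi t0 != 0 by rewrite gt_eqF// Fi_gt0.
have t00 : t0 != 0 by rewrite gt_eqF// interior_gt0.
have [mu0|mu0] := eqVneq mu 0.
(* [Df] is the derivative of [Fi], and [Cf] the value at 0 of its tangent line; both are shown
   constant, and the base point [t0] only serves to name them. *)
- pose Df t := - (r1 t * Fi t); pose Cf t := Fi t + t * (r1 t * Fi t).
  have r2E t : In t -> r2 t = r1 t ^+ 2.
    move=> It; have := interior_rho It; rewrite mu0 !mul0r subr0 => /eqP.
    by rewrite mulf_eq0 sqrf_eq0 (negPf a_neq0) subr_eq0 => /eqP.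
  have Dd t : In t -> is_derive t 1 Df 0.
    move=> It; apply: is_derive_eq (is_derive_fctN (is_derive_fctM (rd t It) (Fd t It))) _.
    by rewrite r2E//; ring.
  have Cd t : In t -> is_derive t 1 Cf 0.
    move=> It; apply: is_derive_eq (is_derive_fctD (Fd t It) (is_derive_fctM (is_derive_id t (1 : R))
      (is_derive_fctM (rd t It) (Fd t It)))) _.
    by rewrite /= r2E//; ring.
  exists (Cf t0), (Df t0); split; last by move=> /(_ mu0).
  move=> _; split.
    apply: Fi_const => [t _|t It].
      by apply: continuousD; [exact: cst_continuous|apply: continuousM; [exact: cst_continuous|exact: id]].
    rewrite (const_on_interior I_interval Dd It0 It) (const_on_interior I_interval Cd It0 It).
    by rewrite /Cf /Df; ring.
  apply: (mulfI t00); apply: (mulIf (invr_neq0 (expf_neq0 2 F0))).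
  move: S3; rewrite mu0 mul0r subr0 /Cf /Df => /eqP; rewrite -subr_eq0 => /eqP S3.
  apply/eqP; rewrite -subr_eq0 -S3; apply/eqP.
  by move: (r1 t0) (Fi t0) F0 => x F F0; field.
pose u t := Num.sqrt (w t).
have u0 t : In t -> u t != 0 by move=> It; rewrite gt_eqF// sqrtr_gt0 interior_w.
have uE t : In t -> w t = u t ^+ 2 by move=> It; rewrite sqr_sqrtr// ltW// interior_w.
have ud t : In t -> is_derive t 1 u (- mu / (2 * u t)).
  move=> It; have := is_derive_fct_comp (f := fun x : R => w x) (is_derive1_sqrt (interior_w It)) (w_derive t).
  by move/is_derive_eq; apply; rewrite mulrC.
(* [Df] is the derivative of [Fi] with respect to [u], by the quotient of [- r1 * Fi] and
   [- mu / (2 * u)]. *)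
pose Df t := 2 / mu * (r1 t * Fi t * u t); pose Cf t := Fi t - Df t * u t.
have r2E t : In t -> r2 t = r1 t ^+ 2 + mu * r1 t / (2 * u t ^+ 2).
  move=> It; have := interior_rho It; rewrite uE// => H.
  have un := u0 t It; apply: (mulfI (expf_neq0 2 un)).
  apply/eqP; rewrite -subr_eq0; apply/eqP; move/eqP: H; rewrite -subr_eq0 => /eqP <-.
  by move: (r1 t) (r2 t) (u t) un => x y z un; field.
have Dd t : In t -> is_derive t 1 Df 0.
  move=> It; apply: is_derive_eq (is_derive_fctM (is_derive_cst (2 / mu) t 1)
    (is_derive_fctM (is_derive_fctM (rd t It) (Fd t It)) (ud t It))) _.
  rewrite /= r2E//; have := u0 t It; move: (r1 t) (Fi t) (u t) => x F z un.
  by field; rewrite mu0 un.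
have Cd t : In t -> is_derive t 1 Cf 0.
  move=> It; apply: is_derive_eq (is_derive_fctB (Fd t It) (is_derive_fctM (Dd t It) (ud t It))) _.
  rewrite /= /Df; have := u0 t It; move: (r1 t) (Fi t) (u t) => x F z un.
  by field; rewrite mu0 un.
exists (Cf t0), (Df t0); split; first by move=> e; rewrite e eqxx in mu0.
move=> _; split.
  apply: Fi_const => [t _|t It].
    apply: continuousD; first exact: cst_continuous.
    apply: continuousM; first exact: cst_continuous.
    apply: continuous_comp; last exact: sqrt_continuous.
    by apply: differentiable_continuous; apply/derivable1_diffP; case: (w_derive t).
  rewrite (const_on_interior I_interval Dd It0 It) (const_on_interior I_interval Cd It0 It).
  by rewrite /Cf -/(u t) subrK.
apply: (mulfI t00); apply: (mulIf (invr_neq0 (expf_neq0 2 F0))).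
have un := u0 t0 It0; have a2E : a ^+ 2 = u t0 ^+ 2 + mu * t0 by rewrite -uE// subrK.
move: S3; rewrite uE// a2E /Cf /Df => /eqP; rewrite -subr_eq0 => /eqP S3.
apply/eqP; rewrite -subr_eq0 -S3; apply/eqP.
by move: (r1 t0) (Fi t0) (u t0) F0 un => x F z F0 un; field; rewrite mu0 F0.
Qed.

End forward.

Section backward.
Hypothesis spec : special_deformation.

Lemma special_kap t : I t ->
  [/\ kap t = 0, derive1 kap t = 0 & derive1 (derive1 kap) t = 0].
Proof.
move=> It; have [K0 _] := spec.
(* At [t = 0] the equation Delta = 1 says nothing about [kap], so it is used in the interior only,
   and [agree_derive] carries the conclusion to end points. *)
have k0 z : In z -> kap z = 0.
  move=> Iz; have zn : z != 0 by rewrite gt_eqF// interior_gt0.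
  apply: (mulfI zn); rewrite mulr0 -[LHS](subKr 1) K0 ?subrr//; exact: In_I.
have k1 z : I z -> kap z = 0 /\ derive1 kap z = 0.
  by move=> Iz; apply: (agree_derive (other_point Iz) Iz k0); exact: line_derive kapS (IJ Iz).
have [? ?] := k1 t It.
have k1' z : In z -> derive1 kap z = 0 by move=> /In_I /k1[].
by have [_ ?] := agree_derive (other_point It) It k1' (line_derive2 kapS (IJ It)).
Qed.

Lemma special_system t : I t ->
  [/\ w t = 0 -> A t = 0 /\ A1 t = 0,
      2 * w t * A1 t = mu * A t + w t * A t ^+ 2,
      w t * (1 + t * A t) ^+ 2 + m * t * E t = a ^+ 2
    & mu - (2 * A t + A t ^+ 2 * t) * w t = m * E t].
Proof.
move=> It; have Jt := IJ It; have [_ [C [D [sp0 sp1]]]] := spec.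
have F0 : Fi t != 0 by rewrite gt_eqF// Fi_gt0.
have a20 : a ^+ 2 != 0 by rewrite sqrf_eq0.
have rd z : I z -> is_derive z 1 r1 (r2 z) by move=> Iz; exact: (line_derive2 rhoS (IJ Iz)).
have Fd z : I z -> is_derive z 1 Fi (- r1 z * Fi z) by move=> Iz; exact: (Fi_derive (IJ Iz)).
rewrite defA_rho// defA1_rho// E_Fi.
have FE c z : 0 < c -> rho z = - ln c -> Fi z = c.
  by move=> c0; rewrite /Fi => ->; rewrite opprK lnK.
have [mu0|mu0] := eqVneq mu 0.
  have [FC mE] := sp0 mu0.
  have FCE z : I z -> Fi z = C + D * z by move=> /FC[c0]; exact: FE.
  have H1 z : I z -> - r1 z * Fi z - D = 0.
    move=> Iz; have hd := is_derive_fctB (Fd z Iz) (is_derive_fctD (is_derive_cst C z 1)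
      (is_derive_fctM (is_derive_cst D z 1) (is_derive_id z (1 : R)))).
    have [|_] := agree_derive (other_point Iz) Iz _ hd.
      by move=> x /In_I Ix; rewrite /= FCE// subrr.
    by rewrite /= mulr1 mul0r !add0r.
  have hd := is_derive_fctB (is_derive_fctM (is_derive_fctN (rd t It)) (Fd t It)) (is_derive_cst D t 1).
  have [|_ H2] := agree_derive (other_point It) It _ hd; first by move=> x /In_I; exact: H1.
  have r2E : r2 t = r1 t ^+ 2.
    apply: (mulIf F0); apply/eqP; rewrite -subr_eq0 -oppr_eq0; apply/eqP.
    by rewrite -H2 /=; move: (r1 t) (r2 t) (Fi t) => *; ring.
  have DE : D = - (r1 t * Fi t) by apply/eqP; rewrite eq_sym -mulNr -subr_eq0 H1.
  have CE : C = Fi t + t * (r1 t * Fi t).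
    by rewrite -[LHS](addrK (D * t)) -(FCE t It) DE; ring.
  rewrite mE CE DE r2E mu0 !mul0r subr0.
  split; first by move=> e; rewrite e eqxx in a20.
  - by ring.
  - by move: (r1 t) (Fi t) F0 => x F Fn; field.
  - by move: (r1 t) (Fi t) F0 => x F Fn; field.
have [FC mE] := sp1 (elimN eqP mu0).
have FCE z : I z -> Fi z = C + D * Num.sqrt (w z) by move=> /FC[c0]; exact: FE.
(* The root need not be differentiable where [w] vanishes, so the squared relation between [Fi] and
   [w] is differentiated, twice. *)
have wE z : I z -> (Fi z - C) * (Fi z - C) - D ^+ 2 * w z = 0.
  move=> Iz; rewrite FCE// -[in X in _ - X](sqr_sqrtr (w_ge0 Iz)).
  by move: (Num.sqrt _) => u; ring.
have dwE z : I z -> 2 * (Fi z - C) * (- r1 z * Fi z) + D ^+ 2 * mu = 0.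
  move=> Iz; have Fcd := is_derive_fctB (Fd z Iz) (is_derive_cst C z 1).
  have hd := is_derive_fctB (is_derive_fctM Fcd Fcd) (is_derive_fctM (is_derive_cst (D ^+ 2) z 1) (w_derive z)).
  have [|_ H] := agree_derive (other_point Iz) Iz _ hd; first by move=> x /In_I; exact: wE.
  by rewrite -H /=; move: (r1 z) (Fi z) => *; ring.
have ddwE : (r1 t * Fi t) ^+ 2 + (Fi t - C) * ((r1 t ^+ 2 - r2 t) * Fi t) = 0.
  have Fcd := is_derive_fctB (Fd t It) (is_derive_cst C t 1).
  have hd := is_derive_fctD (is_derive_fctM (is_derive_fctM (is_derive_cst (2 : R) t 1) Fcd)
    (is_derive_fctM (is_derive_fctN (rd t It)) (Fd t It))) (is_derive_cst (D ^+ 2 * mu) t 1).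
  have [|_ H] := agree_derive (other_point It) It _ hd; first by move=> x /In_I; exact: dwE.
  have two0 : (2 : R) != 0 by rewrite pnatr_eq0.
  apply: (mulfI two0); rewrite mulr0 -H /=; move: (r1 t) (r2 t) (Fi t) => *; ring.
have D0_case : D = 0 -> r1 t = 0 /\ r2 t = 0.
  move=> D0.
  have FCz z : I z -> Fi z - C = 0 by move=> /FCE ->; rewrite D0 mul0r addr0 subrr.
  have r1z z : I z -> r1 z = 0.
    move=> Iz; have [|_ H] := agree_derive (other_point Iz) Iz _ (is_derive_fctB (Fd z Iz) (is_derive_cst C z 1)).
      by move=> x /In_I; exact: FCz.
    have Fz : Fi z != 0 by rewrite gt_eqF// Fi_gt0.
    by apply: (mulIf Fz); apply/eqP; rewrite -eqr_opp -mulNr mul0r oppr0 -[X in X == _]subr0 H.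
  split; first exact: r1z.
  by have [|_ ->] := agree_derive (other_point It) It _ (rd t It); first by move=> x /In_I; exact: r1z.
have := wE t It; have := dwE t It; move: ddwE => H2 H1 H0.
have [D0|D0] := eqVneq D 0.
  have [-> ->] := D0_case D0.
  have CE : C = Fi t by rewrite (FCE t It) D0 mul0r addr0.
  rewrite mE D0 CE; split=> //; first by rewrite !mulr0.
  - by ring.
  - by move: (Fi t) F0 => F Fn; field.
  - by move: (Fi t) F0 => F Fn; field.
have D2 : D ^+ 2 != 0 by rewrite sqrf_eq0.
have Cn : C = Fi t - (Fi t - C) by rewrite subKr.
rewrite mE Cn; move: (Fi t - C) H0 H1 H2 => x H0 H1 H2.
have wx : w t = x ^+ 2 / D ^+ 2 by move/eqP: H0; rewrite subr_eq0 -expr2 => /eqP ->; rewrite [RHS]mulrC mulKf.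
have muE : mu = 2 * x * (r1 t * Fi t) / D ^+ 2.
  apply: (mulIf D2); rewrite mulfVK// mulrC; apply/eqP; rewrite -subr_eq0 -H1; apply/eqP.
  by move: (r1 t) (Fi t) => *; ring.
(* Since [x ^+ 2 = D ^+ 2 * w], this shows that [w] cannot vanish unless [D = 0], the case of
   constant [rho] already settled. *)
have x0 : x != 0.
  by apply: contraNneq mu0 => xz; rewrite muE xz mulr0 !mul0r.
have y0 : r1 t * Fi t != 0.
  by apply: contraNneq mu0 => yz; rewrite muE yz mulr0 mul0r.
have r2E : r2 t = r1 t ^+ 2 + r1 t ^+ 2 * Fi t / x.
  apply: (mulIf F0); apply: (mulIf x0); apply/eqP; rewrite -subr_eq0 -oppr_eq0; apply/eqP.
  by rewrite -H2; move: (r1 t) (r2 t) (Fi t) => *; field.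
have a2E : a ^+ 2 = x ^+ 2 / D ^+ 2 + mu * t by rewrite -wx subrK.
rewrite wx a2E muE r2E; split.
- by move/eqP; rewrite mulf_eq0 sqrf_eq0 (negPf x0) invr_eq0 (negPf D2).
all: by move: (r1 t) (Fi t) F0 => z F Fn; field; rewrite ?x0 ?D0 ?Fn.
Qed.

End backward.

End value_interval.

(** * From charts to the manifold *)

Section manifold.
Context {R : realType} {n : nat} {M : topologicalType} (Mn : smooth_manifold R n M).
Variables (g : bilinear_field Mn) (b : form_field Mn).
Hypothesis gR : is_riemannian_metric g.
Hypothesis bF : is_one_form b.

Lemma chart_metric i : metric_on (coords i) (g i).
Proof.
have [gs _ gT gp] := gR; split.
- exact: image_open.
- by move=> m k l; apply: smooth_on_Cm; exact: gs.
- exact: gT.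
- exact: gp.
Qed.

Lemma chart_form i : form_on (coords i) (b i).
Proof. by split=> m k; apply: smooth_on_Cm; exact: bF.1. Qed.

Lemma normsq_transition i j p : overlap i j p ->
  normsq (g i) (b i) p = normsq (g j) (b j) (transition i j p).
Proof.
move=> ov; have [_ gtr _ _] := gR; have [_ btr] := bF.
have Ui : coords i p by case: ov.
have Uj : coords j (transition i j p) by case: ov => _ dj; exists (par i p).
rewrite (normsqE (chart_metric i) (b i) Ui) (normsqE (chart_metric j) (b j) Uj).
set q := transition i j p; set K := 'J (transition i j) p.
have gE : g i p = K *m g j q *m K^T := gtr i j p ov.
have bE : b i p = b j q *m K^T := btr i j p ov.
(* Invertibility of the Jacobian is read off from that of the metric matrix in the first chart. *)
have Ku : K \in unitmx.
  by have := metric_unit (chart_metric i) Ui; rewrite gE !unitmx_mul => /andP[/andP[]].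
have -> : sharp (g i) p (b i p) = sharp (g j) q (b j q) *m invmx K.
  apply: (can_inj (mulmxK (metric_unit (chart_metric i) Ui))).
  rewrite {1}/sharp mulmxKV ?(metric_unit (chart_metric i))// gE bE.
  rewrite !mulmxA -(mulmxA (sharp _ _ _) (invmx K) K) mulVmx// mulmx1.
  by rewrite /sharp mulmxKV ?(metric_unit (chart_metric j)).
by rewrite bE dot_mulmx trmxK -mulmxA mulVmx// mulmx1.
Qed.

Lemma exists_chart x : exists i, dom (s := Mn) i x.
Proof.
have : [set: M] x by [].
by rewrite -(dom_cover Mn) => -[i _ di]; exists i.
Qed.

Definition chart_at x : chart_index Mn := projT1 (cid (exists_chart x)).

Lemma chart_atP x : dom (chart_at x) x.
Proof. exact: projT2 (cid (exists_chart x)). Qed.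

(** The squared length as a function on [M] itself, where connectedness applies; the choice of chart
    is immaterial by [length_sqE]. *)
Definition length_sq x : R :=
  normsq (g (chart_at x)) (b (chart_at x)) (chart (chart_at x) x).

Lemma length_sqE i x : dom i x -> length_sq x = normsq (g i) (b i) (chart i x).
Proof.
move=> dx; have dc := chart_atP x.
rewrite /length_sq (normsq_transition (j := i)); last first.
  by split; [exists x|rewrite /= chartK].
by rewrite /transition chartK.
Qed.

Lemma length_sq_continuous : continuous length_sq.
Proof.
move=> x; have [i dx] := exists_chart x.
have ci : {for x, continuous (chart i)}.
  have := chart_continuous (s := Mn) (i := i).
  by rewrite continuous_open_subspace ?inE => [/(_ x)|]; [apply; rewrite inE|exact: dom_open].
have cx : coords i (chart i x) by exists x.
have nc : {for chart i x, continuous (normsq (g i) (b i))}.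
  exact: Cm_continuous (normsq_Cm (chart_metric i) (chart_form i) 0) cx.
have H : {for x, continuous (fun y => normsq (g i) (b i) (chart i y))}.
  exact: continuous_comp ci nc.
rewrite /continuous_at (length_sqE dx).
apply: cvg_trans H; apply: near_eq_cvg.
have dn : nbhs x (dom i) by exact: (open_nbhs_nbhs (conj (dom_open i) dx)).
by apply: filterS dn => y dy; rewrite (length_sqE dy).
Qed.

Lemma b2_value_interval : connected [set: M] -> is_interval (b2_value g b).
Proof.
move=> Mc; have -> : b2_value g b = length_sq @` [set: M].
  apply/seteqP; split=> [t [i [p [[x dx <-] ->]]]|t [x _ <-]].
    by exists x => //; exact: length_sqE.
  by exists (chart_at x), (chart (chart_at x) x); split=> //; exists x => //; exact: chart_atP.
apply/connected_intervalP; apply: connected_continuous_connected Mc _.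
exact/continuous_subspaceT/length_sq_continuous.
Qed.

Lemma b2_value_nontrivial : nonconstant_length g b ->
  exists x y, [/\ b2_value g b x, b2_value g b y & x < y].
Proof.
move=> [i [j [p [q [cp cq pq]]]]].
have vp : b2_value g b (normsq (g i) (b i) p) by exists i, p.
have vq : b2_value g b (normsq (g j) (b j) q) by exists j, q.
have : normsq (g i) (b i) p != normsq (g j) (b j) q.
  by apply/eqP => e; apply: pq; rewrite /norm e.
by rewrite neq_lt => /orP[h|h]; [exists (normsq (g i) (b i) p), (normsq (g j) (b j) q)
  |exists (normsq (g j) (b j) q), (normsq (g i) (b i) p)].
Qed.

End manifold.

Lemma normsq_scale (R : realType) (n : nat) (g : 'rV[R]_n -> 'M[R]_n)
    (b b' : 'rV[R]_n -> 'rV[R]_n) p (c : R) :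
  b' p = c *: b p -> normsq g b' p = c ^+ 2 * normsq g b p.
Proof.
move=> e; rewrite /normsq mulr_sumr; apply: eq_bigr => i _.
rewrite /bup e mxE expr2 -!mulrA; congr (_ * _); rewrite mulrCA; congr (_ * _).
by rewrite mulr_sumr; apply: eq_bigr => j _; rewrite mxE mulrCA.
Qed.

Lemma beta_scale (R : realType) (n : nat) (b b' : 'rV[R]_n -> 'rV[R]_n) p y (c : R) :
  b' p = c *: b p -> beta b' p y = c * beta b p y.
Proof.
by move=> e; rewrite /beta mulr_sumr; apply: eq_bigr => i _; rewrite e mxE mulrA.
Qed.

Lemma Rbb_condition_scale (R : realType) (n : nat) (g : 'rV[R]_n -> 'M[R]_n)
    (b b' : 'rV[R]_n -> 'rV[R]_n) p y (c m : R) : b' p = c *: b p ->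
  Rbb g b p y = m * (normsq g b p * alpha2 g p y - beta b p y ^+ 2) ->
  Rbb g b' p y = m * (normsq g b' p * alpha2 g p y - beta b' p y ^+ 2).
Proof.
move=> e; rewrite (Rbb_scale g y e) (normsq_scale g e) (beta_scale y e) => ->.
by move: (normsq _ _ _) (alpha2 _ _ _) (beta _ _ _) => *; ring.
Qed.

Theorem theorem6p1 (R : realType) (n : nat) (M : topologicalType)
    (A : smooth_manifold R n M) (g : bilinear_field A) (b : form_field A)
    (mu a : R) (J : set R) (rho kappa nu : R -> R) :
  (2 < n)%N ->
  connected [set: M] ->
  is_riemannian_metric g ->
  is_one_form b ->
  constant_ricci g mu ->
  killing_form g b ->
  nonconstant_length g b ->
  a != 0 ->
  t00_condition g b a mu ->
  Rbb_condition g b mu ->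
  open J ->
  (forall t, b2_value g b t -> J t) ->
  smooth_on_line J rho ->
  smooth_on_line J kappa ->
  smooth_on_line J nu ->
  (forall t, b2_value g b t -> 0 < 1 - t * kappa t) ->
  (forall t, b2_value g b t -> nu t != 0) ->
  let gbar := deform_metric rho kappa g b in
  let bbar := deform_form nu g b in
  forall mubar : R,
  let special :=
    (forall t, b2_value g b t -> 1 - t * kappa t = 1) /\
    exists C D : R,
      (mu = 0 ->
         (forall t, b2_value g b t ->
            0 < C + D * t /\ rho t = - ln (C + D * t)) /\
         mubar = 4 * C * D * a ^+ 2) /\
      (mu <> 0 ->
         (forall t, b2_value g b t ->
            0 < C + D * Num.sqrt (a ^+ 2 - mu * t) /\
            rho t = - ln (C + D * Num.sqrt (a ^+ 2 - mu * t))) /\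
         mubar = (C ^+ 2 - D ^+ 2 * a ^+ 2) * mu) in
  ((constant_ricci gbar mubar /\ Rbb_condition gbar bbar mubar) <-> special) /\
  (special ->
   forall k : R, k != 0 ->
   (forall t, b2_value g b t ->
      nu t = k * (1 - t * kappa t) * expR (2 * rho t)) ->
   killing_form gbar bbar /\
   forall abar : R, abar = k * a \/ abar = - (k * a) ->
   t00_condition gbar bbar abar mubar).
Proof.
move=> n_gt2 Mc gR bF ricE bK bN a0 t00E RbbE Jo IJ rhoS kapS _ Dgt0 nu0 gbar bbar m.
move=> special.
have gU i := chart_metric gR i; have bU i := chart_form bF i.
have bKU i : killing_on (coords i) (g i) (b i) := bK i.
have inI i p : coords i p -> b2_value g b (normsq (g i) (b i) p) by move=> cp; exists i, p.
have UJ i p : coords i p -> J (normsq (g i) (b i) p) by move=> cp; exact/IJ/inI.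
have ES := smooth_expR Jo rhoS.
have Egt0 i p : coords i p -> 0 < expR (rho (normsq (g i) (b i) p)) ^+ 2.
  by move=> _; rewrite exprn_gt0// expR_gt0.
have Dgt i p : coords i p -> 0 < 1 - normsq (g i) (b i) p * kappa (normsq (g i) (b i) p).
  by move=> cp; exact/Dgt0/inI.
have Iint := b2_value_interval gR bF Mc.
have Inon := b2_value_nontrivial bN.
have Ige0 t : b2_value g b t -> 0 <= t by move=> [i [p [cp ->]]]; exact: normsq_ge0 (gU i) p cp.
have wge0 t : b2_value g b t -> 0 <= a ^+ 2 - mu * t.
  by move=> [i [p [cp ->]]]; exact: (w_ge0 (gU i) (bU i) (bKU i) (t00E i) (RbbE i) cp).
have specE : special = special_deformation (b2_value g b) rho kappa a mu m by [].
set E := fun t => expR (rho t) ^+ 2.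
have defN0 k i p : k != 0 -> coords i p -> defN E kappa k (normsq (g i) (b i) p) != 0.
  move=> k0 cp; apply: mulf_neq0; last by rewrite gt_eqF//; exact: Egt0.
  by apply: mulf_neq0 => //; rewrite gt_eqF//; exact: Dgt.
(* The factor [c] is nonzero because [nu] is, so the [R_bb] condition passes from [bbar] to the dual
   form and back. *)
have dualP i p : coords i p -> exists2 c, c != 0 &
    bbar i p = c *: dual_form (g i) (b i) E kappa 1 p.
  move=> cp; set t := normsq (g i) (b i) p.
  have d0 := defN0 1 i p (oner_neq0 R) cp.
  exists (nu t / defN E kappa 1 t); last by rewrite /dual_form scalerA mulfVK.
  by apply: mulf_neq0; [exact/nu0/inI|exact: invr_neq0].
(* The converse and the last claim rest on the same equations for [E]. The [t_00] condition is
   obtained for the dual form, which over each chart domain coincides with [bbar] under the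
   assumption on [nu]. *)
have core : special -> [/\ constant_ricci gbar m, Rbb_condition gbar bbar m &
    forall k, k != 0 -> forall abar, abar ^+ 2 = k ^+ 2 * a ^+ 2 ->
      t00_condition gbar (fun i => dual_form (g i) (b i) E kappa k) abar m].
  rewrite specE => sp.
  have K0 i p (cp : coords i p) := special_kap Iint Inon IJ kapS Ige0 sp (inI i p cp).
  have Y i p (cp : coords i p) := special_system Iint Inon Jo IJ rhoS a0 wge0 sp (inI i p cp).
  have k0 i p : coords i p -> kappa (normsq (g i) (b i) p) = 0 by move=> cp; case: (K0 i p cp).
  have k1 i p : coords i p -> derive1 kappa (normsq (g i) (b i) p) = 0 by move=> cp; case: (K0 i p cp).
  have k2 i p : coords i p -> derive1 (derive1 kappa) (normsq (g i) (b i) p) = 0.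
    by move=> cp; case: (K0 i p cp).
  have Y1 i p (cp : coords i p) (w0 : a ^+ 2 - mu * normsq (g i) (b i) p = 0) :
      defA E (normsq (g i) (b i) p) = 0 by case: (Y i p cp) => /(_ w0)[].
  have Y2 i p (cp : coords i p) (w0 : a ^+ 2 - mu * normsq (g i) (b i) p = 0) :
      defA1 (E := E) (normsq (g i) (b i) p) = 0 by case: (Y i p cp) => /(_ w0)[].
  have Y3 i p (cp : coords i p) := let: And4 _ h _ _ := Y i p cp in h.
  have Y4 i p (cp : coords i p) := let: And4 _ _ h _ := Y i p cp in h.
  have Y5 i p (cp : coords i p) := let: And4 _ _ _ h := Y i p cp in h.
  split=> [i p cp y|i p cp y|k kn0 abar abarE i p cp y].
  - exact: (ricci_concircular (gU i) (bU i) (bKU i) n_gt2 a0 (t00E i) (RbbE i) (ricE i) (UJ i) ES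
      kapS (Egt0 i) (k0 i) (k1 i) (k2 i) (Y1 i) (Y2 i) (Y3 i) (Y5 i)).
  - have [c _ e] := dualP i p cp; apply: (Rbb_condition_scale e).
    exact: (Rbb_concircular (gU i) (bU i) (bKU i) a0 (t00E i) (RbbE i) (UJ i) ES
      kapS (Egt0 i) (k0 i) (k1 i) (k2 i) (Y1 i) (Y2 i) (Y3 i) (Y4 i) (Y5 i)).
  - exact: (t00_condition_concircular (gU i) (bU i) (bKU i) a0 (t00E i) (RbbE i) (UJ i) ES
      kapS (Egt0 i) (k0 i) (k1 i) (Y1 i) (Y3 i) (Y4 i) (Y5 i)).
split; first split=> [[ricbar Rbbbar]|/core[]//].
- rewrite specE; apply: (forward Iint Inon Jo IJ rhoS kapS a0 Ige0 wge0 (N := n%:R)) => //.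
    by rewrite ltr_nat.
  (* The equations hold at every interior value because it is attained at some point, and such a
     point is regular: neither [f] nor [w] vanishes there. *)
  move=> t It; have [i [p [cp tE]]] := interior_of_sub Iint It; rewrite tE in It *.
  apply: (regular_system (gU i) (bU i) (bKU i) n_gt2 a0 (t00E i) (RbbE i) (ricE i) (UJ i) ES
    kapS (Egt0 i) (Dgt i) (ricbar i)) => //.
  + move=> q cq y; have [c c0 e] := dualP i q cq.
    apply: (Rbb_condition_scale (b := bbar i) (c := c^-1)); last exact: Rbbbar.
    by rewrite e scalerK.
  + by rewrite gt_eqF// (interior_gt0 Ige0 It).
  + by rewrite gt_eqF// (interior_w a0 wge0 It).
- move=> sp k k0 nuE.
  have bbE i q : coords i q -> dual_form (g i) (b i) E kappa k q = bbar i q.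
    by move=> cq; rewrite /bbar /deform_form nuE ?expRM_natl//; exact: inI.
  split=> [i p cp j l|abar abarE i p cp y].
    have Uo : open (coords i) by exact: image_open.
    rewrite -!(covd_eq_on Uo (gbar i) _ _ cp (bbE i)).
    exact: (killing_dual (gU i) (bU i) (bKU i) (UJ i) ES kapS (Egt0 i) (Dgt i) k cp).
  have Uo : open (coords i) by exact: image_open.
  have [_ _ T] := core sp.
  have abar2 : abar ^+ 2 = k ^+ 2 * a ^+ 2 by case: abarE => ->; rewrite ?sqrrN exprMn.
  have [v vq vE] := T k k0 abar abar2 i p cp y.
  exists v.
    apply: quotient_value_eq_on cp _ _ vq => // q cq.
      by rewrite (s0_eq_on Uo (gbar i) y cq (bbE i)).
    by rewrite (normsq_eq_at (gbar i) (bbE i q cq)).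
  rewrite -(t00_eq_on Uo (gbar i) y cp (bbE i)) -(normsq_eq_at (gbar i) (bbE i p cp)).
  by have -> : beta (bbar i) p y = beta (dual_form (g i) (b i) E kappa k) p y
    by rewrite /beta -(bbE i p cp).
Qed.
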